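(* Let $\mathcal{G}$ be the X graph: a star-graph with four edges meeting at one interior vertex, two of them ($e_1$ and $e_2$) of length $\ell_{\rm b}>0$ and two ($e_3$ and $e_4$) of length $\ell_{\rm t}>0$. Let $\omega$ be an open subset of $\mathcal{G}$ having exactly two non-empty parts, one in $e_1$ and one in $e_3$ (that is, $\omega\subset e_1\cup e_3$, $\omega\cap e_1\neq\emptyset$ and $\omega\cap e_3\neq\emptyset$), and let $\Delta_{\mathcal{G}}$ be the Laplacian with Dirichlet boundary conditions at the four exterior vertices. The Schrödinger equation $$i\partial_tu=-\Delta_{\mathcal{G}}u+h1_\omega,\quad t>0,\qquad u(t=0)=u_0\in L^2(\mathcal{G})$$ is exactly controllable in $L^2(\mathcal{G})$ for some time $T>0$ if and only if the ratio $\ell_{\rm t}/\ell_{\rm b}$ is a badly approximable number.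
   Context: Each edge $e_j$, of length $\ell_j$, is identified with $(0,\ell_j)$, the end $0$ being the common interior vertex and the end $\ell_j$ the exterior vertex. $\mathcal{G}$ is identified with the disjoint union of its edges, and open subsets are those of this disjoint union. $L^2(\mathcal{G})=\prod_{j=1}^4L^2(0,\ell_j)$, complex-valued. $D(\Delta_{\mathcal{G}})$ is the set of $u=(u_j)\in\prod_{j=1}^4H^2(0,\ell_j)$ with $u_1(0)=u_2(0)=u_3(0)=u_4(0)$, $\sum_{j=1}^4\partial_xu_j(0)=0$ (Kirchhoff's condition) and $u_j(\ell_j)=0$ for all $j$; $(\Delta_{\mathcal{G}}u)_j=\partial_x^2u_j$. The equation is exactly controllable at time $T>0$ if for all $u_0,u_1\in L^2(\mathcal{G};\mathbb{C})$ there exists $h\in L^2((0,T)\times\omega;\mathbb{C})$ such that the solution $u\in C([0,T];L^2(\mathcal{G}))$ with $u(t=0)=u_0$ satisfies $u(t=T)=u_1$. A real number $\alpha$ is badly approximable if there exists $C>0$ such that, for all $(p,q)\in\mathbb{Z}\times\mathbb{N}^*$, $\left|\alpha-\frac pq\right|\ge\frac{C}{q^2}$. *)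

(* Defs.v *)
From HB Require Import structures.
From mathcomp Require Import all_boot all_order all_algebra.
From mathcomp Require Import all_classical all_reals all_analysis.
From mathcomp Require Import complex.

Set Implicit Arguments.
Unset Strict Implicit.
Unset Printing Implicit Defensive.
Import Order.TTheory GRing.Theory Num.Theory.
Import numFieldNormedType.Exports.
Local Open Scope classical_set_scope.
Local Open Scope ring_scope.
Local Open Scope complex_scope.

(* Elements of L^2 are handled through Borel measurable representatives;
   identities between classes are stated almost everywhere. *)

Definition cintegral (d : measure_display) (X : measurableType d) (R : realType)
    (mu : {measure set X -> \bar R}) (D : set X) (f : X -> R[i]) : R[i] :=
  (\int[mu]_(x in D) complex.Re (f x)) +i* (\int[mu]_(x in D) complex.Im (f x)).

Definition L2 (d : measure_display) (X : measurableType d) (R : realType)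
    (mu : {measure set X -> \bar R}) (D : set X) (f : X -> R[i]) : Prop :=
  [/\ measurable_fun D (fun x => complex.Re (f x)),
      measurable_fun D (fun x => complex.Im (f x)) &
      mu.-integrable D (fun x => (Normc.normc (f x) ^+ 2)%:E)].

Section OneInterval.
Context {R : realType}.
Local Notation leb := (@lebesgue_measure R).

(* C^1 functions with compact support in (0, l). *)
Definition test_function (l : R) (theta : R -> R) : Prop :=
  [/\ forall x, derivable theta x 1,
      continuous (derive1 theta) &
      exists K : set R, [/\ compact K, K `<=` `]0, l[%classic &
        forall x, ~ K x -> theta x = 0]].

Definition weak_derivative (l : R) (f g : R -> R[i]) : Prop :=
  forall theta, test_function l theta ->
    cintegral leb `]0, l[%classic (fun x => f x * (derive1 theta x)%:C) =
    - cintegral leb `]0, l[%classic (fun x => g x * (theta x)%:C).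

Definition continuous_on_closed (l : R) (f : R -> R[i]) : Prop :=
  {within `[0, l]%classic, continuous (fun x => complex.Re (f x))} /\
  {within `[0, l]%classic, continuous (fun x => complex.Im (f x))}.

(* f is in H^2(0, l), with weak derivatives f1 and f2; f and f1 are the
   continuous representatives on [0, l], so that their values at 0 and l are
   the traces. *)
Definition H2 (l : R) (f f1 f2 : R -> R[i]) : Prop :=
  [/\ L2 leb `]0, l[%classic f, L2 leb `]0, l[%classic f1
    & L2 leb `]0, l[%classic f2] /\
  [/\ weak_derivative l f f1, weak_derivative l f1 f2,
      continuous_on_closed l f & continuous_on_closed l f1].

End OneInterval.

(* The star graph with n edges of lengths ell j; a function on the graph is a
   family of functions on the intervals (0, ell j), 0 being the common vertex. *)
Section StarGraph.
Context {R : realType} {n : nat}.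
Variable ell : 'I_n -> R.
Local Notation leb := (@lebesgue_measure R).
Local Notation edge j := (`]0, ell j[%classic : set R).

Definition L2G (f : 'I_n -> R -> R[i]) : Prop :=
  forall j, L2 leb (edge j) (f j).

Definition eqG (f g : 'I_n -> R -> R[i]) : Prop :=
  forall j, ae_eq leb (edge j) (f j) (g j).

Definition innerG (f g : 'I_n -> R -> R[i]) : R[i] :=
  \sum_j cintegral leb (edge j) (fun x => f j x * conjc (g j x)).

Definition normG (f : 'I_n -> R -> R[i]) : R :=
  Num.sqrt (\sum_j \int[leb]_(x in edge j) Normc.normc (f j x) ^+ 2).

(* The graph of the Laplacian: f is in its domain and g is its value at f. *)
Definition laplacian (f g : 'I_n -> R -> R[i]) : Prop :=
  exists f1 : 'I_n -> R -> R[i],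
  [/\ forall j, H2 (ell j) (f j) (f1 j) (g j),
      forall j k, f j 0 = f k 0,
      \sum_j f1 j 0 = 0 &
      forall j, f j (ell j) = 0].

Definition open_subset (omega : 'I_n -> set R) : Prop :=
  forall j, open (omega j) /\ omega j `<=` edge j.

Definition L2_control (omega : 'I_n -> set R) (T : R)
    (h : 'I_n -> R * R -> R[i]) : Prop :=
  forall j, L2 (leb \x leb)%E (`]0, T[%classic `*` omega j) (h j).

Definition cut_off (omega : 'I_n -> set R) (h : 'I_n -> R * R -> R[i]) (s : R) :
    'I_n -> R -> R[i] :=
  fun j x => h j (s, x) * (\1_(omega j) x)%:C.

Definition continuous_L2G (T : R) (u : R -> 'I_n -> R -> R[i]) : Prop :=
  (forall t, t \in `[0, T] -> L2G (u t)) /\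
  (forall t, t \in `[0, T] ->
    (fun s => normG (fun j x => u s j x - u t j x))
      @ within `[0, T]%classic (nbhs t) --> (0 : R)).

(* u in C([0,T]; L^2) solves  i u' = - Lap u + h 1_omega : since Lap is
   self-adjoint, the mild (Duhamel) solution is the unique u such that, for all
   phi in the domain of Lap,
     (d/dt) <u, phi> = i <u, Lap phi> - i <h 1_omega, phi>,
   written here in integrated form. *)
Definition schrodinger_solution (omega : 'I_n -> set R) (T : R)
    (h : 'I_n -> R * R -> R[i]) (u : R -> 'I_n -> R -> R[i]) : Prop :=
  continuous_L2G T u /\
  forall phi lap_phi, laplacian phi lap_phi -> forall t, t \in `[0, T] ->
    innerG (u t) phi = innerG (u 0) phi +
      cintegral leb `]0, t[%classic (fun s =>
        (0 +i* 1) * innerG (u s) lap_phi - (0 +i* 1) * innerG (cut_off omega h s) phi).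

Definition exactly_controllable (omega : 'I_n -> set R) (T : R) : Prop :=
  forall u0 u1, L2G u0 -> L2G u1 ->
  exists h, L2_control omega T h /\
  exists u, [/\ schrodinger_solution omega T h u,
                eqG (u 0) u0 & eqG (u T) u1].

End StarGraph.

(* The edges e_1, e_2, e_3, e_4 are numbered 0, 1, 2, 3. *)
Definition X_length (R : realType) (ell_b ell_t : R) (j : 'I_4) : R :=
  if (j < 2)%N then ell_b else ell_t.

Definition badly_approximable (R : realType) (alpha : R) : Prop :=
  exists2 C : R, 0 < C & forall (p : int) (q : nat), (0 < q)%N ->
    C / q%:R ^+ 2 <= `|alpha - p%:~R / q%:R|.

(* Main.v *)
From HB Require Import structures.
Require Import Defs.
From mathcomp Require Import all_boot all_order all_algebra.
From mathcomp Require Import all_classical all_reals all_analysis.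
From mathcomp Require Import measurable_realfun complex ring lra.
Set Implicit Arguments.
Unset Strict Implicit.
Unset Printing Implicit Defensive.
Import Order.TTheory GRing.Theory Num.Theory.
Import numFieldNormedType.Exports.
Local Open Scope classical_set_scope.
Local Open Scope ring_scope.
Local Notation Re := complex.Re.
Local Notation Im := complex.Im.
Local Notation integrableR mu D f := (integrable mu D (EFin \o f)).
Local Notation "x %:C" := (real_complex _ x) : ring_scope.

(** Write [lb] and [lt] for the two lengths and [al] for [lt / lb]. Exchanging the two edges of a
    pair commutes with the Laplacian, so its eigenfunctions split into three families: those odd on
    the pair of length [lb], of frequency [k * pi / lb]; those odd on the pair of length [lt], of
    frequency [m * pi / lt]; and the even ones, which are the Dirichlet eigenfunctions of an
    interval of length [lb + lt], of frequency [n * pi / (lb + lt)]. Together they form an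
    orthonormal basis ([xphi_orthonormal], [xphi_total]), the eigenvalues of minus the Laplacian
    being the squared frequencies.

    Testing the equation with an eigenfunction gives a scalar equation, solved by Duhamel's formula.
    Steering [u0] to [u1] therefore amounts to prescribing the scalar products, over the time
    interval times [omega], of the control with the waves [conjc (cexp la s)] times eigenfunction: a
    moment problem with square-summable data ([solution_moment]).

    If [al] is badly approximable, frequencies of different families differ by at least a constant
    over some integer [q] while their sum is at least a constant times [q]. The difference of their
    squares is then bounded below, so the eigenvalues are uniformly separated ([spectral_gap]).
    Multiply the waves by [sin (pi / T * s)]: the off-diagonal Gram entries are at most of order the
    inverse of [T] times the squared eigenvalue gap, whereas the diagonal is at least proportional
    to [T], because every eigenfunction is visible in [e_1] or in [e_3] with a mass on [omega]
    bounded below ([omega_lower]). For large [T] the Gram matrix is diagonally dominant and the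
    moment problem is solvable ([diagonal_dominance], [moment_problem], [control_moments]). A state
    with the resulting coefficients is then built, and it solves the equation ([state_continuous],
    [state_weak_equation]).

    If [al] is not badly approximable, some [p] and [q] make [q * |q * al - p|] as small as desired.
    The frequencies [q * pi / lb], [p * pi / lt] and [(p + q) * pi / (lb + lt)] are then so close
    that their squares are close too, and one combination of the three waves nearly cancels on [e_1]
    and on [e_3], its mass remaining on [e_2] and [e_4] where the control does not act
    ([quasi_mode_small]). By Cauchy-Schwarz no control of finite norm steers 0 to a state whose
    coefficients along such a sequence of modes decay slowly enough ([necessity]). *)

(** * Complex numbers and the squared modulus *)

Section ComplexFacts.
Context {R : rcfType}.
Implicit Types z w : R[i].

(** A real polynomial in the two coordinates, within reach of [ring] and [lra], whereas
    [Normc.normc] hides a square root. *)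
Definition sqn z : R := Re z ^+ 2 + Im z ^+ 2.

Lemma sqn_ge0 z : 0 <= sqn z. Proof. by rewrite addr_ge0 ?sqr_ge0. Qed.

Lemma normc_sqn z : Normc.normc z ^+ 2 = sqn z.
Proof. by case: z => a b /=; rewrite sqr_sqrtr // addr_ge0 ?sqr_ge0. Qed.

Lemma normc_ge0 z : 0 <= Normc.normc z.
Proof. by case: z => a b /=; rewrite sqrtr_ge0. Qed.

Lemma ReM z w : Re (z * w) = Re z * Re w - Im z * Im w.
Proof. by case: z w => a b [c d]. Qed.
Lemma ImM z w : Im (z * w) = Re z * Im w + Im z * Re w.
Proof. by case: z w => a b [c d]. Qed.
Lemma ReD z w : Re (z + w) = Re z + Re w.
Proof. by case: z w => a b [c d]. Qed.
Lemma ImD z w : Im (z + w) = Im z + Im w.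
Proof. by case: z w => a b [c d]. Qed.
Lemma ReN z : Re (- z) = - Re z. Proof. by case: z. Qed.
Lemma ImN z : Im (- z) = - Im z. Proof. by case: z. Qed.
Lemma Re_conjc z : Re (conjc z) = Re z. Proof. by case: z. Qed.
Lemma Im_conjc z : Im (conjc z) = - Im z. Proof. by case: z. Qed.
Definition ReImE := (ReM, ImM, ReD, ImD, ReN, ImN, Re_conjc, Im_conjc).

Lemma complex_eqP z w : Re z = Re w -> Im z = Im w -> z = w.
Proof. by case: z w => a b [c d] /= -> ->. Qed.

Lemma Re_sum I (r : seq I) (Q : pred I) (F : I -> R[i]) :
  Re (\sum_(i <- r | Q i) F i) = \sum_(i <- r | Q i) Re (F i).
Proof. exact: (big_morph _ ReD erefl). Qed.
Lemma Im_sum I (r : seq I) (Q : pred I) (F : I -> R[i]) :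
  Im (\sum_(i <- r | Q i) F i) = \sum_(i <- r | Q i) Im (F i).
Proof. exact: (big_morph _ ImD erefl). Qed.

Lemma conjcD z w : conjc (z + w) = conjc z + conjc w.
Proof. by apply: complex_eqP; rewrite ?ReImE //= opprD. Qed.
Lemma conjc_sum I (r : seq I) (Q : pred I) (F : I -> R[i]) :
  conjc (\sum_(i <- r | Q i) F i) = \sum_(i <- r | Q i) conjc (F i).
Proof.
by apply: (big_morph _ conjcD); apply: complex_eqP; rewrite ?ReImE //= oppr0.
Qed.
Lemma conjcM z w : conjc (z * w) = conjc z * conjc w.
Proof. by apply: complex_eqP; rewrite !ReImE; ring. Qed.
Lemma conjcN z : conjc (- z) = - conjc z.
Proof. by apply: complex_eqP; rewrite !ReImE. Qed.
Lemma conjcK z : conjc (conjc z) = z.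
Proof. by apply: complex_eqP; rewrite !ReImE ?opprK. Qed.

Lemma sqnM z w : sqn (z * w) = sqn z * sqn w.
Proof. by rewrite /sqn !ReImE; ring. Qed.
Lemma sqnN z : sqn (- z) = sqn z.
Proof. by rewrite /sqn !ReImE; ring. Qed.
Lemma sqn_conjc z : sqn (conjc z) = sqn z.
Proof. by rewrite /sqn !ReImE; ring. Qed.
Lemma sqn_eq0 z : sqn z = 0 -> z = 0.
Proof.
move=> h; apply: complex_eqP => /=; move: h; rewrite /sqn => h; apply/eqP;
 rewrite -sqrf_eq0; apply/eqP; move: (sqr_ge0 (Re z)) (sqr_ge0 (Im z)); lra.
Qed.
Lemma sqn0 : sqn (0 : R[i]) = 0.
Proof. by rewrite /sqn /= !expr0n /= addr0. Qed.

Lemma sqnD_le z w : sqn (z + w) <= 2 * sqn z + 2 * sqn w.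
Proof.
rewrite /sqn !ReImE -subr_ge0.
have -> : 2 * (Re z ^+ 2 + Im z ^+ 2) + 2 * (Re w ^+ 2 + Im w ^+ 2) -
  ((Re z + Re w) ^+ 2 + (Im z + Im w) ^+ 2) = (Re z - Re w)^+2 + (Im z - Im w)^+2.
  by ring.
by rewrite addr_ge0 ?sqr_ge0.
Qed.

Lemma Re_le_normc z : `|Re z| <= Normc.normc z.
Proof.
case: z => a b /=; rewrite -sqrtr_sqr ler_sqrt ?addr_ge0 ?sqr_ge0 //.
by rewrite lerDl sqr_ge0.
Qed.

Lemma Re_mulc_conj z : Re (z * conjc z) = sqn z.
Proof. by rewrite /sqn !ReImE; ring. Qed.
Lemma Im_mulc_conj z : Im (z * conjc z) = 0.
Proof. by rewrite !ReImE; ring. Qed.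
End ComplexFacts.

(** * Abstract Hilbert spaces and moment problems *)

Section BoundedMonotone.
Context {R : realType}.

Lemma monotone_bounded_cauchy (s : nat -> R) (B : R) :
  (forall m n, (m <= n)%N -> s m <= s n) -> (forall n, s n <= B) ->
  forall e, 0 < e -> exists N, forall n, (N <= n)%N -> s n - s N <= e.
Proof.
move=> sm sB e e0.
have hs : has_sup (range s).
  by split; [exists (s 0%N), 0%N | exists B => _ [n _ <-]].
have [_ [N _ <-] hN] := sup_adherent e0 hs.
exists N => n Nn.
have : s n <= sup (range s) by apply: sup_upper_bound => //; exists n.
lra.
Qed.

Lemma sum_ord_mono (F : nat -> R) m n : (forall k, 0 <= F k) -> (m <= n)%N ->
  \sum_(k < m) F k <= \sum_(k < n) F k.
Proof.
move=> F0 mn; rewrite -(big_mkord xpredT F) -(big_mkord xpredT F).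
by rewrite (big_cat_nat _ mn) //= lerDl sumr_ge0.
Qed.
End BoundedMonotone.

(** Square-integrable functions are kept as representatives: [P] carves them out of the module of
    all functions, and the form is only semidefinite. Hence [Re (ip f f) = 0] does not force
    [f = 0], and limits are unique only up to null elements. *)
Record hilbert_form (R : realType) (V : lmodType R[i]) (P : V -> Prop)
    (ip : V -> V -> R[i]) : Prop := HilbertForm {
  dom0 : P 0;
  domD : forall f g, P f -> P g -> P (f + g);
  domZ : forall a f, P f -> P (a *: f);
  ipD : forall f g h, P f -> P g -> P h -> ip (f + g) h = ip f h + ip g h;
  ipZ : forall a f g, P f -> P g -> ip (a *: f) g = a * ip f g;
  ipC : forall f g, P f -> P g -> ip g f = conjc (ip f g);
  ip_ge0 : forall f, P f -> 0 <= Re (ip f f);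
  ip_complete : forall u : nat -> V, (forall n, P (u n)) ->
    (forall e : R, 0 < e -> exists N, forall m n, (N <= m)%N -> (N <= n)%N ->
      Re (ip (u m - u n) (u m - u n)) <= e) ->
    exists2 f, P f & forall e : R, 0 < e -> exists N, forall n, (N <= n)%N ->
      Re (ip (u n - f) (u n - f)) <= e }.

Section Hilbert.
Context {R : realType} {V : lmodType R[i]} {P : V -> Prop} {ip : V -> V -> R[i]}.
Variable H : hilbert_form P ip.
Local Notation sq f := (Re (ip f f)).
Implicit Types f g h : V.

Lemma domN f : P f -> P (- f).
Proof. by move=> Pf; rewrite -scaleN1r; exact: (domZ H). Qed.
Lemma domB f g : P f -> P g -> P (f - g).
Proof. by move=> Pf Pg; apply: (domD H) => //; exact: domN. Qed.
Lemma ipDr f g h : P f -> P g -> P h -> ip h (f + g) = ip h f + ip h g.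
Proof.
move=> Pf Pg Ph; rewrite (ipC H (domD H Pf Pg) Ph) (ipD H) // conjcD.
by rewrite -!(ipC H).
Qed.
Lemma ipZr a f g : P f -> P g -> ip f (a *: g) = conjc a * ip f g.
Proof.
move=> Pf Pg; rewrite (ipC H (domZ H a Pg) Pf) (ipZ H) // conjcM.
by rewrite -!(ipC H).
Qed.
Lemma ipN f g : P f -> P g -> ip (- f) g = - ip f g.
Proof. by move=> Pf Pg; rewrite -scaleN1r (ipZ H) // mulN1r. Qed.
Lemma ipB f g h : P f -> P g -> P h -> ip (f - g) h = ip f h - ip g h.
Proof. by move=> Pf Pg Ph; rewrite (ipD H) ?ipN //; exact: domN. Qed.
Lemma ip0 f : P f -> ip 0 f = 0.
Proof. by move=> Pf; rewrite -(scale0r 0) (ipZ H) ?mul0r //; exact: (dom0 H). Qed.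
Lemma Im_ip f : P f -> Im (ip f f) = 0.
Proof. by move=> Pf; have := congr1 (@Im R) (ipC H Pf Pf); rewrite Im_conjc; lra. Qed.

Lemma sqD f g : P f -> P g -> sq (f + g) = sq f + sq g + 2 * Re (ip f g).
Proof.
move=> Pf Pg; have Pfg := domD H Pf Pg.
rewrite (ipD H) // !ipDr // !ReD (ipC H Pf Pg) Re_conjc; lra.
Qed.

Lemma sqZ a f : P f -> sq (a *: f) = sqn a * sq f.
Proof.
move=> Pf; have Paf := domZ H a Pf.
by rewrite (ipZ H) // ipZr // !ReImE Im_ip // /sqn; ring.
Qed.

Lemma sqN f : P f -> sq (- f) = sq f.
Proof.
move=> Pf; rewrite -scaleN1r sqZ //.
by rewrite /sqn !ReImE /= oppr0 expr0n /= addr0 sqrrN expr1n mul1r.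
Qed.

Lemma sqB f g : P f -> P g -> sq (f - g) = sq f + sq g - 2 * Re (ip f g).
Proof.
move=> Pf Pg; have Ng := domN Pg; rewrite sqD // sqN //.
by rewrite (ipC H Ng Pf) Re_conjc ipN // ReN (ipC H Pf Pg) Re_conjc; lra.
Qed.

Lemma sqBC f g : P f -> P g -> sq (f - g) = sq (g - f).
Proof. by move=> Pf Pg; rewrite -(opprB g f) sqN //; exact: domB. Qed.

Lemma sqD_le f g : P f -> P g -> sq (f + g) <= 2 * sq f + 2 * sq g.
Proof.
move=> Pf Pg; have := ip_ge0 H (domB Pf Pg); rewrite sqB // sqD //; lra.
Qed.

(** The vector [f - t * ip f g *: g] has nonnegative square for every real [t]; this form of the
    multiplier makes the inequality a real one in [t]. The optimal [t] is the inverse of [sq g]. *)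
Lemma cauchy_schwarz f g : P f -> P g -> sqn (ip f g) <= sq f * sq g.
Proof.
move=> Pf Pg; set S := sqn _.
have key (t : R) : 0 <= sq f - 2 * t * S + t ^+ 2 * S * sq g.
  set c := (- (t%:C%C * ip f g)).
  have eR : Re (conjc c * ip f g) = - t * S by rewrite /c !ReImE /= /S /sqn; ring.
  have eS : sqn c = t ^+ 2 * S by rewrite /c /sqn !ReImE /= /S /sqn; ring.
  have := ip_ge0 H (domD H Pf (domZ H c Pg)).
  rewrite sqD ?sqZ //; last exact: (domZ H).
  by rewrite ipZr // eR eS; lra.
have S0 : 0 <= S by exact: sqn_ge0.
have f0 := ip_ge0 H Pf; have := ip_ge0 H Pg; rewrite le_eqVlt => /orP[/eqP g0|g0].
  (* With [g] null the inequality is affine in [t]; a positive [S] would make it negative for large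
     [t]. *)
  rewrite -g0 mulr0; case: (ltrP 0 S) => // Sp; exfalso.
  have := key ((sq f + 1) / S); rewrite -g0 mulr0 addr0.
  have -> : 2 * ((sq f + 1) / S) * S = 2 * (sq f + 1) by field; lra.
  lra.
have := key (sq g)^-1.
have -> : sq f - 2 * (sq g)^-1 * S + (sq g)^-1 ^+ 2 * S * sq g = sq f - S / sq g.
  by field; lra.
by rewrite subr_ge0 ler_pdivrMr.
Qed.

Lemma dom_sum n (F : nat -> V) : (forall k, P (F k)) -> P (\sum_(k < n) F k).
Proof.
move=> PF; elim/big_ind: _ => //; first exact: (dom0 H).
by move=> x y; apply: (domD H).
Qed.

Lemma ip_suml n (F : nat -> V) g : (forall k, P (F k)) -> P g ->
  ip (\sum_(k < n) F k) g = \sum_(k < n) ip (F k) g.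
Proof.
move=> PF Pg; elim: n => [|n IH]; first by rewrite !big_ord0 ip0.
by rewrite !big_ord_recr /= (ipD H) ?IH //; exact: dom_sum.
Qed.

Lemma ip_sumr n (F : nat -> V) g : (forall k, P (F k)) -> P g ->
  ip g (\sum_(k < n) F k) = \sum_(k < n) ip g (F k).
Proof.
move=> PF Pg; rewrite (ipC H (dom_sum _ PF) Pg) ip_suml // conjc_sum.
by apply: eq_bigr => k _; rewrite -(ipC H).
Qed.

(* A sequence that is Cauchy in mean converges, with inner products passing to
   the limit. *)
Lemma ip_limit (u : nat -> V) f g : (forall n, P (u n)) -> P f -> P g ->
  (forall e : R, 0 < e -> exists N, forall n, (N <= n)%N -> sq (u n - f) <= e) ->
  forall d, (exists N, forall n, (N <= n)%N -> ip (u n) g = d) -> ip f g = d.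
Proof.
move=> Pu Pf Pg uf d [N0 hd].
apply/eqP; rewrite -subr_eq0; apply/eqP; apply: sqn_eq0; apply/eqP.
rewrite eq_le sqn_ge0 andbT; apply/ler_addgt0Pr => e e0.
have g0 := ip_ge0 H Pg.
have [|N1 h1] := uf (e / (sq g + 1)); first by rewrite divr_gt0 //; lra.
pose n := maxn N0 N1.
have -> : ip f g - d = - ip (u n - f) g.
  by rewrite ipB // hd ?leq_maxl // opprB.
rewrite sqnN add0r; apply: (le_trans (cauchy_schwarz (domB (Pu n) Pf) Pg)).
have h := h1 n (leq_maxr _ _).
apply: (@le_trans _ _ (e / (sq g + 1) * sq g)); first by rewrite ler_wpM2r.
by rewrite mulrAC ler_pdivrMr; [nra | lra].
Qed.

Section Moments.
Variable psi : nat -> V.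
Hypothesis Ppsi : forall k, P (psi k).
Definition lincomb n (a : nat -> R[i]) : V := \sum_(k < n) a k *: psi k.

Lemma dom_lincomb n a : P (lincomb n a).
Proof. by apply: (@dom_sum n (fun k => a k *: psi k)) => k; exact: (domZ H). Qed.

Lemma ip_lincombr n a f : P f ->
  ip f (lincomb n a) = \sum_(k < n) conjc (a k) * ip f (psi k).
Proof.
move=> Pf; rewrite (@ip_sumr n (fun k => a k *: psi k)) //.
  by apply: eq_bigr => k _; rewrite ipZr.
by move=> k; exact: (domZ H).
Qed.

Lemma ip_lincombl n a f : P f ->
  ip (lincomb n a) f = \sum_(k < n) a k * ip (psi k) f.
Proof.
move=> Pf; rewrite (@ip_suml n (fun k => a k *: psi k)) //.
  by apply: eq_bigr => k _; rewrite (ipZ H).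
by move=> k; exact: (domZ H).
Qed.

(** Schur's test: each cross term is at most the mean of the two squared coefficients times the
    modulus of the Gram entry, and row sums of these moduli eat at most half of the diagonal. *)
Lemma diagonal_dominance (c : R) :
  (forall k, c <= sq (psi k)) ->
  (forall n k, (k < n)%N ->
     \sum_(j < n | (j : nat) != k) Normc.normc (ip (psi j) (psi k)) <= c / 2) ->
  forall n (a : nat -> R[i]), c / 2 * \sum_(k < n) sqn (a k) <= sq (lincomb n a).
Proof.
move=> diag off n a.
pose G (j k : 'I_n) : R := Normc.normc (ip (psi j) (psi k)).
have Gsym j k : G j k = G k j.
  rewrite /G (ipC H) //; case: (ip _ _) => x y /=; by rewrite sqrrN.
have -> : sq (lincomb n a) = \sum_(k < n) (sqn (a k) * sq (psi k) +
    \sum_(j < n | j != k) Re (conjc (a k) * (a j * ip (psi j) (psi k)))).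
  rewrite ip_lincombr; last exact: dom_lincomb.
  rewrite Re_sum; apply: eq_bigr => k _.
  rewrite ip_lincombl // mulr_sumr Re_sum (bigD1 k) //=; congr (_ + _).
  by rewrite !ReImE Im_ip // /sqn; ring.
have off' (k : 'I_n) : \sum_(j < n | j != k) G j k <= c / 2.
  exact: (off n k (ltn_ord k)).
have lower : \sum_(k < n) (sqn (a k) * c -
     \sum_(j < n | j != k) ((sqn (a k) + sqn (a j)) / 2 * G j k)) <=
   \sum_(k < n) (sqn (a k) * sq (psi k) +
    \sum_(j < n | j != k) Re (conjc (a k) * (a j * ip (psi j) (psi k)))).
  apply: ler_sum => k _; apply: lerD; first by rewrite ler_wpM2l ?sqn_ge0.
  rewrite -sumrN; apply: ler_sum => j _.
  rewrite mulrA; set z := conjc (a k) * a j.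
  have h1 := Re_le_normc (z * ip (psi j) (psi k)).
  have hz : Normc.normc z <= (sqn (a k) + sqn (a j)) / 2.
    have hk := normc_sqn (a k); have hj := normc_sqn (a j).
    rewrite /z Normc.normcM; have -> : Normc.normc (conjc (a k)) = Normc.normc (a k).
      by case: (a k) => x y /=; rewrite sqrrN.
    have := sqr_ge0 (Normc.normc (a k) - Normc.normc (a j)).
    by rewrite sqrrB hk hj; lra.
  rewrite Normc.normcM in h1.
  have h2 := ler_norm (- Re (z * ip (psi j) (psi k))); rewrite normrN in h2.
  have G0 : 0 <= G j k by exact: normc_ge0.
  have := ler_wpM2r G0 hz; rewrite /G; lra.
apply: le_trans lower.
rewrite sumrB.
(* The two halves of the mean have equal double sums, by exchanging the indices and the symmetry of
   the moduli. *)
have split : \sum_(k < n) \sum_(j < n | j != k) ((sqn (a k) + sqn (a j)) / 2 * G j k)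
   = \sum_(k < n) sqn (a k) * (\sum_(j < n | j != k) G j k).
  have e1 : \sum_(k < n) \sum_(j < n | j != k) ((sqn (a k) + sqn (a j)) / 2 * G j k)
    = \sum_(k < n) \sum_(j < n | j != k) (sqn (a k) / 2 * G j k) +
      \sum_(k < n) \sum_(j < n | j != k) (sqn (a j) / 2 * G j k).
    rewrite -big_split; apply: eq_bigr => k _; rewrite -big_split.
    by apply: eq_bigr => j _ /=; ring.
  have e2 : \sum_(k < n) \sum_(j < n | j != k) (sqn (a j) / 2 * G j k) =
     \sum_(k < n) \sum_(j < n | j != k) (sqn (a k) / 2 * G j k).
    under eq_bigr do rewrite big_mkcond; rewrite exchange_big /=.
    apply: eq_bigr => k _; rewrite [RHS]big_mkcond; apply: eq_bigr => j _.
    by rewrite eq_sym Gsym.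
  rewrite e1 e2 -big_split; apply: eq_bigr => k _ /=.
  by rewrite -big_split /= mulr_sumr; apply: eq_bigr => j _ /=; field.
rewrite split -sumrB mulr_sumr; apply: ler_sum => k _.
by have := sqn_ge0 (a k); have := off' k; nra.
Qed.

Section MomentProblem.
Variables (c : R).
Hypotheses (c0 : 0 < c)
  (riesz : forall n (a : nat -> R[i]), c * \sum_(k < n) sqn (a k) <= sq (lincomb n a)).

(** Gram-Schmidt: [chi] is [psi n] minus its projection on the earlier vectors. Adding a multiple of
    [chi] corrects the last moment and leaves the others unchanged. *)
Lemma finite_moments n (d : nat -> R[i]) :
  exists a : nat -> R[i], forall k, (k < n)%N -> ip (lincomb n a) (psi k) = d k.
Proof.
elim: n d => [|n IH] d; first by exists (fun=> 0).
have [b hb] := IH (fun k => ip (psi n) (psi k)).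
have [a ha] := IH d.
pose chi := psi n - lincomb n b.
have Pl m e := dom_lincomb m e.
have Pchi : P chi by exact: domB.
have chi0 k : (k < n)%N -> ip chi (psi k) = 0.
  by move=> kn; rewrite ipB // hb // subrr.
have chin : ip chi (psi n) = ip chi chi.
  have e0 : ip chi (lincomb n b) = 0.
    by rewrite ip_lincombr // big1 // => k _; rewrite chi0 ?mulr0.
  have -> : ip chi chi = ip chi (psi n) + ip chi (- lincomb n b).
    by rewrite -ipDr //; exact: domN.
  by rewrite -scaleN1r ipZr // e0 mulr0 addr0.
have lcE (s : R[i]) : lincomb n.+1 (fun k => if k == n then s else a k - s * b k) =
    lincomb n a + s *: chi.
  rewrite /lincomb big_ord_recr /= eqxx /chi scalerBr addrCA [LHS]addrC; congr (_ + _).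
  rewrite scaler_sumr -sumrB; apply: eq_bigr => k _.
  by rewrite (ltn_eqF (ltn_ord k)) scalerBl scalerA.
(* As a combination of the [psi k], [chi] has last coefficient 1, so [riesz] bounds its square below
   by [c]. *)
have chigt : 0 < sq chi.
  have := riesz n.+1 (fun k => if k == n then 1 else 0 - 1 * b k).
  have -> : lincomb n.+1 (fun k => if k == n then 1 else 0 - 1 * b k) = chi.
    rewrite /lincomb big_ord_recr /= eqxx scale1r addrC /chi; congr (_ + _).
    rewrite -sumrN; apply: eq_bigr => k _.
    by rewrite (ltn_eqF (ltn_ord k)) mul1r sub0r scaleNr.
  apply: lt_le_trans; rewrite mulr_gt0 // big_ord_recr /= eqxx.
  have : sqn (1 : R[i]) = 1 by rewrite /sqn /= expr0n /= addr0 expr1n.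
  move=> ->; apply: ltr_wpDl => //; apply: sumr_ge0 => k _; exact: sqn_ge0.
have chi_neq0 : ip chi chi != 0 by apply/eqP => h; move: chigt; rewrite h ltxx.
exists (fun k => if k == n then (d n - ip (lincomb n a) (psi n)) / ip chi chi
   else a k - (d n - ip (lincomb n a) (psi n)) / ip chi chi * b k).
move=> k; rewrite lcE (ipD H) ?(ipZ H) //; last exact: (domZ H).
rewrite ltnS leq_eqVlt => /orP[/eqP ->|kn].
  by rewrite chin divfK // addrCA subrr addr0.
by rewrite chi0 // mulr0 addr0 ha.
Qed.

(** Solve the first [n] moments inside the span of the first [n] vectors. For [m >= n] the
    difference of two such solutions is orthogonal to the earlier one, so the squared norms
    increase; the lower Riesz inequality bounds them by [B / c], and the solutions form a Cauchy
    sequence. *)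
Lemma moment_problem (d : nat -> R[i]) (B : R) :
  (forall n, \sum_(k < n) sqn (d k) <= B) ->
  exists2 h, P h & forall k, ip h (psi k) = d k.
Proof.
move=> dB.
have /choice [A hA] : forall n, exists a, forall k, (k < n)%N ->
  ip (lincomb n a) (psi k) = d k by move=> n; exact: finite_moments.
pose u n := lincomb n (A n).
have Pu n : P (u n) by exact: dom_lincomb.
have ipu m n : (n <= m)%N -> ip (u m) (u n) = ip (u n) (u n).
  move=> nm; rewrite ip_lincombr // [RHS]ip_lincombr //.
  by apply: eq_bigr => k _; rewrite !hA // (leq_trans (ltn_ord k)).
have sqmono m n : (n <= m)%N -> sq (u m - u n) = sq (u m) - sq (u n).
  by move=> nm; rewrite sqB // ipu //; lra.
have uB n : sq (u n) <= B / c.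
  have hS := dB n; set S := \sum_(k < n) sqn (d k) in hS.
  pose Q := \sum_(k < n) sqn (A n k).
  have cQ : c * Q <= sq (u n) by exact: riesz.
  have e : sq (u n) = \sum_(k < n) Re (conjc (A n k) * d k).
    rewrite ip_lincombr // Re_sum; apply: eq_bigr => k _.
    by rewrite hA.
  (* Young's inequality with weight [c]: by [cQ] the term [c / 2 * Q] is at most half of the left
     side and is absorbed. *)
  have le1 : sq (u n) <= c / 2 * Q + (2 * c)^-1 * S.
    rewrite e /Q /S !mulr_sumr -big_split; apply: ler_sum => k _ /=.
    rewrite !ReImE /sqn -subr_ge0.
    set x := Re (A n k); set y := Im _; set p := Re _; set q := Im _.
    have -> : c / 2 * (x ^+ 2 + y ^+ 2) + (2 * c)^-1 * (p ^+ 2 + q ^+ 2) -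
       (x * p - - y * q) = ((c * x - p) ^+ 2 + (c * y - q) ^+ 2) / (2 * c).
      by field; rewrite gt_eqF.
    by rewrite divr_ge0 ?addr_ge0 ?sqr_ge0 // mulr_ge0 // ltW.
  rewrite ler_pdivlMr //.
  have le2 : (2 * c)^-1 * S <= (2 * c)^-1 * B by rewrite ler_wpM2l // invr_ge0 mulr_ge0 // ltW.
  have : sq (u n) <= (2 * c)^-1 * B * 2 by lra.
  have -> : (2 * c)^-1 * B * 2 = B / c by field; rewrite gt_eqF.
  by rewrite ler_pdivlMr.
have cau e : 0 < e -> exists N, forall m n, (N <= m)%N -> (N <= n)%N ->
    sq (u m - u n) <= e.
  move=> e0.
  have mono m n : (m <= n)%N -> sq (u m) <= sq (u n).
    by move=> mn; have := ip_ge0 H (domB (Pu n) (Pu m)); rewrite sqmono //; lra.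
  have [N hN] := monotone_bounded_cauchy mono uB e0.
  exists N => m n Nm Nn; wlog mn : m n Nm Nn / (n <= m)%N.
    by move=> W; case/orP: (leq_total n m) => h; [|rewrite sqBC //]; exact: W.
  by rewrite sqmono //; have := hN _ Nm; have := mono _ _ Nn; lra.
have [h Ph hlim] := ip_complete H Pu cau.
exists h => // k; apply: (ip_limit Pu Ph (Ppsi k) hlim).
by exists k.+1 => n kn; apply: hA.
Qed.
End MomentProblem.

Section OrthonormalBasis.
Hypothesis orthonormal : forall j k, ip (psi j) (psi k) = (j == k)%:R.

Lemma ip_lincomb_ortho n a k : ip (lincomb n a) (psi k) = if (k < n)%N then a k else 0.
Proof.
rewrite ip_lincombl //; case: ifP => kn.
  rewrite (bigD1 (Ordinal kn)) //= orthonormal eqxx mulr1 big1 ?addr0 // => j.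
  by rewrite -val_eqE /= => /negbTE jk; rewrite orthonormal jk mulr0.
apply: big1 => j _; rewrite orthonormal; case: eqP => [jk|]; last by rewrite mulr0.
by rewrite -jk ltn_ord in kn.
Qed.

Lemma sq_lincomb n (a : nat -> R[i]) : sq (lincomb n a) = \sum_(k < n) sqn (a k).
Proof.
rewrite ip_lincombr; last exact: dom_lincomb.
rewrite Re_sum; apply: eq_bigr => k _; rewrite ip_lincomb_ortho ltn_ord.
by rewrite mulrC Re_mulc_conj.
Qed.

Lemma sq_residual n f : P f -> sq (f - lincomb n (fun k => ip f (psi k))) =
  sq f - \sum_(k < n) sqn (ip f (psi k)).
Proof.
move=> Pf; rewrite sqB ?sq_lincomb //; last exact: dom_lincomb.
rewrite ip_lincombr // Re_sum.
under [in X in 2 * X]eq_bigr do rewrite mulrC Re_mulc_conj.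
lra.
Qed.

Lemma bessel n f : P f -> \sum_(k < n) sqn (ip f (psi k)) <= sq f.
Proof.
move=> Pf; have := ip_ge0 H (domB Pf (dom_lincomb n (fun k => ip f (psi k)))).
by rewrite sq_residual // subr_ge0.
Qed.

Lemma riesz_orthonormal n (a : nat -> R[i]) : 1 * \sum_(k < n) sqn (a k) <= sq (lincomb n a).
Proof. by rewrite mul1r sq_lincomb. Qed.

(** Totality is stated up to null vectors, the form being semidefinite. It is what identifies the
    limit of a Bessel-Cauchy expansion with the vector itself, since the two have the same
    coefficients. *)
Hypothesis total : forall f, P f -> (forall k, ip f (psi k) = 0) -> sq f = 0.

Lemma expansion f : P f -> forall e : R, 0 < e -> exists N, forall n, (N <= n)%N ->
  sq (f - lincomb n (fun k => ip f (psi k))) <= e.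
Proof.
move=> Pf; pose a k := ip f (psi k); pose u n := lincomb n a.
have Pu n : P (u n) by exact: dom_lincomb.
have cau e : 0 < e -> exists N, forall m n, (N <= m)%N -> (N <= n)%N ->
    sq (u m - u n) <= e.
  move=> e0; pose s n := \sum_(k < n) sqn (a k).
  have mono m n : (m <= n)%N -> s m <= s n.
    by apply: (@sum_ord_mono _ (fun k => sqn (a k))) => k; exact: sqn_ge0.
  have [N hN] := monotone_bounded_cauchy mono (fun n => bessel n Pf) e0.
  exists N => m n Nm Nn; wlog mn : m n Nm Nn / (n <= m)%N.
    by move=> W; case/orP: (leq_total n m) => h; [|rewrite sqBC //]; exact: W.
  rewrite sqB // !sq_lincomb -/(s m) -/(s n).
  have -> : Re (ip (u m) (u n)) = s n.
    rewrite ip_lincombr // Re_sum; apply: eq_bigr => k _.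
    by rewrite ip_lincomb_ortho (leq_trans (ltn_ord k)) // mulrC Re_mulc_conj.
  have := hN _ Nm; have := mono _ _ Nn; lra.
have [g Pg hlim] := ip_complete H Pu cau.
have gk k : ip g (psi k) = a k.
  apply: (ip_limit Pu Pg (Ppsi k) hlim); exists k.+1 => n kn.
  by rewrite ip_lincomb_ortho kn.
have fg0 : sq (f - g) = 0.
  apply: total; first exact: domB.
  by move=> k; rewrite ipB // gk subrr.
move=> e e0; have [|N hN] := hlim (e / 2); first lra.
exists N => n Nn; have -> : f - lincomb n a = (f - g) + (g - u n).
  by rewrite addrA subrK.
apply: (le_trans (sqD_le (domB Pf Pg) (domB Pg (Pu n)))).
rewrite fg0 sqBC //; have := hN n Nn; lra.
Qed.

Lemma parseval_le f (B : R) : P f ->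
  (forall n, \sum_(k < n) sqn (ip f (psi k)) <= B) -> sq f <= B.
Proof.
move=> Pf hB; apply/ler_addgt0Pr => e e0.
have [N hN] := expansion Pf e0.
by have := hN N (leqnn _); rewrite sq_residual //; have := hB N; lra.
Qed.
End OrthonormalBasis.
End Moments.
End Hilbert.

(** * Real square-integrable functions and the Riesz-Fischer theorem *)

Section RealL2.
Context d (X : measurableType d) (R : realType) (mu : {measure set X -> \bar R}).
Variable D : set X.
Hypothesis mD : measurable D.
Implicit Types f g : X -> R.

Lemma integrableR_meas f : integrableR mu D f -> measurable_fun D f.
Proof. by move=> /integrableP[/measurable_EFinP]. Qed.

Lemma integrableR_le f g : measurable_fun D f ->
  (forall x, D x -> `|f x| <= g x) -> integrableR mu D g -> integrableR mu D f.
Proof.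
move=> mf fg; apply: le_integrable => //; first exact/measurable_EFinP.
by move=> x Dx; rewrite /= lee_fin (le_trans (fg _ Dx)) // ler_norm.
Qed.

Lemma integrableRD f g : integrableR mu D f -> integrableR mu D g ->
  integrableR mu D (fun x => f x + g x).
Proof. by move=> fi gi; exact: (integrableD mD fi gi). Qed.

Lemma integrableRZ (c : R) f : integrableR mu D f ->
  integrableR mu D (fun x => c * f x).
Proof. by move=> fi; exact: (integrableZl mD c fi). Qed.

Lemma integrableRN f : integrableR mu D f -> integrableR mu D (fun x => - f x).
Proof. by move=> fi; exact: (integrableN fi). Qed.

Lemma EFin_Rintegral f : integrableR mu D f ->
  (\int[mu]_(x in D) (f x)%:E)%E = (\int[mu]_(x in D) f x)%:E.
Proof. by move=> fi; rewrite fineK //; exact: integrable_fin_num. Qed.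

Definition sq_int f := measurable_fun D f /\ integrableR mu D (fun x => f x ^+ 2).

Lemma measurable_sqr f : measurable_fun D f -> measurable_fun D (fun x => f x ^+ 2).
Proof. by move=> mf; exact: measurable_funX. Qed.

Lemma sq_intD f g : sq_int f -> sq_int g -> sq_int (fun x => f x + g x).
Proof.
move=> [mf fi] [mg gi]; split; first exact: measurable_funD.
apply: (@integrableR_le _ (fun x => 2 * f x ^+ 2 + 2 * g x ^+ 2)).
- by apply: measurable_sqr; exact: measurable_funD.
- move=> x _; rewrite ger0_norm ?sqr_ge0 //.
  by have := sqr_ge0 (f x - g x); lra.
- by apply: integrableRD; exact: integrableRZ.
Qed.

Lemma sq_intZ (c : R) f : sq_int f -> sq_int (fun x => c * f x).
Proof.
move=> [mf fi]; split.
  by apply: measurable_funM => //; exact: measurable_cst.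
have -> : (fun x => (c * f x) ^+ 2) = (fun x => c ^+ 2 * f x ^+ 2).
  by apply/funext => x; rewrite exprMn.
exact: integrableRZ.
Qed.

Lemma sq_intB f g : sq_int f -> sq_int g -> sq_int (fun x => f x - g x).
Proof.
move=> hf hg; have := sq_intD hf (sq_intZ (-1) hg).
by under eq_fun do rewrite mulN1r.
Qed.

Lemma sq_int_mul f g : sq_int f -> sq_int g -> integrableR mu D (fun x => f x * g x).
Proof.
move=> [mf fi] [mg gi].
apply: (@integrableR_le _ (fun x => f x ^+ 2 + g x ^+ 2)).
- exact: measurable_funM.
- move=> x _; rewrite ler_norml; apply/andP; split.
    have := sqr_ge0 (f x + g x); have := sqr_ge0 (f x); have := sqr_ge0 (g x); lra.
  have := sqr_ge0 (f x - g x); have := sqr_ge0 (f x); have := sqr_ge0 (g x); lra.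
- exact: integrableRD.
Qed.

Lemma sq_int_ext f g : (forall x, D x -> f x = g x) -> sq_int f -> sq_int g.
Proof.
move=> fg [mf fi]; split.
  by apply: eq_measurable_fun mf => x /set_mem /fg.
apply: eq_integrable fi => // x /set_mem /fg /= ->; by [].
Qed.

Section RieszFischer.
Variable u : nat -> X -> R.
Hypothesis uL2 : forall n, sq_int (u n).
Hypothesis ucau : forall e : R, 0 < e -> exists N, forall m n, (N <= m)%N ->
  (N <= n)%N -> \int[mu]_(x in D) (u m x - u n x) ^+ 2 <= e.

Let dist_int m n : integrableR mu D (fun x => (u m x - u n x) ^+ 2).
Proof. by have [] := sq_intB (uL2 m) (uL2 n). Qed.

Let ecau e : 0 < e -> exists N, forall m n, (N <= m)%N -> (N <= n)%N ->
  (\int[mu]_(x in D) ((u m x - u n x) ^+ 2)%:E <= e%:E)%E.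
Proof.
move=> /ucau [N hN]; exists N => m n Nm Nn.
by rewrite EFin_Rintegral // lee_fin hN.
Qed.

(** The index [g k] is taken beyond all the thresholds up to [k], so both [g k] and [g k.+1] lie
    past [N k]. It need not be strictly increasing; [k <= g k] suffices for limits. *)
Lemma fast_subsequence : exists2 g : nat -> nat, forall k, (k <= g k)%N & forall k,
  (\int[mu]_(x in D) ((u (g k.+1) x - u (g k) x) ^+ 2)%:E <= (8^-1 ^+ k)%:E)%E.
Proof.
have /choice [N hN] : forall k, exists N, forall m n, (N <= m)%N -> (N <= n)%N ->
  (\int[mu]_(x in D) ((u m x - u n x) ^+ 2)%:E <= (8^-1 ^+ k)%:E)%E.
  by move=> k; apply: ecau; rewrite exprn_gt0 // invr_gt0.
pose g k := maxn k (\max_(i < k.+1) N i)%N.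
have gN k m : (k <= m)%N -> (N k <= g m)%N.
  move=> km; rewrite /g leq_max; apply/orP; right; rewrite -ltnS in km.
  exact: (leq_bigmax (Ordinal km)).
by exists g => k; [exact: leq_maxl | apply: hN; apply: gN].
Qed.

(** Weighted by [4 ^+ k], the squared increments form a series whose integral is at most 2, hence
    finite almost everywhere. At such points the increments are of order [2^-1 ^+ k], so the
    telescoping series converges. *)
Lemma ae_limit (v : nat -> X -> R) : (forall k, measurable_fun D (v k)) ->
  (forall k, (\int[mu]_(x in D) ((v k.+1 x - v k x) ^+ 2)%:E <= (8^-1 ^+ k)%:E)%E) ->
  {ae mu, forall x, D x -> cvgn (v ^~ x)}.
Proof.
move=> mv hv.
pose F k x := (4 ^+ k * (v k.+1 x - v k x) ^+ 2)%:E.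
have mF k : measurable_fun D (F k).
  apply/measurable_EFinP; apply: measurable_funM; first exact: measurable_cst.
  by apply: measurable_sqr; exact: measurable_funB.
have F0 k x : (0 <= F k x)%E.
  by rewrite lee_fin; apply: mulr_ge0; [exact: exprn_ge0 | exact: sqr_ge0].
pose S x := (\sum_(k <oo) F k x)%E.
have iS : integrable mu D S.
  apply/integrableP; split.
    by apply: ge0_emeasurable_sum => // k x _ _; exact: F0.
  under eq_integral do rewrite gee0_abs ?nneseries_ge0 //.
  rewrite integral_nneseries //.
  apply: (@le_lt_trans _ _ 2%:E); last exact: ltry.
  apply: lime_le.
    by apply: is_cvg_nneseries => k _ _; apply: integral_ge0 => x _; exact: F0.
  apply: nearW => n; apply: (@le_trans _ _ (\sum_(0 <= k < n) (2^-1 ^+ k)%:E)%E).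
    apply: lee_sum => k _; rewrite /F.
    have -> : (\int[mu]_(x in D) (4 ^+ k * (v k.+1 x - v k x) ^+ 2)%:E =
        (4 ^+ k)%:E * \int[mu]_(x in D) ((v k.+1 x - v k x) ^+ 2)%:E)%E.
      under eq_integral do rewrite EFinM.
      rewrite ge0_integralZl_EFin ?exprn_ge0 //.
        by move=> x _; rewrite lee_fin sqr_ge0.
      by apply/measurable_EFinP; apply: measurable_sqr; exact: measurable_funB.
    have -> : (2^-1 ^+ k)%:E = ((4 ^+ k)%:E * (8^-1 ^+ k)%:E)%E :> \bar R.
      by rewrite -EFinM -exprMn; congr (_ ^+ _)%:E; lra.
    by rewrite lee_pmul2l // ?lte_fin ?exprn_gt0.
  rewrite sumEFin lee_fin.
  have -> : \sum_(0 <= k < n) 2^-1 ^+ k = 2 - 2 * 2^-1 ^+ n :> R.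
    elim: n => [|n IH]; first by rewrite big_geq // expr0; lra.
    by rewrite big_nat_recr //= IH exprS; lra.
  by rewrite gerBl mulr_ge0 // exprn_ge0.
have := integrable_ae mD iS; apply: filterS => x hx Dx.
have Sx := hx Dx; set s := fine (S x).
have Fs k : 4 ^+ k * (v k.+1 x - v k x) ^+ 2 <= s.
  rewrite -lee_fin /s fineK //.
  apply: le_trans (@nneseries_lim_ge _ _ _ 0 k.+1 _); last by move=> i _ _; exact: F0.
  rewrite big_nat_recr //= leeDr // sume_ge0 // => i _; exact: F0.
have s0 : 0 <= s.
  by apply: le_trans (Fs 0%N); rewrite expr0 mul1r sqr_ge0.
have vs k : `|v k.+1 x - v k x| <= (s + 1) * 2^-1 ^+ k.
  have p0 : 0 <= (s + 1) * 2^-1 ^+ k by apply: mulr_ge0; [lra|rewrite exprn_ge0].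
  rewrite -(ger0_norm p0) -ler_sqr ?nnegrE // !real_normK ?num_real // exprMn -exprM mulnC exprM.
  have -> : (2^-1 ^+ 2 : R) = 4^-1 by lra.
  have := Fs k; rewrite exprVn -ler_pdivlMl ?exprn_gt0 // mulrC => /le_trans; apply.
  by rewrite ler_wpM2r ?invr_ge0 ?exprn_ge0 //; nra.
suff : cvgn (series (telescope (v ^~ x))).
  move=> h; have -> : v ^~ x = (fun n => v 0%N x + series (telescope (v ^~ x)) n).
    by apply/funext => n; exact: (eq_sum_telescope (v ^~ x)).
  by apply: is_cvgD => //; exact: is_cvg_cst.
apply: normed_cvg; apply: (series_le_cvg (v_ := geometric (s + 1) 2^-1)).
- by move=> n /=.
- by move=> n /=; apply: mulr_ge0; [lra|rewrite exprn_ge0].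
- by move=> n; exact: vs.
- by apply: is_cvg_geometric_series; rewrite gtr0_norm; lra.
Qed.

(** The almost everywhere limit of a fast subsequence is the candidate, and Fatou's lemma turns the
    Cauchy property into convergence in mean. *)
Lemma riesz_fischer : exists2 f, sq_int f & forall e : R, 0 < e ->
  exists N, forall n, (N <= n)%N -> \int[mu]_(x in D) (u n x - f x) ^+ 2 <= e.
Proof.
have [g gk gB] := fast_subsequence; pose v k := u (g k).
have mv k : measurable_fun D (v k) by have [] := uL2 (g k).
have aecv := ae_limit mv gB.
(* The upper limit is measurable whether or not the sequence converges; [fine] gives it a default
   value where it is infinite. *)
pose w x k := (v k x)%:E; pose f x := fine (limn_esup (w x)).
have mf : measurable_fun D f.
  apply: measurableT_comp => //.
  by apply: (@measurable_fun_limn_esup _ _ _ _ (fun k x => (v k x)%:E)) => k;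
    apply/measurable_EFinP.
have fE x : cvgn (v ^~ x) -> v k x @[k --> \oo] --> f x.
  move=> /cvg_ex [l vl]; suff -> : f x = l by [].
  have /cvg_limn_einf_sup[_] : w x k @[k --> \oo] --> l%:E by apply: cvg_EFin => //; exact: nearW.
  by rewrite /f => ->.
(* Fatou: a bound on the distance from [u n] to all later terms passes to the distance to [f]. *)
have key n e : (forall k, (n <= k)%N -> (\int[mu]_(x in D) ((u n x - u k x) ^+ 2)%:E <= e%:E)%E) ->
  (\int[mu]_(x in D) ((u n x - f x) ^+ 2)%:E <= e%:E)%E.
  move=> hn; pose F k x := ((u n x - v k x) ^+ 2)%:E.
  have mn : measurable_fun D (u n) by have [] := uL2 n.
  have mF k : measurable_fun D (F k).
    by apply/measurable_EFinP; apply: measurable_sqr; exact: measurable_funB.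
  have F0 k x : D x -> (0 <= F k x)%E by rewrite lee_fin sqr_ge0.
  have -> : (\int[mu]_(x in D) ((u n x - f x) ^+ 2)%:E =
     \int[mu]_(x in D) limn_einf (F ^~ x))%E.
    apply: ge0_ae_eq_integral => //.
    - by apply/measurable_EFinP; apply: measurable_sqr; exact: measurable_funB.
    - have -> : (fun x => limn_einf (F ^~ x)) =
         (fun x => (- limn_esup (fun k => - F k x))%E).
        by apply/funext => x; rewrite -limn_einfN; congr (limn_einf _);
          apply/funext => k; rewrite /comp oppeK.
      apply: measurableT_comp => //.
      by apply: (@measurable_fun_limn_esup _ _ _ _ (fun k x => (- F k x)%E)) => k;
        exact: measurableT_comp.
    - by move=> x _; rewrite lee_fin sqr_ge0.
    - move=> x Dx; rewrite limn_einf_lim; apply: lime_ge; first exact: is_cvg_einfs.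
      by apply: nearW => k; apply: le_ereal_inf_tmp => _ [m _ <-]; exact: F0.
    - apply: filterS aecv => x cv Dx; have h := fE x (cv Dx).
      have /cvg_limn_einf_sup[-> _] // : F k x @[k --> \oo] --> ((u n x - f x) ^+ 2)%:E.
      apply: cvg_EFin; first exact: nearW.
      rewrite /comp /=; under eq_fun do rewrite expr2.
      by rewrite expr2; apply: cvgM; apply: cvgB => //; exact: cvg_cst.
  apply: le_trans (fatou mu mD mF F0) _.
  rewrite limn_einf_lim; apply: lime_le; first exact: is_cvg_einfs.
  apply: nearW => k; apply: le_trans (hn (g (maxn k n)) _); last first.
    by apply: leq_trans (gk _); exact: leq_maxr.
  by apply: ereal_inf_lbound; exists (maxn k n) => //=; exact: leq_maxl.
have fsq n e : (forall k, (n <= k)%N ->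
    (\int[mu]_(x in D) ((u n x - u k x) ^+ 2)%:E <= e%:E)%E) ->
    sq_int (fun x => u n x - f x).
  move=> hn; split; first by apply: measurable_funB => //; have [] := uL2 n.
  apply/integrableP; split.
    apply/measurable_EFinP; apply: measurable_sqr; apply: measurable_funB => //.
    by have [] := uL2 n.
  apply: le_lt_trans (ltry e); apply: le_trans (key n e hn).
  by under eq_integral do rewrite /= ger0_norm ?sqr_ge0 //.
have [N1 hN1] := ecau ltr01.
have fL2 : sq_int f.
  have h := fsq N1 1 (fun k kN => hN1 N1 k (leqnn _) kN).
  apply: sq_int_ext (sq_intB (uL2 N1) h) => x _; exact: subKr.
exists f => // e e0; have [N hN] := ecau e0; exists N => n Nn.
rewrite -lee_fin -EFin_Rintegral; first by apply: key => k nk; apply: hN => //; exact: leq_trans nk.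
by have [] := sq_intB (uL2 n) fL2.
Qed.

End RieszFischer.
End RealL2.

(** * Complex integrals and the Hilbert space of a finite family of sets *)

Section ComplexIntegral.
Context d (X : measurableType d) (R : realType) (mu : {measure set X -> \bar R}).
Implicit Types (D : set X) (f g : X -> R[i]).

Definition cintegrable D f : Prop :=
  integrableR mu D (fun x => Re (f x)) /\ integrableR mu D (fun x => Im (f x)).

Lemma Re_cintegral D f : Re (cintegral mu D f) = \int[mu]_(x in D) Re (f x).
Proof. by []. Qed.
Lemma Im_cintegral D f : Im (cintegral mu D f) = \int[mu]_(x in D) Im (f x).
Proof. by []. Qed.

Lemma eq_cintegral D f g : (forall x, D x -> f x = g x) ->
  cintegral mu D f = cintegral mu D g.
Proof.
by move=> fg; apply: complex_eqP; apply: eq_Rintegral => x /set_mem /fg ->.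
Qed.

Lemma ae_eq_cintegral D f g : measurable D -> cintegrable D f -> cintegrable D g ->
  ae_eq mu D f g -> cintegral mu D f = cintegral mu D g.
Proof.
move=> mD [/integrableP[f1 _] /integrableP[f2 _]] [/integrableP[g1 _] /integrableP[g2 _]] fg.
by apply: complex_eqP => /=; congr fine; apply: ae_eq_integral => //;
  apply: filterS fg => x fg Dx; rewrite fg.
Qed.

Lemma cintegral_set0 f : cintegral mu set0 f = 0.
Proof. by apply: complex_eqP; rewrite /= Rintegral_set0. Qed.

Section Linear.
Variable D : set X.
Hypothesis mD : measurable D.

Lemma eq_cintegrable f g : (forall x, D x -> f x = g x) ->
  cintegrable D f -> cintegrable D g.
Proof.
by move=> fg [h1 h2]; split; [apply: (eq_integrable mD) h1|apply: (eq_integrable mD) h2];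
  rewrite // => x /set_mem /fg /= ->.
Qed.

Lemma cintegrableD f g : cintegrable D f -> cintegrable D g ->
  cintegrable D (fun x => f x + g x).
Proof.
move=> [f1 f2] [g1 g2]; split.
  by apply: (eq_integrable mD) (integrableRD mD f1 g1) => x _ /=; rewrite ReD.
by apply: (eq_integrable mD) (integrableRD mD f2 g2) => x _ /=; rewrite ImD.
Qed.

Lemma cintegralD f g : cintegrable D f -> cintegrable D g ->
  cintegral mu D (fun x => f x + g x) = cintegral mu D f + cintegral mu D g.
Proof.
move=> [f1 f2] [g1 g2]; apply: complex_eqP; rewrite ?ReD ?ImD /=.
  by rewrite -RintegralD //; apply: eq_Rintegral => x _; rewrite ReD.
by rewrite -RintegralD //; apply: eq_Rintegral => x _; rewrite ImD.
Qed.

Lemma cintegrableZ (c : R[i]) f : cintegrable D f -> cintegrable D (fun x => c * f x).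
Proof.
move=> [f1 f2]; split.
  apply: (eq_integrable mD) (integrableRD mD (integrableRZ mD (Re c) f1)
    (integrableRZ mD (- Im c) f2)) => x _ /=; congr _%:E; rewrite ReM; ring.
apply: (eq_integrable mD) (integrableRD mD (integrableRZ mD (Re c) f2)
    (integrableRZ mD (Im c) f1)) => x _ /=; congr _%:E; rewrite ImM; ring.
Qed.

Lemma cintegralZ (c : R[i]) f : cintegrable D f ->
  cintegral mu D (fun x => c * f x) = c * cintegral mu D f.
Proof.
move=> [f1 f2]; apply: complex_eqP; rewrite ?ReM ?ImM /=.
  rewrite -RintegralZl // -[X in _ - X]RintegralZl // -RintegralB //; last 2 first.
    exact: integrableRZ.
    exact: integrableRZ.
  by apply: eq_Rintegral => x _; rewrite ReM.
rewrite -RintegralZl // -[X in _ + X]RintegralZl // -RintegralD //; last 2 first.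
  exact: integrableRZ.
  exact: integrableRZ.
by apply: eq_Rintegral => x _; rewrite ImM.
Qed.

Lemma cintegrableN f : cintegrable D f -> cintegrable D (fun x => - f x).
Proof.
by move=> fi; apply: eq_cintegrable (cintegrableZ (-1) fi) => x _; rewrite mulN1r.
Qed.

Lemma cintegralN f : cintegrable D f ->
  cintegral mu D (fun x => - f x) = - cintegral mu D f.
Proof.
move=> fi; rewrite -mulN1r -cintegralZ //.
by apply: eq_cintegral => x _; rewrite mulN1r.
Qed.

Lemma cintegrableB f g : cintegrable D f -> cintegrable D g ->
  cintegrable D (fun x => f x - g x).
Proof. by move=> fi gi; apply: cintegrableD => //; exact: cintegrableN. Qed.

Lemma cintegralB f g : cintegrable D f -> cintegrable D g ->
  cintegral mu D (fun x => f x - g x) = cintegral mu D f - cintegral mu D g.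
Proof.
by move=> fi gi; rewrite -cintegralN // -cintegralD //; exact: cintegrableN.
Qed.

Lemma cintegral_conj f : cintegrable D f ->
  cintegral mu D (fun x => conjc (f x)) = conjc (cintegral mu D f).
Proof.
move=> [f1 f2]; apply: complex_eqP; rewrite ?Re_conjc ?Im_conjc /=.
  by apply: eq_Rintegral => x _; rewrite Re_conjc.
rewrite -mulN1r -RintegralZl //.
by apply: eq_Rintegral => x _; rewrite Im_conjc mulN1r.
Qed.

Lemma cintegrable0 : cintegrable D (fun=> 0).
Proof. by split; exact: integrable0. Qed.

Lemma cintegral0 : cintegral mu D (fun=> 0) = 0.
Proof.
by apply: complex_eqP; rewrite /= Rintegral_cst // mul0r.
Qed.

Lemma cintegrable_sum (I : Type) (r : seq I) (F : I -> X -> R[i]) :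
  (forall i, cintegrable D (F i)) -> cintegrable D (fun x => \sum_(i <- r) F i x).
Proof.
move=> Fi; elim: r => [|i r IH].
  by apply: eq_cintegrable cintegrable0 => x _; rewrite big_nil.
by apply: eq_cintegrable (cintegrableD (Fi i) IH) => x _; rewrite big_cons.
Qed.

Lemma cintegral_sum (I : Type) (r : seq I) (F : I -> X -> R[i]) :
  (forall i, cintegrable D (F i)) ->
  cintegral mu D (fun x => \sum_(i <- r) F i x) = \sum_(i <- r) cintegral mu D (F i).
Proof.
move=> Fi; elim: r => [|i r IH].
  by rewrite big_nil -[RHS]cintegral0; apply: eq_cintegral => x _; rewrite big_nil.
rewrite big_cons -IH -cintegralD //; last exact: cintegrable_sum.
by apply: eq_cintegral => x _; rewrite big_cons.
Qed.

Lemma cintegrable_le f (g : X -> R) :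
  measurable_fun D (fun x => Re (f x)) -> measurable_fun D (fun x => Im (f x)) ->
  integrableR mu D g -> (forall x, D x -> `|Re (f x)| <= g x) ->
  (forall x, D x -> `|Im (f x)| <= g x) -> cintegrable D f.
Proof. by move=> m1 m2 gi h1 h2; split; apply: integrableR_le gi. Qed.

Lemma integrableR_cst (B : R) : (mu D < +oo)%E -> integrableR mu D (fun=> B).
Proof.
move=> fin; apply: measurable_bounded_integrable => //.
exists `|B|; split; first exact: num_real.
by move=> M BM x _ /=; exact: ltW.
Qed.

Lemma cintegrable_bounded f (B : R) : (mu D < +oo)%E ->
  measurable_fun D (fun x => Re (f x)) -> measurable_fun D (fun x => Im (f x)) ->
  (forall x, D x -> `|Re (f x)| <= B) -> (forall x, D x -> `|Im (f x)| <= B) ->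
  cintegrable D f.
Proof.
move=> fin m1 m2 h1 h2; apply: (@cintegrable_le _ (fun=> B)) => //.
exact: integrableR_cst.
Qed.

Lemma Rintegral_bound (f : X -> R) (B : R) : (mu D < +oo)%E -> integrableR mu D f ->
  (forall x, D x -> `|f x| <= B) -> `|\int[mu]_(x in D) f x| <= B * fine (mu D).
Proof.
move=> fin fi fB; apply: (le_trans (le_normr_Rintegral mD fi)).
rewrite -Rintegral_cst //; apply: le_Rintegral => //.
  exact: integrable_norm.
exact: integrableR_cst.
Qed.

(** Real and imaginary parts are bounded separately, whence the factor 2; the loss is harmless
    below. *)
Lemma cintegral_bound f (B : R) : (mu D < +oo)%E -> cintegrable D f -> 0 <= B ->
  (forall x, D x -> sqn (f x) <= B ^+ 2) ->
  sqn (cintegral mu D f) <= 2 * (B * fine (mu D)) ^+ 2.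
Proof.
move=> fin [f1 f2] B0 fB; have m0 : 0 <= B * fine (mu D).
  by rewrite mulr_ge0 // fine_ge0.
have aux (F : X -> R) : integrableR mu D F -> (forall x, D x -> F x ^+ 2 <= sqn (f x)) ->
   (\int[mu]_(x in D) F x) ^+ 2 <= (B * fine (mu D)) ^+ 2.
  move=> Fi hF; rewrite -[leLHS]real_normK ?num_real // ler_sqr ?nnegrE //.
  apply: Rintegral_bound => // x Dx.
  rewrite -ler_sqr ?nnegrE // real_normK ?num_real //.
  exact: le_trans (hF x Dx) (fB x Dx).
have h1 := aux _ f1 (fun x _ => _ : Re (f x) ^+ 2 <= sqn (f x)).
have h2 := aux _ f2 (fun x _ => _ : Im (f x) ^+ 2 <= sqn (f x)).
have e1 x : D x -> Re (f x) ^+ 2 <= sqn (f x) by rewrite /sqn lerDl sqr_ge0.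
have e2 x : D x -> Im (f x) ^+ 2 <= sqn (f x) by rewrite /sqn lerDr sqr_ge0.
have := aux _ f1 e1; have := aux _ f2 e2; rewrite /sqn Re_cintegral Im_cintegral; lra.
Qed.

Lemma L2P f : L2 mu D f <->
  sq_int mu D (fun x => Re (f x)) /\ sq_int mu D (fun x => Im (f x)).
Proof.
split=> [[m1 m2 fi]|[[m1 i1] [m2 i2]]].
  have aux (F : X -> R) : measurable_fun D F ->
      (forall x, F x ^+ 2 <= sqn (f x)) -> sq_int mu D F.
    move=> mF hF; split=> //; apply: integrableR_le fi => //; first exact: measurable_sqr.
    by move=> x Dx; rewrite ger0_norm ?sqr_ge0 // normc_sqn.
  by split; apply: aux => // x; rewrite /sqn ?lerDl ?lerDr sqr_ge0.
split=> //; apply: (eq_integrable mD) (integrableRD mD i1 i2) => x _ /=.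
by rewrite normc_sqn.
Qed.

Lemma L2D f g : L2 mu D f -> L2 mu D g -> L2 mu D (fun x => f x + g x).
Proof.
move=> /L2P[f1 f2] /L2P[g1 g2]; apply/L2P; split.
  by apply: sq_int_ext (sq_intD mD f1 g1) => // x _; rewrite ReD.
by apply: sq_int_ext (sq_intD mD f2 g2) => // x _; rewrite ImD.
Qed.

Lemma L2Z (c : R[i]) f : L2 mu D f -> L2 mu D (fun x => c * f x).
Proof.
move=> /L2P[f1 f2]; apply/L2P; split.
  by apply: sq_int_ext (sq_intB mD (sq_intZ mD (Re c) f1) (sq_intZ mD (Im c) f2)) => // x _;
   rewrite ReM.
by apply: sq_int_ext (sq_intD mD (sq_intZ mD (Re c) f2) (sq_intZ mD (Im c) f1)) => // x _;
   rewrite ImM.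
Qed.

Lemma L2_0 : L2 mu D (fun=> 0).
Proof.
apply/(L2P); split; (split; first exact: measurable_cst);
  by apply: (eq_integrable mD) (integrable0 mu D) => x _; rewrite /= expr0n.
Qed.

Lemma L2_mul_conj f g : L2 mu D f -> L2 mu D g ->
  cintegrable D (fun x => f x * conjc (g x)).
Proof.
move=> /L2P[f1 f2] /L2P[g1 g2]; split.
  apply: (eq_integrable mD) (integrableRD mD (sq_int_mul mD f1 g1) (sq_int_mul mD f2 g2)).
  by move=> x _ /=; congr _%:E; rewrite !ReImE; ring.
apply: (eq_integrable mD) (integrableRD mD (sq_int_mul mD f2 g1)
   (integrableRN (sq_int_mul mD f1 g2))).
by move=> x _ /=; congr _%:E; rewrite !ReImE; ring.
Qed.

Lemma L2_bounded f (B : R) : (mu D < +oo)%E ->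
  measurable_fun D (fun x => Re (f x)) -> measurable_fun D (fun x => Im (f x)) ->
  (forall x, D x -> sqn (f x) <= B) -> L2 mu D f.
Proof.
move=> fin m1 m2 fB; split=> //; apply: (@integrableR_le _ _ _ _ _ mD _ (fun=> B)).
- have -> : (fun x => Normc.normc (f x) ^+ 2) = (fun x => Re (f x) ^+ 2 + Im (f x) ^+ 2).
    by apply/funext => x; rewrite normc_sqn.
  by apply: measurable_funD; exact: measurable_sqr.
- by move=> x Dx; rewrite normc_sqn ger0_norm ?sqn_ge0 ?fB.
- exact: integrableR_cst.
Qed.

Lemma Re_cintegral_sq f : L2 mu D f -> Re (cintegral mu D (fun x => f x * conjc (f x))) =
  \int[mu]_(x in D) (Re (f x)) ^+ 2 + \int[mu]_(x in D) (Im (f x)) ^+ 2.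
Proof.
move=> /L2P[[_ f1] [_ f2]]; rewrite Re_cintegral -RintegralD //.
by apply: eq_Rintegral => x _; rewrite Re_mulc_conj.
Qed.
End Linear.

Lemma L2S (D E : set X) f : measurable D -> measurable E -> E `<=` D ->
  L2 mu D f -> L2 mu E f.
Proof.
move=> mD mE ED [m1 m2 fi]; split; try exact: measurable_funS ED _.
exact: integrableS fi.
Qed.
End ComplexIntegral.

Section L2Hilbert.
Context d (X : measurableType d) (R : realType) (mu : {measure set X -> \bar R}).
Context (n : nat) (E : 'I_n -> set X).
Hypothesis mE : forall j, measurable (E j).
Local Notation V := ('I_n -> X -> R[i]).

Definition L2s (f : V) : Prop := forall j, L2 mu (E j) (f j).
Definition ips (f g : V) : R[i] :=
  \sum_j cintegral mu (E j) (fun x => f j x * conjc (g j x)).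

Lemma sq_ips f : L2s f -> Re (ips f f) = \sum_j
  (\int[mu]_(x in E j) (Re (f j x)) ^+ 2 + \int[mu]_(x in E j) (Im (f j x)) ^+ 2).
Proof.
by move=> fL; rewrite Re_sum; apply: eq_bigr => j _; exact: (Re_cintegral_sq (mE j) (fL j)).
Qed.

(** Completeness reduces to the real Riesz-Fischer theorem, applied to the real and the imaginary
    part on each set of the family. *)
Lemma L2s_hilbert : hilbert_form L2s ips.
Proof.
have LD f g : L2s f -> L2s g -> L2s (f + g) by move=> hf hg j; exact: L2D.
have LZ a f : L2s f -> L2s (a *: f) by move=> hf j; exact: L2Z.
split=> //.
- by move=> j; exact: L2_0.
- move=> f g h fL gL hL; rewrite -big_split; apply: eq_bigr => j _ /=.
  rewrite -cintegralD //; try exact: L2_mul_conj.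
  by apply: eq_cintegral => x _; rewrite mulrDl.
- move=> a f g fL gL; rewrite mulr_sumr; apply: eq_bigr => j _ /=.
  rewrite -cintegralZ //; last exact: L2_mul_conj.
  by apply: eq_cintegral => x _; rewrite mulrA.
- move=> f g fL gL; rewrite conjc_sum; apply: eq_bigr => j _.
  rewrite -cintegral_conj //; last exact: L2_mul_conj.
  by apply: eq_cintegral => x _; rewrite conjcM conjcK mulrC.
- move=> f fL; rewrite sq_ips //; apply: sumr_ge0 => j _.
  by rewrite addr_ge0 // Rintegral_ge0 // => x _; exact: sqr_ge0.
move=> u uL ucau.
have LB f g : L2s f -> L2s g -> L2s (f - g).
  by move=> fL gL; have := LD _ _ fL (LZ (-1) _ gL); rewrite scaleN1r.
have le1 f j : L2s f -> \int[mu]_(x in E j) Re (f j x) ^+ 2 +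
    \int[mu]_(x in E j) Im (f j x) ^+ 2 <= Re (ips f f).
  move=> fL; rewrite sq_ips // (bigD1 j) //= lerDl sumr_ge0 // => i _.
  by rewrite addr_ge0 // Rintegral_ge0 // => x _; exact: sqr_ge0.
have pos j (F : X -> R) : 0 <= \int[mu]_(x in E j) F x ^+ 2.
  by rewrite Rintegral_ge0 // => x _; exact: sqr_ge0.
have part (P : R[i] -> R) : (forall z w, P (z - w) = P z - P w) ->
    (forall f j, L2s f -> sq_int mu (E j) (fun x => P (f j x))) ->
    (forall f j, L2s f -> \int[mu]_(x in E j) P (f j x) ^+ 2 <= Re (ips f f)) ->
    forall j, exists f, sq_int mu (E j) f /\ forall e : R, 0 < e ->
   exists N, forall k, (N <= k)%N -> \int[mu]_(x in E j) (P (u k j x) - f x) ^+ 2 <= e.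
  move=> PB PL Pint j.
  have [||f fL hf] := @riesz_fischer _ _ _ mu (E j) (mE j) (fun k x => P (u k j x)).
  - by move=> k; exact: PL.
  - move=> e /ucau [N hN]; exists N => k l Nk Nl.
    apply: le_trans (hN k l Nk Nl); apply: le_trans (Pint _ j (LB _ _ (uL k) (uL l))).
    by under eq_Rintegral do rewrite -PB.
  by exists f.
have /choice [fr hr] : forall j, exists f, sq_int mu (E j) f /\ forall e : R, 0 < e ->
   exists N, forall k, (N <= k)%N -> \int[mu]_(x in E j) (Re (u k j x) - f x) ^+ 2 <= e.
  apply: (part (@complex.Re R)); [by move=> z w; rewrite ReD ReN| |].
    by move=> f j /(_ j) /L2P => /(_ (mE j)) [].
  move=> f j fL.
  by have := le1 f j fL; have := pos j (fun x => Im (f j x)); lra.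
have /choice [fi hi] : forall j, exists f, sq_int mu (E j) f /\ forall e : R, 0 < e ->
   exists N, forall k, (N <= k)%N -> \int[mu]_(x in E j) (Im (u k j x) - f x) ^+ 2 <= e.
  apply: (part (@complex.Im R)); [by move=> z w; rewrite ImD ImN| |].
    by move=> f j /(_ j) /L2P => /(_ (mE j)) [].
  move=> f j fL.
  by have := le1 f j fL; have := pos j (fun x => Re (f j x)); lra.
pose f : V := fun j x => Complex (fr j x) (fi j x).
have fL : L2s f by move=> j; apply/L2P => //; split; [have [] := hr j|have [] := hi j].
(* There are two contributions for each of the [n] sets; [n.+1] keeps the denominator positive for
   an empty family. *)
exists f => // e e0; pose e' := e / (2 * n.+1%:R).
have e'0 : 0 < e' by rewrite divr_gt0 // mulr_gt0.
have /choice [Nr hNr] := fun j => (hr j).2 e' e'0.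
have /choice [Ni hNi] := fun j => (hi j).2 e' e'0.
exists (maxn (\max_j Nr j) (\max_j Ni j)) => k; rewrite geq_max => /andP[kr ki].
rewrite sq_ips; last exact: LB.
apply: (@le_trans _ _ (\sum_(j < n) (e' + e'))).
  apply: ler_sum => j _; apply: lerD.
    under eq_Rintegral do rewrite /= ReD ReN.
    by apply: hNr; apply: leq_trans kr; exact: (leq_bigmax j).
  under eq_Rintegral do rewrite /= ImD ImN.
  by apply: hNi; apply: leq_trans ki; exact: (leq_bigmax j).
rewrite sumr_const card_ord -mulr_natr /e'.
have -> : (e / (2 * n.+1%:R) + e / (2 * n.+1%:R)) * n%:R = e * (n%:R / n.+1%:R).
  by field; apply/eqP => h; have := ler0n R n; lra.
by apply: ler_piMr; [exact: ltW | rewrite ler_pdivrMr ?ltr0Sn // mul1r ler_nat].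
Qed.
End L2Hilbert.

(** * Fubini's theorem for real and complex integrands *)

Section FineIntegral.
Context d (X : measurableType d) (R : realType) (mu : {measure set X -> \bar R}).

(** Section integrals may be infinite on a null set. Replacing them there by the default value of
    [fine] does not change the outer integral. *)
Lemma Rintegral_fine (D : set X) (G : X -> \bar R) : measurable D ->
  integrable mu setT G -> (forall x, ~ D x -> G x = 0%E) ->
  integrableR mu D (fun x => fine (G x)) /\
  \int[mu]_(x in D) fine (G x) = fine (\int[mu]_x G x)%E.
Proof.
move=> mD Gi G0.
have GD : integrable mu D G by apply: integrableS Gi.
have mG : measurable_fun D G by case/integrableP: GD.
have mF : measurable_fun D (EFin \o (fine \o G)).
  by apply/measurable_EFinP; exact: measurableT_comp.
split.
  apply/integrableP; split=> //; case/integrableP: GD => _; apply: le_lt_trans.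
  apply: ge0_le_integral => //; do 2? exact: measurableT_comp.
  by move=> x _ /=; case: (G x) => [r| |] //=; rewrite normr0 ?leey.
rewrite /Rintegral; congr fine; transitivity (\int[mu]_(x in D) G x)%E.
  apply: ae_eq_integral => //; have := integrable_ae mD GD.
  by apply: filterS => x h Dx; rewrite /= fineK //; exact: h.
rewrite integral_mkcond; apply: eq_integral => x _; rewrite patchE.
by case: ifPn => // /negP xD; rewrite G0 // => Dx; apply: xD; rewrite inE.
Qed.

Lemma integrableR_restrict (D : set X) (g : X -> R) : measurable D ->
  integrableR mu D g -> integrableR mu setT (g \_ D).
Proof. by move=> mD gi; have := (integrable_mkcond _ mD).1 gi; rewrite restrict_EFin. Qed.
End FineIntegral.

Section Fubini.
Context d1 d2 (T1 : measurableType d1) (T2 : measurableType d2) (R : realType).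
Variable m1 : {sigma_finite_measure set T1 -> \bar R}.
Variable m2 : {sigma_finite_measure set T2 -> \bar R}.
Variables (D1 : set T1) (D2 : set T2).
Hypotheses (mD1 : measurable D1) (mD2 : measurable D2).
Local Notation m12 := (m1 \x m2)%E.

Let mD12 : measurable (D1 `*` D2). Proof. exact: measurableX. Qed.

Section RealFubini.
Variable f : T1 * T2 -> R.
Hypothesis fi : integrableR m12 (D1 `*` D2) f.

Let f' := (EFin \o f) \_ (D1 `*` D2).
Let f'i : integrable m12 setT f'. Proof. exact: ((integrable_mkcond _ mD12).1 fi). Qed.

Lemma Rfubini1 : integrableR m1 D1 (fun x => \int[m2]_(y in D2) f (x, y)) /\
  \int[m1]_(x in D1) (\int[m2]_(y in D2) f (x, y)) =
  \int[m12]_(z in D1 `*` D2) f z.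
Proof.
pose F := fubini_F m2 f'.
have FE x : D1 x -> \int[m2]_(y in D2) f (x, y) = fine (F x).
  move=> D1x; rewrite /Rintegral integral_mkcond; congr fine; apply: eq_integral => y _.
  rewrite /f' !patchE; congr (if _ then _ else _).
  by apply/idP/idP => /set_mem h; apply/mem_set => //; case: h.
have F0 x : ~ D1 x -> F x = 0%E.
  move=> D1x; apply: integral0_eq => y _.
  by rewrite /f' patchE; case: ifPn => // /set_mem [].
have [h1 h2] := Rintegral_fine mD1 (integrable_fubini_F f'i) F0; split.
  by apply: (eq_integrable mD1) h1 => x /set_mem /FE /= ->.
transitivity (\int[m1]_(x in D1) fine (F x)).
  by apply: eq_Rintegral => x /set_mem /FE.
rewrite h2 (integral12_prod_meas1 f'i).
by rewrite /Rintegral [in RHS]integral_mkcond.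
Qed.

Lemma Rfubini2 : integrableR m2 D2 (fun y => \int[m1]_(x in D1) f (x, y)) /\
  \int[m2]_(y in D2) (\int[m1]_(x in D1) f (x, y)) =
  \int[m12]_(z in D1 `*` D2) f z.
Proof.
pose F := fubini_G m1 f'.
have FE y : D2 y -> \int[m1]_(x in D1) f (x, y) = fine (F y).
  move=> D2y; rewrite /Rintegral integral_mkcond; congr fine; apply: eq_integral => x _.
  rewrite /f' !patchE; congr (if _ then _ else _).
  by apply/idP/idP => /set_mem h; apply/mem_set => //; case: h.
have F0 y : ~ D2 y -> F y = 0%E.
  move=> D2y; apply: integral0_eq => x _.
  by rewrite /f' patchE; case: ifPn => // /set_mem [].
have Fi : integrable m2 setT F.
  apply/integrableP; split; first exact: (measurable_fubini_G f'i).
  apply: (@le_lt_trans _ _ (\int[m2]_y \int[m1]_x `|f' (x, y)|)%E); last first.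
    by apply: (integrable21ltyP _ _ _).1 => //; case/integrableP: f'i.
  have mabs : measurable_fun setT (fun y => \int[m1]_x `|f' (x, y)|)%E.
    apply: (measurable_fun_fubini_tonelli_G (abse \o f')) => //=.
    by apply: measurableT_comp => //; case/integrableP: f'i.
  apply: ge0_le_integral => //.
  - by apply: measurableT_comp => //; exact: (measurable_fubini_G f'i).
  - move=> y _; apply: le_abse_integral => //.
    by apply: measurableT_comp => //; case/integrableP: f'i.
have [h1 h2] := Rintegral_fine mD2 Fi F0; split.
  by apply: (eq_integrable mD2) h1 => x /set_mem /FE /= ->.
transitivity (\int[m2]_(x in D2) fine (F x)).
  by apply: eq_Rintegral => x /set_mem /FE.
rewrite h2 (integral21_prod_meas1 f'i).
by rewrite /Rintegral [in RHS]integral_mkcond.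
Qed.
End RealFubini.

Lemma integrableR_prod (a : T1 -> R) (b : T2 -> R) :
  integrableR m1 D1 a -> integrableR m2 D2 b ->
  integrableR m12 (D1 `*` D2) (fun z => a z.1 * b z.2).
Proof.
move=> ai bi; apply: (integrable_mkcond _ mD12).2.
pose a' := a \_ D1; pose b' := b \_ D2.
have ab : ((EFin \o (fun z => a z.1 * b z.2)) \_ (D1 `*` D2)) =
    (fun z => (a' z.1 * b' z.2)%:E).
  apply/funext => -[x y]; rewrite /a' /b' !patchE /=.
  case: (pselect ((D1 `*` D2) (x, y))) => h.
    by rewrite !mem_set //; case: h.
  rewrite (memNset h).
  case: (boolP (x \in D1)) => xD; last by rewrite mul0r.
  case: (boolP (y \in D2)) => yD; last by rewrite mulr0.
  by exfalso; apply: h; split; exact: set_mem.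
rewrite ab.
have a'i : integrableR m1 setT a' by exact: integrableR_restrict.
have b'i : integrableR m2 setT b' by exact: integrableR_restrict.
have ma : measurable_fun setT a' by exact: integrableR_meas a'i.
have mb : measurable_fun setT b' by exact: integrableR_meas b'i.
apply/integrable12ltyP.
  by apply/measurable_EFinP; apply: measurable_funM; exact: measurableT_comp.
pose B := (\int[m2]_y `|(b' y)%:E|)%E.
have Bfin : (B < +oo)%E by case/integrableP: b'i.
have Bf : B \is a fin_num by rewrite ge0_fin_numE // integral_ge0.
have e x : (\int[m2]_y `|(a' x * b' y)%:E| = `|(a' x)%:E| * B)%E.
  rewrite /B -ge0_integralZl //.
  - by apply: eq_integral => y _; rewrite EFinM abseM.
  - by apply: measurableT_comp => //; exact/measurable_EFinP.
apply: (@le_lt_trans _ _ (\int[m1]_x (`|(a' x)%:E| * B))%E).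
  by rewrite le_eqVlt; apply/orP; left; apply/eqP; apply: eq_integral => x _; exact: e.
rewrite -(fineK Bf) ge0_integralZr //; last 2 first.
  by apply: measurableT_comp => //; exact/measurable_EFinP.
  by rewrite lee_fin fine_ge0 // integral_ge0.
case/integrableP: a'i => _ Afin; rewrite muleC; apply: lte_mul_pinfty => //.
by rewrite lee_fin fine_ge0 // integral_ge0.
Qed.

Lemma cfubini1 (f : T1 * T2 -> R[i]) : cintegrable m12 (D1 `*` D2) f ->
  cintegrable m1 D1 (fun x => cintegral m2 D2 (fun y => f (x, y))) /\
  cintegral m1 D1 (fun x => cintegral m2 D2 (fun y => f (x, y))) =
  cintegral m12 (D1 `*` D2) f.
Proof.
move=> [f1 f2]; have [h1 e1] := Rfubini1 f1; have [h2 e2] := Rfubini1 f2.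
by split; [split|apply: complex_eqP].
Qed.

Lemma cintegrable_prod (a : T1 -> R[i]) (b : T2 -> R[i]) :
  cintegrable m1 D1 a -> cintegrable m2 D2 b ->
  cintegrable m12 (D1 `*` D2) (fun z => a z.1 * b z.2).
Proof.
move=> [a1 a2] [b1 b2]; split.
  apply: (eq_integrable mD12) (integrableRD mD12 (integrableR_prod a1 b1)
    (integrableRN (integrableR_prod a2 b2))) => z _ /=; congr _%:E.
  by rewrite ReM.
apply: (eq_integrable mD12) (integrableRD mD12 (integrableR_prod a1 b2)
    (integrableR_prod a2 b1)) => z _ /=; congr _%:E.
by rewrite ImM.
Qed.

Lemma cintegral_prod (a : T1 -> R[i]) (b : T2 -> R[i]) :
  cintegrable m1 D1 a -> cintegrable m2 D2 b ->
  cintegral m12 (D1 `*` D2) (fun z => a z.1 * b z.2) =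
  cintegral m1 D1 a * cintegral m2 D2 b.
Proof.
move=> ai bi; rewrite -(cfubini1 (cintegrable_prod ai bi)).2 /=.
rewrite mulrC -cintegralZ //; apply: eq_cintegral => x _.
by rewrite cintegralZ // mulrC.
Qed.

End Fubini.

(** * Fundamental theorem and integration by parts *)

Section Calculus.
Context {R : realType}.
Local Notation leb := (@lebesgue_measure R).
Local Notation oo a b := (`]a, b[%classic : set R).
Local Notation mR := (measurableTypeR R).
Implicit Types (f g F : R -> R).

Lemma ooP a b x : oo a b x <-> a < x < b.
Proof. by rewrite /= in_itv. Qed.

Lemma mleb (i : interval R) : measurable ([set` i] : set mR).
Proof. exact: measurable_itv. Qed.

Lemma leb_oo_lt a b : (leb (oo a b) < +oo)%E.
Proof. by rewrite lebesgue_measure_itv /=; case: ifP => _; rewrite ?EFinN -?EFinB ltry. Qed.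

Lemma fine_leb_oo (a b : R) : a <= b -> fine (leb (oo a b)) = b - a.
Proof.
rewrite le_eqVlt => /orP[/eqP ->|ab]; rewrite lebesgue_measure_itv /= lte_fin.
  by rewrite ltxx subrr.
by rewrite ab.
Qed.

Lemma measurable_continuous f D : measurable D -> continuous f -> measurable_fun D f.
Proof. by move=> mD cf; apply: measurable_funTS; exact: continuous_measurable_fun. Qed.

Lemma continuous_integrableR f (a b : R) : continuous f -> integrableR leb (oo a b) f.
Proof.
move=> cf; have h : integrableR leb `[a, b]%classic f.
  apply: continuous_compact_integrable; first exact: segment_compact.
  exact: continuous_subspaceT.
by apply: integrableS h => //; exact: subset_itv_oo_cc.
Qed.

Lemma Rintegral_oo_cc f (a b : R) : integrableR leb (oo a b) f ->
  \int[leb]_(x in oo a b) f x = \int[leb]_(x in `[a, b]) f x.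
Proof.
move=> fi; have [ab|ba] := ltP a b; last first.
  move: ba; rewrite le_eqVlt => /orP[/eqP ->|ba].
    by rewrite set_itvoo0 set_itv1 Rintegral_set0 Rintegral_set1.
  rewrite !set_itv_ge ?Rintegral_set0 //; rewrite bnd_simp -?leNgt -?ltNge //; exact: ltW.
have fi' : integrableR leb `]a, b]%classic f.
  case/integrableP: fi => mf fin; apply/integrableP; split.
    apply/measurable_EFinP; move/measurable_EFinP: mf => mf.
    by apply/measurable_fun_itv_bndo_bndcP.
  rewrite (_ : (\int[_]_(x in _) _)%E = \int[leb]_(x in `]a, b[) `|(f x)%:E|)%E //.
  rewrite -integral_itv_bndo_bndc //.
  by apply: measurableT_comp => //; exact/measurable_EFinP.
by rewrite Rintegral_itv_bndo_bndc // Rintegral_itv_obnd_cbnd.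
Qed.

Lemma is_derive_continuous f F : (forall x, is_derive x (1 : R) F (f x)) -> continuous F.
Proof.
move=> dF x; apply: differentiable_continuous; apply/derivable1_diffP.
by have [] := dF x.
Qed.

Lemma Rintegral_FTC f F (a b : R) : a <= b -> (forall x, is_derive x (1 : R) F (f x)) ->
  continuous f -> \int[leb]_(x in oo a b) f x = F b - F a.
Proof.
move=> + dF cf; rewrite le_eqVlt => /orP[/eqP ->|ab].
  by rewrite set_itvoo0 Rintegral_set0 subrr.
rewrite Rintegral_oo_cc; last exact: continuous_integrableR.
have cF := is_derive_continuous dF.
rewrite /Rintegral (@continuous_FTC2 _ f F) //.
- exact: continuous_subspaceT.
- split; first by move=> x _; have [] := dF x.
    by apply: cvg_at_right_filter; exact: cF.
  by apply: cvg_at_left_filter; exact: cF.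
- by move=> x _; rewrite derive1E; have [] := dF x.
Qed.

Definition prim f (y : R) : R := \int[leb]_(x in oo 0 y) f x.

Lemma prim_continuous (l : R) f : 0 < l -> integrableR leb (oo 0 l) f ->
  {within `[0, l], continuous (prim f)}.
Proof.
move=> l0 fi; pose f' := f \_ (oo 0 l).
have f'i : integrableR leb `[0, l]%classic f'.
  apply: (@integrableS _ _ _ _ setT) => //.
  by apply: integrableR_restrict.
have := parameterized_integral_continuous (ltW l0) f'i.
apply: subspace_eq_continuous => y /set_mem /=; rewrite in_itv /= => /andP[y0 yl].
rewrite /from_subspace /= /parameterized_integral /prim -Rintegral_oo_cc; last first.
  by apply: integrableS f'i => // x /=; rewrite !in_itv /= => /andP[x0 xy]; apply/andP;
    split; lra.
apply: eq_Rintegral => x /set_mem; rewrite /= in_itv /= => /andP[x0 xy].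
by rewrite /f' patchE mem_set //= in_itv /=; apply/andP; split; lra.
Qed.

(** Integration by parts for a merely integrable [f]: the primitive of [f] need not be
    differentiable, so both sides are computed by Fubini as the integral of [f x * g y] over the
    triangle [x < y]. *)
Lemma prim_ibp (l : R) f g F : 0 <= l -> integrableR leb (oo 0 l) f ->
  (forall x, is_derive x (1 : R) F (g x)) -> continuous g ->
  integrableR leb (oo 0 l) (fun y => g y * prim f y) /\
  \int[leb]_(y in oo 0 l) (g y * prim f y) =
  \int[leb]_(x in oo 0 l) (f x * (F l - F x)).
Proof.
move=> l0 fi dF cg; have gi := continuous_integrableR 0 l cg.
pose A : set (mR * mR) := [set z : R * R | z.1 < z.2].
have mA : measurable A.
  have -> : A = setT `&` (fun z : mR * mR => z.2 - z.1 : R) @^-1` `]0, +oo[%classic.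
    by rewrite setTI; apply/seteqP; split => z /=; rewrite /A /= in_itv /= andbT subr_gt0.
  by apply: measurable_funB => //.
pose D := oo 0 l.
have Ai : integrableR (leb \x leb)%E (D `*` D) (fun z => f z.1 * g z.2 * \1_A z).
  have fgi := integrableR_prod (mleb _) (mleb _) fi gi.
  have mD : measurable (D `*` D : set (mR * mR)) by apply: measurableX; exact: mleb.
  apply: (@integrableR_le _ _ _ _ _ mD _ (fun z => `|f z.1 * g z.2|)); last exact: integrable_norm.
    apply: measurable_funM; first exact: integrableR_meas fgi.
    exact: measurable_indic.
  move=> z _; rewrite normrM ler_piMr // indicE.
  by case: (_ \in _); rewrite ?normr1 ?normr0.
have eF y : D y -> g y * prim f y = \int[leb]_(x in D) (f x * g y * \1_A (x, y)).
  rewrite /D /= in_itv /= => /andP[y0 yl].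
  have -> : \int[leb]_(x in D) (f x * g y * \1_A (x, y)) =
      \int[leb]_(x in D) ((fun x => g y * f x) \_ (oo 0 y)) x.
    apply: eq_Rintegral => x /set_mem; rewrite /D /= in_itv /= => /andP[x0 xl].
    rewrite patchE indicE; have [xy|yx] := ltP x y.
      rewrite !mem_set //=; first by rewrite mulr1 mulrC.
      by rewrite in_itv /= x0.
    rewrite !memNset ?mulr0 //=; first by rewrite in_itv /= x0 ltNge yx.
    by rewrite /A /= ltNge yx.
  rewrite -Rintegral_mkcondr.
  have -> : D `&` oo 0 y = oo 0 y.
    rewrite setIidr // => x; rewrite /D /= !in_itv /= => /andP[x0 xy].
    by apply/andP; split; lra.
  rewrite RintegralZl //; apply: integrableS fi => // x; rewrite /= !in_itv /= => /andP[x0 xy].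
  by apply/andP; split; lra.
have eG x : D x -> f x * (F l - F x) = \int[leb]_(y in D) (f x * g y * \1_A (x, y)).
  rewrite /D /= in_itv /= => /andP[x0 xl].
  have -> : \int[leb]_(y in D) (f x * g y * \1_A (x, y)) =
      \int[leb]_(y in D) ((fun y => f x * g y) \_ (oo x l)) y.
    apply: eq_Rintegral => y /set_mem; rewrite /D /= in_itv /= => /andP[y0 yl].
    rewrite patchE indicE; have [xy|yx] := ltP x y.
      by rewrite !mem_set //= ?mulr1 // in_itv /= xy.
    rewrite !memNset ?mulr0 //=; first by rewrite in_itv /= ltNge yx.
    by rewrite /A /= ltNge yx.
  rewrite -Rintegral_mkcondr.
  have -> : D `&` oo x l = oo x l.
    rewrite setIidr // => y; rewrite /D /= !in_itv /= => /andP[y0 yl].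
    by apply/andP; split; lra.
  by rewrite RintegralZl ?(Rintegral_FTC (ltW xl) dF cg) //; exact: continuous_integrableR.
have [h1 e1] := @Rfubini2 _ _ _ _ _ leb leb D D (mleb _) (mleb _) _ Ai.
have [_ e2] := @Rfubini1 _ _ _ _ _ leb leb D D (mleb _) (mleb _) _ Ai.
split.
  by apply: (eq_integrable (mleb _)) h1 => y /set_mem /eF /= ->.
transitivity (\int[leb]_(y in D) (\int[leb]_(x in D) (f x * g y * \1_A (x, y)))).
  by apply: eq_Rintegral => y /set_mem /eF ->.
rewrite e1 -e2.
by apply: eq_Rintegral => x /set_mem /eG ->.
Qed.
End Calculus.

(** * Completeness of the sine functions on an interval *)

Section Trigonometry.
Context {R : realType}.

Lemma is_derive_affine (a b x : R) : is_derive x (1 : R) (fun x => a * x + b) a.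
Proof.
have -> : (fun x => a * x + b) = (a *: id) \+ cst b by apply/funext => y.
by apply: is_derive_eq; rewrite addr0 /GRing.scale /= mulr1.
Qed.

Lemma is_derive_sin_affine (a b x : R) :
  is_derive x (1 : R) (fun x => sin (a * x + b)) (a * cos (a * x + b)).
Proof.
rewrite mulrC.
by apply: (@is_derive1_comp _ (@sin R) (fun x => a * x + b) x); exact: is_derive_affine.
Qed.

Lemma is_derive_cos_affine (a b x : R) :
  is_derive x (1 : R) (fun x => cos (a * x + b)) (- (a * sin (a * x + b))).
Proof.
rewrite mulrC -mulNr.
by apply: (@is_derive1_comp _ (@cos R) (fun x => a * x + b) x); exact: is_derive_affine.
Qed.

Lemma continuous_cos_affine (a b : R) : continuous (fun x => cos (a * x + b)).
Proof. by apply: (@is_derive_continuous _ (fun x => - (a * sin (a * x + b)))) => x;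
  exact: is_derive_cos_affine. Qed.

Lemma continuous_sin_affine (a b : R) : continuous (fun x => sin (a * x + b)).
Proof. by apply: (@is_derive_continuous _ (fun x => a * cos (a * x + b))) => x;
  exact: is_derive_sin_affine. Qed.

Lemma sin_cos_natpi k : sin (k%:R * pi) = 0 :> R /\ cos (k%:R * pi) = (-1) ^+ k :> R.
Proof.
elim: k => [|k [IHs IHc]]; first by rewrite mul0r sin0 cos0 expr0.
rewrite -natr1 mulrDl mul1r (sinD (k%:R * pi)) (cosD (k%:R * pi)) IHs IHc cospi sinpi exprS; split; ring.
Qed.

Lemma sin_natpi k : sin (k%:R * pi) = 0 :> R. Proof. by case: (sin_cos_natpi k). Qed.
Lemma cos_natpi k : cos (k%:R * pi) = (-1) ^+ k :> R. Proof. by case: (sin_cos_natpi k). Qed.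
End Trigonometry.

Section SineCompleteness.
Context {R : realType}.
Local Notation leb := (@lebesgue_measure R).
Local Notation mR := (measurableTypeR R).
Local Notation oo a b := (`]a, b[%classic : set R).
Variables (l : R) (l0 : 0 < l).
Local Notation D := (oo 0 l).
Local Notation w k := (k%:R * pi / l : R).

Definition bdd_meas (f : R -> R) : Prop := measurable_fun (D : set mR) f /\
  exists M, forall x, D x -> `|f x| <= M.

Lemma bdd_meas_int f : bdd_meas f -> integrableR leb D f.
Proof.
move=> [mf [M hM]]; apply: (@integrableR_le _ _ _ _ _ (mleb _) _ (fun=> M)) => //.
by apply: integrableR_cst; [exact: mleb | exact: leb_oo_lt].
Qed.

Lemma bdd_measM f g : bdd_meas f -> bdd_meas g -> bdd_meas (fun x => f x * g x).
Proof.
move=> [mf [M hM]] [mg [N hN]]; split; first exact: measurable_funM.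
by exists (M * N) => x Dx; rewrite normrM ler_pM ?hM ?hN.
Qed.

Lemma bdd_measD f g : bdd_meas f -> bdd_meas g -> bdd_meas (fun x => f x + g x).
Proof.
move=> [mf [M hM]] [mg [N hN]]; split; first exact: measurable_funD.
by exists (M + N) => x Dx; rewrite (le_trans (ler_normD _ _)) // lerD ?hM ?hN.
Qed.

Lemma bdd_meas_cst c : bdd_meas (fun=> c).
Proof. by split; [exact: measurable_cst | exists `|c|]. Qed.

Lemma bdd_meas_cos a : bdd_meas (fun x => cos (a * x)).
Proof.
have -> : (fun x => cos (a * x)) = (fun x => cos (a * x + 0)).
  by apply/funext => x; rewrite addr0.
split; first by apply: measurable_continuous; [exact: mleb | exact: continuous_cos_affine].
by exists 1 => x _; exact: cos_max.
Qed.

(** The powers of [q] concentrate near [y0], where [H] is positive: the contribution near [y0] is at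
    least of order [r1 ^+ n], while the rest is at least minus a constant times [r2 ^+ n]. As
    [r2 < r1], the integrals cannot all vanish. *)
Lemma peaking (H q : R -> R) (y0 rho dl eta r1 r2 : R) :
  bdd_meas H -> (forall n, bdd_meas (fun x => q x ^+ n)) -> (forall x, 0 <= q x) ->
  0 < eta -> 0 < rho -> rho <= dl -> dl < y0 -> dl < l - y0 -> 0 <= r2 -> r2 < r1 ->
  (forall x, `|x - y0| < dl -> eta <= H x) -> (forall x, `|x - y0| < rho -> r1 <= q x) ->
  (forall x, 0 < x -> x < l -> dl <= `|x - y0| -> q x <= r2) ->
  ~ forall n, \int[leb]_(x in D) (H x * q x ^+ n) = 0.
Proof.
move=> bH bq q0 eta0 rho0 rhodl dly dll r20 r12 hH hq qout orth.
have r10 : 0 < r1 by clear -r20 r12; lra.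
pose J := oo (y0 - rho) (y0 + rho).
have JD : D `&` J = J.
  rewrite setIidr // => x /ooP /andP[x1 x2]; apply/ooP.
  by clear -rhodl dly dll x1 x2; apply/andP; split; lra.
have [_ [M0 hM0]] := bH; pose M := Num.max M0 1.
have M1 : 1 <= M by rewrite le_max lexx orbT.
have M0' : 0 <= M by apply: le_trans M1.
have hM x : D x -> - M <= H x.
  by move=> Dx; have : `|H x| <= M by [rewrite le_max hM0]; rewrite ler_norml => /andP[].
(* Pointwise [H x * q x ^+ n >= A x - M * r2 ^+ n]: within [rho] both factors are bounded below,
   between [rho] and [dl] the product is nonnegative, beyond [dl] the power is small. *)
have ineq n : eta * r1 ^+ n * (2 * rho) <= M * r2 ^+ n * l.
  have r2n0 : 0 <= r2 ^+ n by rewrite exprn_ge0.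
  have Mr : 0 <= M * r2 ^+ n by apply: mulr_ge0.
  pose A (x : R) := ((fun=> eta * r1 ^+ n) \_ J) x.
  have Ai : integrableR leb D A.
    apply: (@integrableS _ _ _ _ setT) => //.
    apply: integrableR_restrict; first exact: mleb.
    by apply: integrableR_cst; [exact: mleb | exact: leb_oo_lt].
  have Bi : integrableR leb D (fun=> M * r2 ^+ n).
    by apply: integrableR_cst; [exact: mleb | exact: leb_oo_lt].
  have : \int[leb]_(x in D) (A x - M * r2 ^+ n) <= 0.
    apply: (@le_trans _ _ (\int[leb]_(x in D) (H x * q x ^+ n))); last by rewrite orth.
    apply: le_Rintegral; first exact: mleb.
    - by apply: integrableRD; [exact: mleb|exact: Ai|exact: integrableRN].
    - by apply: bdd_meas_int; exact: bdd_measM.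
    - move=> x Dx; have Hm := hM x Dx.
      have qn0 : 0 <= q x ^+ n by rewrite exprn_ge0.
      have p0 : (point : R) = 0 by [].
      rewrite /A patchE p0; case: ifPn => [/set_mem|xJ].
        move=> /ooP /andP[x1 x2].
        have xr : `|x - y0| < rho by clear -x1 x2; rewrite ltr_norml; apply/andP; split; lra.
        have h1 : eta <= H x by apply: hH; exact: lt_le_trans rhodl.
        have h2 : r1 ^+ n <= q x ^+ n.
          by apply: lerXn2r; rewrite ?nnegrE ?q0 ?(ltW r10) // hq.
        have : eta * r1 ^+ n <= H x * q x ^+ n.
          by apply: ler_pM; rewrite ?exprn_ge0 // ltW.
        by apply: le_trans; rewrite gerBl.
      have [xdl|xdl] := ltP `|x - y0| dl.
        have h1 : 0 <= H x * q x ^+ n by apply: mulr_ge0 => //; apply: le_trans (hH x xdl); exact: ltW.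
        by apply: le_trans h1; rewrite sub0r oppr_le0.
      have h2 : q x ^+ n <= r2 ^+ n.
        move: Dx; rewrite /= in_itv /= => /andP[x0 xl].
        by apply: lerXn2r; rewrite ?nnegrE ?q0 // qout.
      rewrite sub0r -mulNr; apply: (@le_trans _ _ (- M * q x ^+ n)); last by rewrite ler_wpM2r.
      by rewrite !mulNr lerN2 ler_wpM2l.
  rewrite (RintegralB (mleb _) Ai Bi) (Rintegral_cst _ (mleb _)) -Rintegral_mkcondr JD.
  have -> : fine (leb D) = l by rewrite fine_leb_oo ?subr0 // ltW.
  have e1 : fine (leb J) = 2 * rho by rewrite fine_leb_oo; clear -rho0; lra.
  by rewrite (Rintegral_cst _ (mleb _)) e1 subr_le0.
have ratio n : eta * (2 * rho) <= M * l * (r2 / r1) ^+ n.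
  have hin := ineq n; rewrite expr_div_n.
  have rn : 0 < r1 ^+ n by rewrite exprn_gt0.
  by rewrite [leRHS]mulrA ler_pdivlMr // mulrAC [leRHS]mulrAC.
have rr : `|r2 / r1| < 1.
  by rewrite ger0_norm ?divr_ge0 ?(ltW r10) // ltr_pdivrMr // mul1r.
have /cvgrPdist_lt h := cvg_expr rr.
have Ml : 0 < M * l by apply: mulr_gt0 => //; exact: lt_le_trans M1.
have epos : 0 < eta * (2 * rho) / (M * l) by rewrite divr_gt0 // mulr_gt0 // mulr_gt0.
have [N _ /(_ N (leqnn _))] := h _ epos.
rewrite /= sub0r normrN ger0_norm ?exprn_ge0 ?divr_ge0 ?(ltW r10) //.
by rewrite ltr_pdivlMr // mulrC ltNge ratio.
Qed.

Section CosineOrthogonal.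
Variable H : R -> R.
Hypotheses (bH : bdd_meas H)
  (Hcos : forall k, \int[leb]_(x in D) (H x * cos (w k * x)) = 0).

(** By the product-to-sum formula these multipliers are stable under multiplication by
    [cos (w 1 * x)]; being stable under linear combinations too, they contain all polynomials in
    that cosine. *)
Let ortho (phi : R -> R) := bdd_meas phi /\
  forall k, \int[leb]_(x in D) (H x * phi x * cos (w k * x)) = 0.

Let ortho1 : ortho (fun=> 1).
Proof.
split=> [|k]; first exact: bdd_meas_cst.
by under eq_Rintegral do rewrite mulr1.
Qed.

Let orthoD f g : ortho f -> ortho g -> ortho (fun x => f x + g x).
Proof.
move=> [bf hf] [bg hg]; split=> [|k]; first exact: bdd_measD.
transitivity (\int[leb]_(x in D) (H x * f x * cos (w k * x)) +
  \int[leb]_(x in D) (H x * g x * cos (w k * x))); last by rewrite hf hg addr0.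
rewrite -RintegralD ?mleb //; last 2 first.
- by apply: bdd_meas_int; do 2?apply: bdd_measM => //; exact: bdd_meas_cos.
- by apply: bdd_meas_int; do 2?apply: bdd_measM => //; exact: bdd_meas_cos.
by apply: eq_Rintegral => x _; ring.
Qed.

Let orthoZ c f : ortho f -> ortho (fun x => c * f x).
Proof.
move=> [bf hf]; split=> [|k].
  by apply: bdd_measM => //; exact: bdd_meas_cst.
transitivity (c * \int[leb]_(x in D) (H x * f x * cos (w k * x)));
  last by rewrite hf mulr0.
rewrite -RintegralZl ?mleb //; last first.
  by apply: bdd_meas_int; do 2?apply: bdd_measM => //; exact: bdd_meas_cos.
by apply: eq_Rintegral => x _; ring.
Qed.

Let orthoM f : ortho f -> ortho (fun x => f x * cos (w 1 * x)).
Proof.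
move=> [bf hf]; split=> [|k]; first by apply: bdd_measM => //; exact: bdd_meas_cos.
case: k => [|k].
  apply: etrans (hf 1%N); apply: eq_Rintegral => x _.
  by rewrite !mul0r cos0; ring.
have bb j : integrableR leb D (fun x => H x * f x * cos (w j * x)).
  by apply: bdd_meas_int; do 2?apply: bdd_measM => //; exact: bdd_meas_cos.
transitivity (2^-1 * (\int[leb]_(x in D) (H x * f x * cos (w k.+2 * x)) +
  \int[leb]_(x in D) (H x * f x * cos (w k * x)))); last by rewrite !hf addr0 mulr0.
rewrite -RintegralD ?mleb // -RintegralZl ?mleb //; last by apply: integrableRD; rewrite ?mleb.
apply: eq_Rintegral => x _.
have -> : w k.+2 * x = w k.+1 * x + w 1 * x.
  by rewrite -(natr1 k.+1); field; rewrite gt_eqF.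
have -> : w k * x = w k.+1 * x - w 1 * x.
  by rewrite -(natr1 k); field; rewrite gt_eqF.
by rewrite cosD cosB; field.
Qed.

(** A polynomial in the cosine. With [c0] the cosine at [y0], its values lie between 0 and 1 and it
    equals 1 only at [y0], the cosine being injective on the interval. *)
Let q c0 x : R := 1 - (cos (w 1 * x) - c0) ^+ 2 / 4.

Let ortho_q c0 n : ortho (fun x => q c0 x ^+ n).
Proof.
elim: n => [|n IH]; first by under eq_fun do rewrite expr0.
have -> : (fun x => q c0 x ^+ n.+1) = (fun x => (1 - c0 ^+ 2 / 4) * q c0 x ^+ n +
   (c0 / 2 * (q c0 x ^+ n * cos (w 1 * x)) +
    (- 4^-1) * (q c0 x ^+ n * cos (w 1 * x) * cos (w 1 * x)))).
  by apply/funext => x; rewrite exprS {1}/q; field.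
by apply: orthoD; [|apply: orthoD]; apply: orthoZ => //; do 2?apply: orthoM.
Qed.

(** A positive value at [y0] would persist nearby by continuity and contradict [peaking], since all
    powers of [q] are orthogonal to [H]. *)
Lemma cos_ortho_nonpos y0 : D y0 -> {for y0, continuous H} -> H y0 <= 0.
Proof.
rewrite /= in_itv /= => /andP[y00 y0l] cH; rewrite leNgt; apply/negP => H0.
pose eta := H y0 / 2; have eta0 : 0 < eta by rewrite divr_gt0.
have [d /= d0 hd] : \forall x \near y0, eta <= H x.
  have /cvgrPdist_lt /(_ eta eta0) := cH; apply: filterS => x /=.
  by rewrite ltr_norml => /andP[_]; rewrite /eta; lra.
have hd' x : `|x - y0| < d -> eta <= H x.
  by move=> h; apply: hd; rewrite /= distrC.
pose dl := Num.min (d / 2) (Num.min (y0 / 2) ((l - y0) / 2)).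
have dl0 : 0 < dl by rewrite /dl !lt_min !divr_gt0 ?subr_gt0.
have dld : dl < d by rewrite /dl gt_min; apply/orP; left; lra.
have dly : dl < y0 by rewrite /dl !gt_min; apply/orP; right; apply/orP; left; lra.
have dll : dl < l - y0 by rewrite /dl !gt_min; apply/orP; right; apply/orP; right; lra.
pose th x : R := w 1 * x; have w0 : 0 < w 1 by rewrite mul1r divr_gt0 // pi_gt0.
have thl : th l = pi by rewrite /th; field; rewrite gt_eqF.
have cos_dec x y : 0 <= x -> x < y -> y <= l -> cos (th y) < cos (th x).
  have inpi z : 0 <= z -> z <= l -> th z \in `[0, pi].
    move=> z0 zl; have h : th z <= th l by rewrite /th ler_pM2l.
    have h0 : 0 <= th z by apply: mulr_ge0 => //; exact: ltW.
    by rewrite in_itv /= h0 -thl h.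
  move=> x0 xy yl; rewrite ltr_cos ?inpi ?ltr_pM2l //; lra.
pose c0 := cos (th y0).
(* The cosine decreases strictly, so at distance at least [dl] from [y0] it differs from [c0] by at
   least [kp]. *)
pose kp := Num.min (cos (th (y0 - dl)) - c0) (c0 - cos (th (y0 + dl))).
have kp0 : 0 < kp.
  by rewrite /kp lt_min !subr_gt0; apply/andP; split; apply: cos_dec; lra.
have kpout x : 0 < x -> x < l -> dl <= `|x - y0| -> kp <= `|cos (th x) - c0|.
  move=> x0 xl; rewrite ler_normr => /orP[h|h].
    have : cos (th x) <= cos (th (y0 + dl)).
      have : y0 + dl <= x by lra.
      by rewrite le_eqVlt => /orP[/eqP ->//|?]; apply/ltW/cos_dec; lra.
    have : kp <= c0 - cos (th (y0 + dl)) by rewrite /kp ge_min lexx orbT.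
    by rewrite ler_normr => ? ?; apply/orP; right; lra.
  have : cos (th (y0 - dl)) <= cos (th x).
    have : x <= y0 - dl by lra.
    by rewrite le_eqVlt => /orP[/eqP ->//|?]; apply/ltW/cos_dec; lra.
  have : kp <= cos (th (y0 - dl)) - c0 by rewrite /kp ge_min lexx.
  by rewrite ler_normr => ? ?; apply/orP; left; lra.
have c01 : `|c0| <= 1 by exact: cos_max.
have qE x : q c0 x = 1 - (cos (th x) - c0) ^+ 2 / 4 by [].
have csq x : (cos (th x) - c0) ^+ 2 <= 4.
  have := cos_max (th x); rewrite !ler_norml in c01 * => /andP[? ?].
  by case/andP: c01 => ? ?; nra.
have q0 x : 0 <= q c0 x by rewrite qE; have := csq x; lra.
have q1 x : q c0 x <= 1 by rewrite qE; have := sqr_ge0 (cos (th x) - c0); lra.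
have kp2 : kp ^+ 2 <= 4.
  have h : kp <= `|cos (th (y0 + dl)) - c0|.
    have e : y0 + dl - y0 = dl by lra.
    by apply: kpout; [lra|lra|rewrite e ler_norm].
  have := csq (y0 + dl); rewrite -real_normK ?num_real //.
  by move: h kp0; set a := `|_|; nra.
(* [r2] bounds [q c0] beyond distance [dl]; [r1] lies halfway between [r2] and the peak value 1, so
   by continuity [q c0] exceeds it near [y0]. *)
pose r2 := 1 - kp ^+ 2 / 4; pose r1 := 1 - kp ^+ 2 / 8.
have r20 : 0 <= r2 by rewrite /r2; lra.
have r12 : r2 < r1 by rewrite /r1 /r2; have := exprn_gt0 2 kp0; lra.
have r10 : 0 < r1 by lra.
have qout x : 0 < x -> x < l -> dl <= `|x - y0| -> q c0 x <= r2.
  move=> x0 xl xd; have := kpout x x0 xl xd; rewrite qE /r2.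
  have := real_normK (num_real (cos (th x) - c0)).
  by set a := `|_| => <- ?; nra.
have [d' /= d'0 hq] : \forall x \near y0, r1 <= q c0 x.
  have cq : {for y0, continuous (q c0)}.
    have cc : {for y0, continuous (fun x => cos (w 1 * x + 0))}.
      exact: continuous_cos_affine.
    rewrite /q; apply: cvgB; first exact: cvg_cst.
    apply: cvgM; last exact: cvg_cst.
    rewrite expr2; under eq_fun do rewrite expr2 -[w 1 * _]addr0.
    rewrite -[w 1 * _]addr0.
    by apply: cvgM; apply: cvgB => //; exact: cvg_cst.
  have e0 : 0 < 1 - r1 by rewrite /r1; have := exprn_gt0 2 kp0; lra.
  have /cvgrPdist_lt /(_ _ e0) := cq; apply: filterS => x /=.
  have -> : q c0 y0 = 1 by rewrite qE subrr expr0n /= mul0r subr0.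
  by rewrite ltr_norml => /andP[_]; lra.
pose rho := Num.min (d' / 2) dl.
have rho0 : 0 < rho by rewrite lt_min divr_gt0.
have rhodl : rho <= dl by rewrite ge_min lexx orbT.
have rhod' : rho < d' by rewrite gt_min; apply/orP; left; lra.
have hq' x : `|x - y0| < rho -> r1 <= q c0 x.
  by move=> h; apply: hq; rewrite /= distrC; lra.
apply: (@peaking H (q c0) y0 rho dl eta r1 r2) => //.
- by move=> n; have [] := ortho_q c0 n.
- by move=> x h; apply: hd'; exact: lt_trans dld.
- move=> n; have [_ hq0] := ortho_q c0 n; have := hq0 0%N.
  by under eq_Rintegral do rewrite !mul0r cos0 mulr1.
Qed.
End CosineOrthogonal.

(** Lebesgue differentiation: almost everywhere [f] is the derivative of its primitive, which is
    locally constant here. *)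
Lemma ae_eq0_of_prim_cst f (m : R) : integrableR leb D f ->
  (forall y, D y -> prim f y = m) -> ae_eq leb D f (cst 0).
Proof.
move=> fi fm; pose f' := f \_ D.
have f'i : integrableR leb setT f' by apply: integrableR_restrict => //; exact: mleb.
have f'i' y : integrableR leb `[0, y]%classic f' by apply: integrableS f'i.
have f'l : locally_integrable [set: R] f'.
  by apply: integrable_locally => //; exact: mleb.
have := @FTC1 R f' (BLeft 0) f'i' f'l.
apply: filterS; first exact: (ae_filter_ringOfSetsType leb).
move=> x hx Dx.
have /ooP/andP[x0 xl] := Dx.
have [|_ dF] := hx; first by rewrite /= lte_fin.
rewrite /= in dF.
have -> : f x = f' x by rewrite /f' patchE mem_set.
rewrite -dF derive1E.
rewrite (@near_eq_derive _ _ _ _ (cst m)) ?derive_cst //.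
have : \forall y \near x, D y.
  by apply: near_in_itvoo; rewrite in_itv /= x0.
apply: filterS => y Dy; rewrite /= -(fm y Dy) /prim; have /ooP/andP[y0 yl] := Dy.
rewrite -(@Rintegral_oo_cc _ f'); last first.
  by apply: integrableS f'i => //; exact: mleb.
apply: eq_Rintegral => z /set_mem /ooP/andP[z0 zy].
by rewrite /f' patchE mem_set //; apply/ooP/andP; split; lra.
Qed.

Lemma bdd_meas_prim f : integrableR leb D f -> bdd_meas (prim f).
Proof.
move=> fi; split.
  have d1 x : is_derive x (1 : R) id (cst 1 x) by exact: is_derive_id.
  have [h _] := prim_ibp (ltW l0) fi d1 (fun x => cvg_cst _).
  by apply: eq_measurable_fun (integrableR_meas h) => y _; exact: mul1r.
exists (\int[leb]_(x in D) `|f x|) => y /ooP/andP[y0 yl].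
have sub : oo 0 y `<=` D by move=> z /ooP/andP[z0 zy]; apply/ooP/andP; split; lra.
have fiy : integrableR leb (oo 0 y) f by apply: integrableS fi => //; exact: mleb.
apply: (le_trans (le_normr_Rintegral (mleb _) fiy)).
have nfi := integrable_norm fi.
rewrite -lee_fin -!EFin_Rintegral //; last exact: integrable_norm.
apply: ge0_subset_integral => //; try exact: mleb.
by case/integrableP: nfi.
Qed.

(** Integrating by parts, the primitive [G] of [f] is orthogonal to every nonconstant cosine, the
    boundary terms vanishing with the sines. [G] minus its mean is continuous and orthogonal to all
    cosines, so it vanishes by [cos_ortho_nonpos] applied to it and to its opposite. Passing to the
    primitive is what makes pointwise values meaningful. *)
Lemma sine_complete f : integrableR leb D f ->
  (forall k, \int[leb]_(x in D) (f x * sin (w k * x)) = 0) -> ae_eq leb D f (cst 0).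
Proof.
move=> fi fsin; pose G := prim f; have bG : bdd_meas G := bdd_meas_prim fi.
have wl k : w k * l = k%:R * pi by field; rewrite gt_eqF.
have w0 k : 0 < w k.+1 by rewrite divr_gt0 // mulr_gt0 ?pi_gt0.
have dS k x : is_derive x (1 : R) (fun x => sin (w k * x + 0)) (w k * cos (w k * x + 0)).
  exact: is_derive_sin_affine.
have cS k : continuous (fun x => w k * cos (w k * x + 0)).
  by move=> x; apply: cvgM; [exact: cvg_cst | exact: continuous_cos_affine].
have bc k : bdd_meas (fun x => cos (w k * x)) by exact: bdd_meas_cos.
have cos0 k : \int[leb]_(x in D) cos (w k.+1 * x) = 0.
  apply: (mulfI (lt0r_neq0 (w0 k))); rewrite mulr0 -RintegralZl ?mleb //; last exact: bdd_meas_int.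
  have := Rintegral_FTC (ltW l0) (dS k.+1) (cS k.+1).
  rewrite !addr0 wl sin_natpi mulr0 sin0 subrr => {2}<-.
  by apply: eq_Rintegral => x _; rewrite addr0.
have Gcos k : \int[leb]_(x in D) (G x * cos (w k.+1 * x)) = 0.
  apply: (mulfI (lt0r_neq0 (w0 k))); rewrite mulr0 -RintegralZl ?mleb //; last first.
    by apply: bdd_meas_int; exact: bdd_measM.
  have [_ e] := prim_ibp (ltW l0) fi (dS k.+1) (cS k.+1).
  transitivity (\int[leb]_(y in D) (w k.+1 * cos (w k.+1 * y + 0) * prim f y)).
    by apply: eq_Rintegral => x _; rewrite addr0 /G; ring.
  rewrite e !addr0 wl sin_natpi.
  transitivity (\int[leb]_(x in D) ((-1) * (f x * sin (w k.+1 * x)))).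
    by apply: eq_Rintegral => x _; rewrite addr0; ring.
  have bs : bdd_meas (fun x => sin (w k.+1 * x)).
    have -> : (fun x => sin (w k.+1 * x)) = (fun x => sin (w k.+1 * x + 0)).
      by apply/funext => x; rewrite addr0.
    split; first by apply: measurable_continuous; [exact: mleb | exact: continuous_sin_affine].
    by exists 1 => x _; exact: sin_max.
  rewrite RintegralZl ?fsin ?mulr0 //.
  apply: (@integrableR_le _ _ _ _ _ (mleb _) _ (fun x => `|f x|)).
  - by apply: measurable_funM; [exact: integrableR_meas fi | case: bs].
  - by move=> x _; rewrite normrM ler_piMr // sin_max.
  - exact: integrable_norm.
(* Subtracting the mean takes care of the constant cosine, index 0. *)
pose m := (\int[leb]_(x in D) G x) / l.
pose H x := G x + - m.
have bH : bdd_meas H by apply: bdd_measD => //; exact: bdd_meas_cst.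
have Hcos k : \int[leb]_(x in D) (H x * cos (w k * x)) = 0.
  transitivity (\int[leb]_(x in D) (G x * cos (w k * x)) -
     m * \int[leb]_(x in D) cos (w k * x)).
    rewrite -RintegralZl ?mleb //; last exact: bdd_meas_int.
    rewrite -RintegralB ?mleb //; last 2 first.
    - by apply: bdd_meas_int; exact: bdd_measM.
    - by apply: bdd_meas_int; apply: bdd_measM => //; exact: bdd_meas_cst.
    by apply: eq_Rintegral => x _; rewrite /H; ring.
  case: k => [|k]; last by rewrite Gcos cos0 mulr0 subr0.
  have e : \int[leb]_(x in D) cos (w 0 * x) = l.
    transitivity (\int[leb]_(x in D) (1 : R)).
      by apply: eq_Rintegral => x _; rewrite !mul0r trigo.cos0.
    by rewrite Rintegral_cst ?mleb // mul1r fine_leb_oo ?subr0 // ltW.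
  rewrite e /m divfK ?gt_eqF //; apply/eqP; rewrite subr_eq0; apply/eqP.
  by apply: eq_Rintegral => x _; rewrite !mul0r trigo.cos0 mulr1.
have cG y : D y -> {for y, continuous G}.
  move=> Dy; have := prim_continuous l0 fi.
  by move=> /(continuous_within_itvP _ l0) [+ _ _]; apply.
have H0 y : D y -> G y = m.
  move=> Dy; have cH : {for y, continuous H}.
    by apply: cvgD; [exact: cG | exact: cvg_cst].
  have h1 := cos_ortho_nonpos bH Hcos Dy cH.
  have bN : bdd_meas (fun x => (-1) * H x) by apply: bdd_measM => //; exact: bdd_meas_cst.
  have h2 : -1 * H y <= 0.
    apply: (cos_ortho_nonpos bN) => // [k|].
      transitivity (-1 * \int[leb]_(x in D) (H x * cos (w k * x))); last by rewrite Hcos mulr0.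
      rewrite -RintegralZl ?mleb //; last by apply: bdd_meas_int; exact: bdd_measM.
      by apply: eq_Rintegral => x _; rewrite mulrA.
    by apply: cvgM => //; exact: cvg_cst.
  by rewrite /H in h1 h2; lra.
exact: (ae_eq0_of_prim_cst fi H0).
Qed.
End SineCompleteness.

(** * Test functions, weak derivatives and traces *)

Section SmoothStep.
Context {R : realType}.
Implicit Types x z : R.

Definition pospart z : R := (z + `|z|) / 2.
Definition possqr z : R := pospart z ^+ 2.
(** Between 0 and 1 this is [1 - (1 - z ^+ 2) ^+ 2], a step of class C^1, which is all the
    regularity that [test_function] asks for. *)
Definition smoothstep z : R := 1 - possqr (1 - possqr z).
Definition smoothstep' z : R := 2 * pospart (1 - possqr z) * (2 * pospart z).

Lemma pospart_ge0 z : 0 <= pospart z.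
Proof. by rewrite /pospart; have := ler_norm (- z); rewrite normrN; lra. Qed.
Lemma pospart_pos z : 0 <= z -> pospart z = z.
Proof. by move=> z0; rewrite /pospart ger0_norm //; lra. Qed.
Lemma pospart_neg z : z <= 0 -> pospart z = 0.
Proof. by move=> z0; rewrite /pospart ler0_norm //; lra. Qed.

Lemma continuous_pospart : continuous pospart.
Proof.
move=> z; apply: cvgM; last exact: cvg_cst.
by apply: cvgD; [exact: cvg_id | exact: norm_continuous].
Qed.

Lemma is_derive_possqr z : is_derive z (1 : R) possqr (2 * pospart z).
Proof.
have [z0|z0|->] := ltgtP z 0.
- rewrite pospart_neg ?ltW // mulr0.
  apply: (@near_eq_is_derive _ _ _ (cst (0 : R))).
  have : \forall y \near z, y \in `]z - 1, 0[%R.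
    by apply: near_in_itvoo; rewrite in_itv /=; apply/andP; split; lra.
  apply: filterS => y; rewrite in_itv /= => /andP[_ y0].
  by rewrite /possqr pospart_neg ?expr0n // ltW.
- rewrite pospart_pos ?ltW //.
  have dd : is_derive z (1 : R) ((@id R) * (@id R)) (2 * z).
    by apply: is_derive_eq; rewrite /GRing.scale /=; lra.
  apply: near_eq_is_derive dd.
  have : \forall y \near z, y \in `]0, z + 1[%R.
    by apply: near_in_itvoo; rewrite in_itv /=; apply/andP; split; lra.
  apply: filterS => y; rewrite in_itv /= => /andP[y0 _].
  by rewrite /possqr pospart_pos ?expr2 // ltW.
- rewrite pospart_neg // mulr0.
  (* At 0 the two branches meet. The slope function is [pospart] itself, because
     [pospart y ^+ 2 = pospart y * y]. *)
  apply/is_derive1_caratheodory; exists pospart; split.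
  + move=> y; rewrite /possqr (pospart_neg (lexx 0)) expr0n /= !subr0 expr2.
    have [y0|y0] := leP 0 y; first by rewrite pospart_pos.
    by rewrite pospart_neg ?ltW // !mul0r.
  + exact: continuous_pospart.
  + exact: pospart_neg.
Qed.

Lemma continuous_possqr : continuous possqr.
Proof. exact: is_derive_continuous is_derive_possqr. Qed.

Lemma is_derive_smoothstep z : is_derive z (1 : R) smoothstep (smoothstep' z).
Proof.
have dI y : is_derive y (1 : R) (fun y => 1 - possqr y) (- (2 * pospart y)).
  have := is_deriveB (is_derive_cst (1 : R) y (1 : R)) (is_derive_possqr y).
  by rewrite sub0r.
have dq y := @is_derive1_comp _ possqr (fun y => 1 - possqr y) y _ _
  (is_derive_possqr (1 - possqr y)) (dI y).
have := is_deriveB (is_derive_cst (1 : R) z (1 : R)) (dq z).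
by rewrite sub0r mulrN opprK.
Qed.

Lemma continuous_smoothstep' : continuous smoothstep'.
Proof.
move=> z; have c1 : {for z, continuous (fun z => pospart (1 - possqr z))}.
  apply: (@continuous_comp _ _ _ (fun z => 1 - possqr z) pospart).
    by apply: cvgB; [exact: cvg_cst | exact: continuous_possqr].
  exact: continuous_pospart.
apply: cvgM; first by apply: cvgM => //; exact: cvg_cst.
by apply: cvgM; [exact: cvg_cst | exact: continuous_pospart].
Qed.

Lemma smoothstep'_ge0 z : 0 <= smoothstep' z.
Proof. by apply: mulr_ge0; apply: mulr_ge0 => //; exact: pospart_ge0. Qed.
Lemma smoothstep_neg z : z <= 0 -> smoothstep z = 0.
Proof.
move=> z0; rewrite /smoothstep /possqr (pospart_neg z0) expr0n /= subr0.
by rewrite pospart_pos // expr1n subrr.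
Qed.
Lemma smoothstep_pos z : 1 <= z -> smoothstep z = 1.
Proof.
move=> z1; rewrite /smoothstep /possqr (pospart_pos (le_trans ler01 z1)).
by rewrite pospart_neg ?expr0n ?subr0 //; nra.
Qed.
Lemma smoothstep'_neg z : z <= 0 -> smoothstep' z = 0.
Proof. by move=> z0; rewrite /smoothstep' (pospart_neg z0) !mulr0. Qed.
Lemma smoothstep'_pos z : 1 <= z -> smoothstep' z = 0.
Proof.
move=> z1; rewrite /smoothstep' [pospart (1 - _)]pospart_neg ?mulr0 ?mul0r //.
by rewrite /possqr pospart_pos; nra.
Qed.
End SmoothStep.

Section Bump.
Context {R : realType}.
Variables (ep : R) (ep0 : 0 < ep).
Implicit Types c x : R.

Definition ramp c x : R := smoothstep (ep^-1 * x + - (ep^-1 * c)).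
(** The derivative of [ramp c]: a nonnegative bump of mass one carried by the interval from [c] to
    [c + ep]. *)
Definition bump c x : R := smoothstep' (ep^-1 * x + - (ep^-1 * c)) * ep^-1.

Lemma is_derive_ramp c x : is_derive x (1 : R) (ramp c) (bump c x).
Proof.
exact (@is_derive1_comp _ smoothstep (fun x => ep^-1 * x + - (ep^-1 * c)) x _ _
  (is_derive_smoothstep _) (is_derive_affine _ _ x)).
Qed.

Lemma continuous_bump c : continuous (bump c).
Proof.
move=> x; apply: cvgM; last exact: cvg_cst.
apply: (@continuous_comp _ _ _ (fun x => ep^-1 * x + - (ep^-1 * c)) smoothstep');
  last exact: continuous_smoothstep'.
by apply: cvgD; [apply: cvgM; [exact: cvg_cst | exact: cvg_id] | exact: cvg_cst].
Qed.

Lemma rampE c x : ep^-1 * x + - (ep^-1 * c) = (x - c) / ep.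
Proof. by ring. Qed.

Lemma ramp_neg c x : x <= c -> ramp c x = 0.
Proof. by move=> xc; rewrite /ramp rampE smoothstep_neg // ler_pdivrMr // mul0r; lra. Qed.
Lemma ramp_pos c x : c + ep <= x -> ramp c x = 1.
Proof. by move=> xc; rewrite /ramp rampE smoothstep_pos // ler_pdivlMr // mul1r; lra. Qed.
Lemma bump_ge0 c x : 0 <= bump c x.
Proof. by rewrite /bump mulr_ge0 ?smoothstep'_ge0 // invr_ge0 ltW. Qed.
Lemma bump_out c x : ~~ (c < x < c + ep) -> bump c x = 0.
Proof.
rewrite negb_and -!leNgt => /orP[h|h]; rewrite /bump rampE.
  by rewrite smoothstep'_neg ?mul0r // ler_pdivrMr // mul0r; lra.
by rewrite smoothstep'_pos ?mul0r // ler_pdivlMr // mul1r; lra.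
Qed.

Lemma bump_le c x : bump c x <= 2 * 2 * 2 * ep^-1.
Proof.
rewrite /bump; apply: ler_wpM2r; first by rewrite invr_ge0 ltW.
set z := _ + _; have [z0|z0] := leP z 0; first by rewrite smoothstep'_neg //; lra.
have [z1|z1] := leP 1 z; first by rewrite smoothstep'_pos //; lra.
rewrite /smoothstep' /possqr (pospart_pos (ltW z0)) pospart_pos; nra.
Qed.

Lemma derive_ramp_diff a b : derive1 (fun x => ramp a x - ramp b x) = (fun x => bump a x - bump b x).
Proof.
apply/funext => x; rewrite derive1E.
by have [_ ->] := is_deriveB (is_derive_ramp a x) (is_derive_ramp b x).
Qed.

Lemma test_function_ramp_diff (l a b : R) : 0 < a -> a < b -> b + ep < l ->
  test_function l (fun x => ramp a x - ramp b x).
Proof.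
move=> a0 ab bl; split.
- by move=> x; have [] := is_deriveB (is_derive_ramp a x) (is_derive_ramp b x).
- by rewrite derive_ramp_diff => x; apply: cvgB; exact: continuous_bump.
- exists `[a, b + ep]%classic; split; first exact: segment_compact.
    by move=> x /=; rewrite !in_itv /= => /andP[h1 h2]; apply/andP; split; lra.
  move=> x /=; rewrite in_itv /= => /negP; rewrite negb_and -!ltNge => /orP[h|h].
    by rewrite !ramp_neg ?subrr //; lra.
  by rewrite !ramp_pos ?subrr //; lra.
Qed.
End Bump.

Section WeakDerivative.
Context {R : realType}.
Local Notation leb := (@lebesgue_measure R).
Local Notation mR := (measurableTypeR R).
Local Notation oo a b := (`]a, b[%classic : set R).
Variables (l : R) (l0 : 0 < l).
Local Notation D := (oo 0 l).

Lemma test_function_derive (th : R -> R) : test_function l th ->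
  (forall x, is_derive x (1 : R) th (derive1 th x)) /\ th 0 = 0 /\ th l = 0.
Proof.
move=> [dth _ [K [_ KD Kth]]]; split.
  by move=> x; rewrite derive1E; apply/derivableP; exact: dth.
split; apply: Kth => /KD; rewrite /= in_itv /= ltxx ?andbF //.
Qed.

(** The du Bois-Reymond lemma. The difference of two ramps is a test function whose derivative is a
    bump at [a] minus a bump at [b], so the averages of [K] near [a] and near [b] agree; continuity
    gives the values. *)
Lemma cst_of_test (K : R -> R) : integrableR leb D K ->
  (forall y, D y -> {for y, continuous K}) ->
  (forall th, test_function l th -> \int[leb]_(x in D) (K x * derive1 th x) = 0) ->
  forall a b, D a -> D b -> a < b -> K a = K b.
Proof.
move=> Ki cK hK.
(* The factor [s], taken as 1 and then -1, yields both inequalities from one argument. *)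
suff main (s : R) a b : D a -> D b -> a < b -> s * K a <= s * K b.
  move=> a b Da Db ab; apply/eqP; rewrite eq_le.
  by have := main 1 a b Da Db ab; have := main (-1) a b Da Db ab; lra.
move=> Da Db ab; rewrite leNgt; apply/negP => lt.
have /ooP/andP[a0 al] := Da; have /ooP/andP[b0 bl] := Db.
(* A third of the gap: after losing [eta] at each point, [eta] still remains. *)
pose eta := (s * K a - s * K b) / 3; have eta0 : 0 < eta by rewrite /eta; lra.
have near_pt y : D y -> exists2 d, 0 < d & forall x, `|x - y| < d -> `|s * K x - s * K y| < eta.
  move=> Dy; have c : {for y, continuous (fun x => s * K x)}.
    by apply: cvgM; [exact: cvg_cst | exact: cK].
  have /cvgrPdist_lt /(_ _ eta0) [d /= d0 hd] := c.
  by exists d => // x xy; rewrite distrC; apply: hd; rewrite /= distrC.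
have [da da0 hda] := near_pt a Da; have [db db0 hdb] := near_pt b Db.
pose ep := Num.min (da / 2) (Num.min (db / 2) (Num.min (b - a) ((l - b) / 2))).
have ep0 : 0 < ep by rewrite /ep !lt_min !divr_gt0 ?subr_gt0 ?ab.
have epa : ep < da by rewrite /ep !gt_min; apply/orP; left; lra.
have epb : ep < db by rewrite /ep !gt_min; apply/orP; right; apply/orP; left; lra.
have epl : ep < l - b.
  by rewrite /ep !gt_min; apply/orP; right; apply/orP; right; apply/orP; right; lra.
have epab : ep <= b - a by rewrite /ep !ge_min lexx !orbT.
have bel : b + ep < l by clear -epl; lra.
have tth := test_function_ramp_diff ep0 a0 ab bel.
have ip c : D c -> c + ep <= l -> \int[leb]_(x in D) bump ep c x = 1.
  move=> /ooP/andP[c0 _] cl.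
  rewrite (Rintegral_FTC (ltW l0) (is_derive_ramp ep c) (@continuous_bump _ ep c)).
  by rewrite ramp_pos // ramp_neg ?subr0 // ltW.
have pi c : integrableR leb D (bump ep c).
  by apply: continuous_integrableR; exact: continuous_bump.
have e := hK _ tth; rewrite derive_ramp_diff in e.
have Kp c : integrableR leb D (fun x => K x * bump ep c x).
  apply: (@integrableR_le _ _ _ _ _ (mleb _) _ (fun x => 2 * 2 * 2 * ep^-1 * `|K x|)).
  - apply: measurable_funM; first exact: integrableR_meas Ki.
    exact: integrableR_meas (pi c).
  - by move=> x _; rewrite normrM mulrC ler_wpM2r // ger0_norm ?bump_ge0 // bump_le.
  - by apply: integrableRZ; [exact: mleb | exact: integrable_norm].
have lower : \int[leb]_(x in D) ((s * K a - eta) * bump ep a x + - ((s * K b + eta) * bump ep b x)) <=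
    \int[leb]_(x in D) (s * (K x * (bump ep a x - bump ep b x))).
  apply: le_Rintegral; first exact: mleb.
  - by apply: integrableRD; rewrite ?mleb //; last apply: integrableRN; apply: integrableRZ;
      rewrite ?mleb.
  - apply: integrableRZ; rewrite ?mleb //.
    apply: (eq_integrable (mleb _)) (integrableRD (mleb _) (Kp a) (integrableRN (Kp b))).
    by move=> x _ /=; rewrite mulrBr.
  - move=> x Dx.
    have h1 : (s * K a - eta) * bump ep a x <= s * K x * bump ep a x.
      have [/andP[x1 x2]|] := boolP (a < x < a + ep); last by move=> /(bump_out ep0) ->; rewrite !mulr0.
      apply: ler_wpM2r; first exact: bump_ge0.
      have : `|x - a| < da by clear -x1 x2 epa; rewrite ger0_norm; lra.
      by move=> /hda; clear; rewrite ltr_norml => /andP[? ?]; lra.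
    have h2 : s * K x * bump ep b x <= (s * K b + eta) * bump ep b x.
      have [/andP[x1 x2]|] := boolP (b < x < b + ep); last by move=> /(bump_out ep0) ->; rewrite !mulr0.
      apply: ler_wpM2r; first exact: bump_ge0.
      have : `|x - b| < db by clear -x1 x2 epb; rewrite ger0_norm; lra.
      by move=> /hdb; clear; rewrite ltr_norml => /andP[? ?]; lra.
    have -> : s * (K x * (bump ep a x - bump ep b x)) = s * K x * bump ep a x - s * K x * bump ep b x by ring.
    by apply: lerB.
have : \int[leb]_(x in D) (s * (K x * (bump ep a x - bump ep b x))) = 0.
  rewrite RintegralZl ?mleb //; first by rewrite e mulr0.
  apply: (eq_integrable (mleb _)) (integrableRD (mleb _) (Kp a) (integrableRN (Kp b))).
  by move=> x _ /=; rewrite mulrBr.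
move: lower; rewrite RintegralB ?mleb //; last 2 first.
- by apply: integrableRZ; rewrite ?mleb.
- by apply: integrableRZ; rewrite ?mleb.
have e1 : \int[leb]_(x in D) bump ep a x = 1 by apply: ip => //; clear -epl epab ab; lra.
have e2 : \int[leb]_(x in D) bump ep b x = 1 by apply: ip => //; clear -epl epab ab; lra.
by rewrite (RintegralZl _ _ (pi a)) ?(RintegralZl _ _ (pi b)) ?mleb // e1 e2 /eta; lra.
Qed.

Lemma within_continuous_bdd_meas (f : R -> R) :
  {within `[0, l], continuous f} -> bdd_meas l f.
Proof.
move=> cf; split.
  apply: (@measurable_funS _ _ _ _ (`[0, l]%classic : set mR)); first exact: mleb.
    exact: subset_itv_oo_cc.
  by apply: subspace_continuous_measurable_fun => //; exact: mleb.
have cn : {within `[0, l], continuous (fun x => `|f x|)}.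
  by move=> x; apply: cvg_norm; exact: cf.
have [c _ hc] := EVT_max (ltW l0) cn.
exists `|f c| => x /ooP/andP[x0 xl]; apply: hc; rewrite in_itv /=.
by apply/andP; split; exact: ltW.
Qed.

(** The difference of [F] and the primitive of [G] has zero weak derivative, so it is constant
    inside the interval; continuity extends this to the endpoints, which are the traces. *)
Lemma weak_derivative_prim (F G : R -> R) : integrableR leb D F -> integrableR leb D G ->
  {within `[0, l], continuous F} ->
  (forall th, test_function l th ->
    \int[leb]_(x in D) (F x * derive1 th x) = - \int[leb]_(x in D) (G x * th x)) ->
  forall y, 0 <= y <= l -> F y = F 0 + prim G y.
Proof.
move=> Fi Gi cF hFG; pose K y := F y - prim G y.
have bG := bdd_meas_prim l0 Gi; have Gpi := bdd_meas_int bG.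
have cG := prim_continuous l0 Gi.
have cK : {within `[0, l], continuous K}.
  by move=> x; apply: cvgB; [exact: cF | exact: cG].
have [cK1 cK2 cK3] := (continuous_within_itvP _ l0).1 cK.
have Ki : integrableR leb D K.
  by apply: integrableRD; [exact: mleb| |exact: integrableRN].
have Kcst a b : D a -> D b -> K a = K b.
  have wlogK a' b' : D a' -> D b' -> a' < b' -> K a' = K b'.
    apply: cst_of_test => //.
    move=> th tth; have [dth [th0 thl]] := test_function_derive tth.
    have [_ cth _] := tth.
    have [ip e] := prim_ibp (ltW l0) Gi dth cth.
    have bth : bdd_meas l (derive1 th).
      by apply: within_continuous_bdd_meas; exact: continuous_subspaceT.
    have bF := within_continuous_bdd_meas cF.
    transitivity (\int[leb]_(x in D) (F x * derive1 th x) -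
        \int[leb]_(x in D) (derive1 th x * prim G x)).
      rewrite -RintegralB ?mleb //; last by apply: bdd_meas_int; exact: bdd_measM.
      by apply: eq_Rintegral => x _; rewrite /K; ring.
    rewrite hFG // e thl; apply/eqP; rewrite subr_eq0; apply/eqP.
    rewrite -mulN1r -RintegralZl ?mleb //.
      by apply: eq_Rintegral => x _; ring.
    have bt : bdd_meas l th.
      by apply: within_continuous_bdd_meas; apply: continuous_subspaceT; exact: is_derive_continuous dth.
    have [mt [M hM]] := bt.
    apply: (@integrableR_le _ _ _ _ _ (mleb _) _ (fun x => M * `|G x|)).
    - by apply: measurable_funM => //; exact: integrableR_meas Gi.
    - by move=> x Dx; rewrite normrM mulrC ler_wpM2r // hM.
    - by apply: integrableRZ; [exact: mleb | exact: integrable_norm].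
  move=> Da Db; have [ab|ab|->//] := ltgtP a b; first exact: wlogK.
  by apply/esym/wlogK.
have l2 : D (l / 2) by apply/ooP/andP; split; have := l0; lra.
have near0 : \forall x \near 0^'+, K x = K (l / 2).
  have : \forall x \near 0^'+, x < l by exact: nbhs_right_lt.
  have : \forall x \near (0 : R)^'+, 0 < x by exact: nbhs_right_gt.
  by apply: filterS2 => x x0 xl; apply: Kcst => //; apply/ooP/andP.
have nearl : \forall x \near l^'-, K x = K (l / 2).
  have : \forall x \near l^'-, 0 < x by exact: nbhs_left_gt.
  have : \forall x \near l^'-, x < l by exact: nbhs_left_lt.
  by apply: filterS2 => x xl x0; apply: Kcst => //; apply/ooP/andP.
have K0 : K 0 = K (l / 2).
  have h : K x @[x --> 0^'+] --> K (l / 2) by apply: cvg_near_cst.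
  by rewrite -(cvg_lim (@Rhausdorff R) cK2) (cvg_lim (@Rhausdorff R) h).
have Kl : K l = K (l / 2).
  have h : K x @[x --> l^'-] --> K (l / 2) by apply: cvg_near_cst.
  by rewrite -(cvg_lim (@Rhausdorff R) cK3) (cvg_lim (@Rhausdorff R) h).
have prim0 : prim G 0 = 0 by rewrite /prim set_itvoo0 Rintegral_set0.
have K0E : K 0 = F 0 by rewrite /K prim0 subr0.
move=> y /andP[]; rewrite le_eqVlt => /orP[/eqP <- _|y0]; first by rewrite prim0 addr0.
rewrite le_eqVlt => /orP[/eqP ->|yl].
  by rewrite -K0E K0 -Kl /K subrK.
have Dy : D y by apply/ooP/andP.
by rewrite -K0E K0 -(Kcst y) // /K subrK.
Qed.

(** Unlike a test function, [s] may be nonzero at the ends; the representation of [F] by a primitive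
    produces the boundary terms. *)
Lemma weak_derivative_trace (F G s s' : R -> R) : integrableR leb D F -> integrableR leb D G ->
  {within `[0, l], continuous F} ->
  (forall th, test_function l th ->
    \int[leb]_(x in D) (F x * derive1 th x) = - \int[leb]_(x in D) (G x * th x)) ->
  (forall x, is_derive x (1 : R) s (s' x)) -> continuous s' ->
  \int[leb]_(x in D) (F x * s' x) =
    F l * s l - F 0 * s 0 - \int[leb]_(x in D) (G x * s x).
Proof.
move=> Fi Gi cF hFG ds cs'.
have hF := weak_derivative_prim Fi Gi cF hFG.
have [ip e] := prim_ibp (ltW l0) Gi ds cs'.
have s'i := continuous_integrableR 0 l cs'.
transitivity (\int[leb]_(x in D) (F 0 * s' x) + \int[leb]_(x in D) (s' x * prim G x)).
  rewrite -RintegralD ?mleb //; last by apply: integrableRZ => //; exact: mleb.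
  apply: eq_Rintegral => x /set_mem /ooP/andP[x0 xl].
  have -> : F x = F 0 + prim G x by apply: hF; rewrite !ltW.
  by ring.
rewrite e RintegralZl ?mleb // (Rintegral_FTC (ltW l0) ds cs').
have [ms [M hM]] : bdd_meas l s.
  by apply: within_continuous_bdd_meas; apply: continuous_subspaceT; exact: is_derive_continuous ds.
have Gsi : integrableR leb D (fun x => G x * s x).
  apply: (@integrableR_le _ _ _ _ _ (mleb _) _ (fun x => M * `|G x|)).
  - by apply: measurable_funM => //; exact: integrableR_meas Gi.
  - by move=> x Dx; rewrite normrM mulrC ler_wpM2r // hM.
  - by apply: integrableRZ; [exact: mleb | exact: integrable_norm].
transitivity (F 0 * (s l - s 0) + (s l * \int[leb]_(x in D) G x - \int[leb]_(x in D) (G x * s x))).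
  congr (_ + _); rewrite -RintegralZl ?mleb // -RintegralB ?mleb //.
    by apply: eq_Rintegral => x _; ring.
  by apply: integrableRZ => //; exact: mleb.
have -> : \int[leb]_(x in D) G x = F l - F 0.
  by rewrite (hF l) ?lexx ?ltW // /prim addrC addKr.
ring.
Qed.
End WeakDerivative.

Section ComplexTrace.
Context {R : realType}.
Local Notation leb := (@lebesgue_measure R).
Local Notation mR := (measurableTypeR R).
Local Notation oo a b := (`]a, b[%classic : set R).

Lemma sq_int_integrableR d (X : measurableType d) (mu : {measure set X -> \bar R})
    (D : set X) (f : X -> R) : measurable D -> (mu D < +oo)%E ->
  sq_int mu D f -> integrableR mu D f.
Proof.
move=> mD fin [mf fi]; apply: (@integrableR_le _ _ _ _ _ mD _ (fun x => 1 + f x ^+ 2)) => //.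
  move=> x _; rewrite -real_normK ?num_real //; set a := `|_|.
  by have := sqr_ge0 (a - 1); nra.
by apply: integrableRD => //; exact: integrableR_cst.
Qed.

Lemma Re_mulr (z : R[i]) (r : R) : Re (z * r%:C) = Re z * r.
Proof. by rewrite ReM /= mulr0 subr0. Qed.
Lemma Im_mulr (z : R[i]) (r : R) : Im (z * r%:C) = Im z * r.
Proof. by rewrite ImM /= mulr0 add0r. Qed.

Variables (l : R) (l0 : 0 < l).
Local Notation D := (oo 0 l).

Lemma cintegral_mulr (f : R -> R[i]) (s : R -> R) :
  cintegral leb D (fun x => f x * (s x)%:C) =
  Complex (\int[leb]_(x in D) (Re (f x) * s x)) (\int[leb]_(x in D) (Im (f x) * s x)).
Proof.
by apply: complex_eqP => /=; apply: eq_Rintegral => x _; rewrite ?Re_mulr ?Im_mulr.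
Qed.

Lemma complex_trace (f g : R -> R[i]) (s s' : R -> R) :
  L2 leb D f -> L2 leb D g -> continuous_on_closed l f -> weak_derivative l f g ->
  (forall x, is_derive x (1 : R) s (s' x)) -> continuous s' ->
  cintegral leb D (fun x => f x * (s' x)%:C) =
  f l * (s l)%:C - f 0 * (s 0)%:C - cintegral leb D (fun x => g x * (s x)%:C).
Proof.
move=> /(L2P _ (mleb _)) [f1 f2] /(L2P _ (mleb _)) [g1 g2] [c1 c2] wfg ds cs.
have li F : sq_int leb D F -> integrableR leb D F.
  by apply: sq_int_integrableR; [exact: mleb | exact: leb_oo_lt].
rewrite !cintegral_mulr; apply: complex_eqP.
  rewrite !(ReD, ReN) !Re_mulr.
  apply: (weak_derivative_trace l0) => //; try exact: li.
  by move=> th /wfg; rewrite !cintegral_mulr => -[].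
rewrite !(ImD, ImN) !Im_mulr.
apply: (weak_derivative_trace l0) => //; try exact: li.
by move=> th /wfg; rewrite !cintegral_mulr => -[].
Qed.

Lemma continuous_real_L2 (a : R -> R) : continuous a -> L2 leb D (fun x => (a x)%:C).
Proof.
move=> ca; have [ma [M hM]] : bdd_meas l a.
  by apply: (within_continuous_bdd_meas l0); exact: continuous_subspaceT.
apply: (@L2_bounded _ _ _ _ _ (mleb _) _ (M ^+ 2)); first exact: leb_oo_lt.
- exact: ma.
- exact: measurable_cst.
- move=> x Dx; rewrite /sqn /= expr0n /= addr0 -real_normK ?num_real //.
  by rewrite lerXn2r ?nnegrE ?hM // (le_trans _ (hM x Dx)).
Qed.

Lemma H2_real (a a1 a2 : R -> R) : (forall x, is_derive x (1 : R) a (a1 x)) ->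
  (forall x, is_derive x (1 : R) a1 (a2 x)) -> continuous a2 ->
  H2 l (fun x => (a x)%:C) (fun x => (a1 x)%:C) (fun x => (a2 x)%:C).
Proof.
move=> d1 d2 c2; have c1 := is_derive_continuous d2; have c0 := is_derive_continuous d1.
have w (b b' : R -> R) : (forall x, is_derive x (1 : R) b (b' x)) -> continuous b' ->
    weak_derivative l (fun x => (b x)%:C) (fun x => (b' x)%:C).
  move=> db cb' th tth; have [dth [th0 thl]] := test_function_derive tth.
  have [_ cth _] := tth; have cb := is_derive_continuous db.
  have cth0 := is_derive_continuous dth.
  rewrite !cintegral_mulr; apply: complex_eqP => /=; last first.
    have z (c : R -> R) : \int[leb]_(x in D) (0 * c x) = 0.
      transitivity (\int[leb]_(x in D) (0 : R)); last by rewrite Rintegral_cst ?mleb // mul0r.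
      by apply: eq_Rintegral => x _; rewrite mul0r.
    by rewrite !z oppr0.
  have cm1 : continuous (fun x => b x * derive1 th x).
    by move=> x; apply: cvgM; [exact: cb | exact: cth].
  have cm2 : continuous (fun x => b' x * th x).
    by move=> x; apply: cvgM; [exact: cb' | exact: cth0].
  have dm x : is_derive x (1 : R) (fun x => b x * th x) (b x * derive1 th x + b' x * th x).
    by rewrite addrC [b' x * _]mulrC addrC; exact: (is_deriveM (db x) (dth x)).
  have cm : continuous (fun x => b x * derive1 th x + b' x * th x).
    by move=> x; apply: cvgD; [exact: cm1 | exact: cm2].
  have := Rintegral_FTC (ltW l0) dm cm.
  rewrite th0 thl !mulr0 subrr RintegralD ?mleb //; try exact: continuous_integrableR.
  by move/eqP; rewrite addr_eq0 => /eqP.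
split; split; try exact: continuous_real_L2; try exact: w.
- by split; [exact: continuous_subspaceT | apply: continuous_subspaceT => x; exact: cvg_cst].
- by split; [exact: continuous_subspaceT | apply: continuous_subspaceT => x; exact: cvg_cst].
Qed.
End ComplexTrace.

(** * Modes of a star graph and Green's formula *)

Section Modes.
Context {R : realType} {n : nat}.
Variable ell : 'I_n -> R.
Hypothesis ell0 : forall j, 0 < ell j.
Local Notation leb := (@lebesgue_measure R).
Local Notation mR := (measurableTypeR R).
Local Notation edge j := (`]0, ell j[%classic : set R).

Lemma L2G_hilbert : hilbert_form (L2G ell) (innerG ell).
Proof. exact: (@L2s_hilbert _ _ _ leb n _ (fun j => mleb _)). Qed.

(** The argument is [nu * (ell j - x)] expanded as an affine function: the Dirichlet condition at
    the exterior end is built in. *)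
Definition mode_sin (nu : R) (j : 'I_n) (x : R) : R := sin (- nu * x + nu * ell j).
Definition mode_cos (nu : R) (j : 'I_n) (x : R) : R := cos (- nu * x + nu * ell j).

Definition mode (A : 'I_n -> R) (nu : R) : 'I_n -> R -> R[i] :=
  fun j x => (A j * mode_sin nu j x)%:C.

(* Continuity and Kirchhoff's condition at the common vertex. *)
Definition vertex_conditions (A : 'I_n -> R) (nu : R) : Prop :=
  (forall j k, A j * sin (nu * ell j) = A k * sin (nu * ell k)) /\
  \sum_j A j * cos (nu * ell j) = 0.

Lemma is_derive_mode_sin nu j (c x : R) :
  is_derive x (1 : R) (fun x => c * mode_sin nu j x) (- (c * nu) * mode_cos nu j x).
Proof.
have := is_deriveZ c (is_derive_sin_affine (- nu) (nu * ell j) x).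
by move=> h; apply: (is_derive_eq h); rewrite /GRing.scale /= /mode_cos; ring.
Qed.

Lemma is_derive_mode_cos nu j (c x : R) :
  is_derive x (1 : R) (fun x => c * mode_cos nu j x) (c * nu * mode_sin nu j x).
Proof.
have := is_deriveZ c (is_derive_cos_affine (- nu) (nu * ell j) x).
by move=> h; apply: (is_derive_eq h); rewrite /GRing.scale /= /mode_sin; ring.
Qed.

Lemma continuous_mode_sin nu j (c : R) : continuous (fun x => c * mode_sin nu j x).
Proof. by apply: is_derive_continuous => x; exact: is_derive_mode_sin. Qed.

Lemma continuous_mode_cos nu j (c : R) : continuous (fun x => c * mode_cos nu j x).
Proof. by apply: is_derive_continuous => x; exact: is_derive_mode_cos. Qed.

Lemma mode_sin0 nu j : mode_sin nu j 0 = sin (nu * ell j).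
Proof. by rewrite /mode_sin mulr0 add0r. Qed.
Lemma mode_cos0 nu j : mode_cos nu j 0 = cos (nu * ell j).
Proof. by rewrite /mode_cos mulr0 add0r. Qed.
Lemma mode_sinl nu j : mode_sin nu j (ell j) = 0.
Proof. by rewrite /mode_sin mulNr addNr sin0. Qed.
Lemma mode_L2G A nu : L2G ell (mode A nu).
Proof. by move=> j; apply: continuous_real_L2 => //; exact: continuous_mode_sin. Qed.

Lemma mode_laplacian A nu : vertex_conditions A nu ->
  laplacian ell (mode A nu) (fun j x => (- nu ^+ 2)%:C * mode A nu j x).
Proof.
move=> [vc vk]; exists (fun j x => (- (A j * nu) * mode_cos nu j x)%:C); split.
- move=> j; have -> : (fun x => (- nu ^+ 2)%:C * mode A nu j x) =
     (fun x => (- (A j * nu) * nu * mode_sin nu j x)%:C).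
    by apply/funext => x; rewrite /mode -rmorphM; congr (_ %:C); ring.
  apply: H2_real => //.
  - by move=> x; exact: is_derive_mode_sin.
  - by move=> x; exact: is_derive_mode_cos.
  - exact: continuous_mode_sin.
- by move=> j k; rewrite /mode !mode_sin0 (vc j k).
- rewrite -rmorph_sum; apply: (congr1 (real_complex R)).
  under eq_bigr do rewrite mode_cos0.
  transitivity (- nu * \sum_j A j * cos (nu * ell j)); last by rewrite vk mulr0.
  by rewrite mulr_sumr; apply: eq_bigr => j _; ring.
- by move=> j; rewrite /mode mode_sinl mulr0.
Qed.

(** Two integrations by parts on each edge. The exterior terms vanish by the Dirichlet conditions;
    at the common vertex, continuity lets a common value be factored out and Kirchhoff's condition
    makes the remaining sum vanish, once for [phi] and once for the mode. *)
Lemma green_mode A nu phi psi : laplacian ell phi psi -> vertex_conditions A nu ->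
  innerG ell psi (mode A nu) = (- nu ^+ 2)%:C * innerG ell phi (mode A nu).
Proof.
move=> [phi1 [hH2 hc hk hl]] [vc vk].
have mE f j : cintegral leb (edge j) (fun x => f j x * conjc (mode A nu j x)) =
    cintegral leb (edge j) (fun x => f j x * (A j * mode_sin nu j x)%:C).
  apply: eq_cintegral => x _; congr (_ * _); apply: complex_eqP => //=.
  by rewrite oppr0.
have key j : cintegral leb (edge j) (fun x => psi j x * conjc (mode A nu j x)) =
   (- nu ^+ 2)%:C * cintegral leb (edge j) (fun x => phi j x * conjc (mode A nu j x)) -
   phi1 j 0 * (A j * sin (nu * ell j))%:C +
   phi j 0 * (- (A j * nu) * cos (nu * ell j))%:C.
  have [[L0 L1 L2] [w1 w2 c0 c1]] := hH2 j.
  have e1 := complex_trace (ell0 j) L1 L2 c1 w2 (is_derive_mode_sin nu j (A j))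
    (@continuous_mode_cos nu j (- (A j * nu))).
  have e2 := complex_trace (ell0 j) L0 L1 c0 w1 (is_derive_mode_cos nu j (- (A j * nu)))
    (@continuous_mode_sin nu j (- (A j * nu) * nu)).
  rewrite !mE; rewrite mode_sinl mode_sin0 mulr0 in e1.
  rewrite hl mul0r mode_cos0 in e2.
  have Li : cintegrable leb (edge j) (fun x => phi j x * (A j * mode_sin nu j x)%:C).
    have := L2_mul_conj (mleb _) L0 (@mode_L2G A nu j).
    apply: eq_cintegrable; first exact: mleb.
    by move=> x _; congr (_ * _); apply: complex_eqP => //=; rewrite oppr0.
  have e3 : cintegral leb (edge j) (fun x => phi j x * (- (A j * nu) * nu * mode_sin nu j x)%:C)
    = (- nu ^+ 2)%:C * cintegral leb (edge j) (fun x => phi j x * (A j * mode_sin nu j x)%:C).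
    rewrite -cintegralZ //.
    apply: eq_cintegral => x _; rewrite [RHS]mulrCA -rmorphM; congr (_ * _%:C); ring.
  have z0 : ((0 : R)%:C : R[i]) = 0 by [].
  by rewrite e3 in e2; rewrite e2 e1 z0; ring.
rewrite /innerG; under eq_bigr do rewrite key.
rewrite !big_split /= -mulr_sumr -addrA -[RHS]addr0; congr (_ + _).
(* Without edges there is no common value to factor out, but both sums are empty. *)
case: (pickP (@predT 'I_n)) => [j0 _|no]; last first.
  by rewrite !big1 ?addr0 // => j; have := no j.
have -> : \sum_j - (phi1 j 0 * (A j * sin (nu * ell j))%:C) =
    - (A j0 * sin (nu * ell j0))%:C * \sum_j phi1 j 0.
  by rewrite mulr_sumr; apply: eq_bigr => j _; rewrite (vc j j0); ring.
rewrite hk mulr0 add0r.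
have -> : \sum_j phi j 0 * (- (A j * nu) * cos (nu * ell j))%:C =
    phi j0 0 * (- nu * \sum_j A j * cos (nu * ell j))%:C.
  rewrite mulr_sumr rmorph_sum mulr_sumr; apply: eq_bigr => j _.
  by rewrite (hc j j0); congr (_ * _%:C); ring.
by rewrite vk mulr0 mulr0.
Qed.
End Modes.

(** * Sine completeness on two intervals joined at the vertex *)

Section AffineChange.
Context {R : realType}.
Local Notation leb := (@lebesgue_measure R).
Local Notation mR := (measurableTypeR R).
Local Notation oo a b := (`]a, b[%classic : set R).

(** Translations and reflections at once: the Boolean chooses the sign of the variable. *)
Definition aff (e : bool) (c : R) : mR -> mR := fun x => (if e then x else - x) + c.

Lemma measurable_aff e c : measurable_fun setT (aff e c).
Proof.
apply: measurable_continuous => // x; apply: cvgD; last exact: cvg_cst.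
by case: e; [exact: cvg_id | apply: cvgN; exact: cvg_id].
Qed.

HB.instance Definition _ e c := isMeasurableFun.Build _ _ _ _ (aff e c) (measurable_aff e c).

Lemma leb_aff e c (A : set mR) : measurable A -> leb A = pushforward leb (aff e c) A.
Proof.
apply: lebesgue_measure_unique => X [[a b] _ <-] /=; rewrite /pushforward.
have [ab|ba] := ltP a b; last first.
  rewrite set_itv_ge ?preimage_set0 ?measure0 //.
  by rewrite bnd_simp -leNgt.
case: e.
  have -> : aff true c @^-1` `]a, b]%classic = `]a - c, b - c]%classic.
    by apply/seteqP; split => x; rewrite /aff /= !in_itv /= => /andP[h1 h2]; apply/andP; split; lra.
  rewrite !lebesgue_measure_itv /= !lte_fin ab ltrD2r ab -!EFinD.
  by congr _%:E; lra.
have -> : aff false c @^-1` `]a, b]%classic = `[c - b, c - a[%classic.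
  by apply/seteqP; split => x; rewrite /aff /= !in_itv /= => /andP[h1 h2]; apply/andP; split; lra.
rewrite !lebesgue_measure_itv /= !lte_fin ab ltrD2l ltrN2 ab -!EFinD.
by congr _%:E; lra.
Qed.

Lemma aff_change e c (f : R -> R) : integrableR leb setT f ->
  integrableR leb setT (fun x => f (aff e c x)) /\
  \int[leb]_x f (aff e c x) = \int[leb]_x f x.
Proof.
move=> fi; have mf : measurable_fun setT (EFin \o f : mR -> \bar R) by case/integrableP: fi.
have ch (g : R -> \bar R) : (\int[pushforward leb (aff e c)]_(y in setT) g y =
    \int[leb]_(y in setT) g y)%E.
  by apply: eq_measure_integral => A mA _; apply/esym; exact: leb_aff.
have fi' : integrableR leb setT (fun x => f (aff e c x)).
  apply/integrableP; split.
    by apply: (measurableT_comp mf); exact: measurable_aff.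
  case/integrableP: fi => _; rewrite -ch ge0_integral_pushforward //.
  by apply: measurableT_comp.
split=> //; rewrite /Rintegral; congr fine.
rewrite -[RHS]ch (@integral_pushforward _ _ _ _ _ (aff e c)) //.
Qed.

End AffineChange.

Section TwoIntervals.
Context {R : realType}.
Local Notation leb := (@lebesgue_measure R).
Local Notation mR := (measurableTypeR R).
Local Notation oo a b := (`]a, b[%classic : set R).
Variables (a b : R).
Hypotheses (a0 : 0 < a) (b0 : 0 < b).

Let zext (l : R) (f : R -> R) : R -> R := f \_ (oo 0 l).

Let zext_in l f x : oo 0 l x -> zext l f x = f x.
Proof. by move=> xl; rewrite /zext patchE mem_set. Qed.
Let zext_out l f x : ~ oo 0 l x -> zext l f x = 0.
Proof. by move=> xl; rewrite /zext patchE memNset. Qed.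

Let sin_bdd_int (f : R -> R) (nu c : R) (D : set mR) : measurable D -> integrableR leb D f ->
  integrableR leb D (fun x => f x * sin (nu * x + c)).
Proof.
move=> mD fi; apply: (@integrableR_le _ _ _ _ _ mD _ (fun x => `|f x|)).
- apply: measurable_funM; first exact: integrableR_meas fi.
  by apply: measurable_continuous => //; exact: continuous_sin_affine.
- by move=> x _; rewrite normrM ler_piMr // sin_max.
- exact: integrable_norm.
Qed.

Let zextM l f (g : R -> R) : (fun x => zext l f x * g x) = zext l (fun x => f x * g x).
Proof.
apply/funext => x; have [xl|xl] := pselect (oo 0 l x); first by rewrite !zext_in.
by rewrite !zext_out // mul0r.
Qed.

Let zext_int l f : integrableR leb (oo 0 l) f -> integrableR leb setT (zext l f).
Proof. by move=> fi; apply: integrableR_restrict => //; exact: mleb. Qed.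

(** Reflecting the first interval and shifting the second lays them end to end on an interval of
    length [a + b], the vertex landing at [a]; the two families of sines become the ordinary sines
    of the long interval. *)
Lemma two_interval_sine_complete (f g : R -> R) :
  integrableR leb (oo 0 a) f -> integrableR leb (oo 0 b) g ->
  (forall k, let nu := k%:R * pi / (a + b) in
    \int[leb]_(x in oo 0 a) (f x * sin (- nu * x + nu * a)) +
    \int[leb]_(x in oo 0 b) (g x * sin (nu * x + nu * a)) = 0) ->
  ae_eq leb (oo 0 a) f (cst 0) /\ ae_eq leb (oo 0 b) g (cst 0).
Proof.
move=> fi gi hfg; pose F := zext a f; pose G := zext b g.
have Fi : integrableR leb setT F by exact: zext_int.
have Gi : integrableR leb setT G by exact: zext_int.
pose F1 x := F (aff false a x); pose G1 x := G (aff true (- a) x).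
have [F1i _] := aff_change false a Fi; have [G1i _] := aff_change true (- a) Gi.
pose w x := F1 x + G1 x.
have wi : integrableR leb setT w by apply: integrableRD.
have ab0 : 0 < a + b by have := a0; have := b0; lra.
have wD : integrableR leb (oo 0 (a + b)) w by apply: integrableS wi => //; exact: mleb.
have F1out x : ~ oo 0 a x -> F1 x = 0.
  move=> h; apply: zext_out => /ooP; rewrite /aff => /andP[h1 h2]; apply: h; apply/ooP/andP; lra.
have G1out x : ~ oo a (a + b) x -> G1 x = 0.
  move=> h; apply: zext_out => /ooP; rewrite /aff => /andP[h1 h2]; apply: h; apply/ooP/andP; lra.
have w0 : ae_eq leb (oo 0 (a + b)) w (cst 0).
  apply: sine_complete => // k; set nu := _ / _.
  have si h : integrableR leb setT h -> integrableR leb setT (fun x => h x * sin (nu * x)).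
    move=> hi; have := sin_bdd_int nu 0 measurableT hi.
    by under eq_fun do rewrite addr0.
  transitivity (\int[leb]_x (w x * sin (nu * x))).
    rewrite Rintegral_mkcond; apply: eq_Rintegral => x _; rewrite patchE.
    case: ifPn => // /negP xD; have {}xD : ~ oo 0 (a + b) x.
      by move=> h; apply: xD; rewrite inE.
    rewrite /w F1out ?G1out ?addr0 ?mul0r //.
      by move=> /ooP/andP[h1 h2]; apply: xD; apply/ooP/andP; have := a0; lra.
    by move=> /ooP/andP[h1 h2]; apply: xD; apply/ooP/andP; have := b0; lra.
  rewrite -[RHS](hfg k) /= -/nu.
  transitivity (\int[leb]_x (F1 x * sin (nu * x)) + \int[leb]_x (G1 x * sin (nu * x))).
    rewrite -RintegralD //; try exact: si.
    by apply: eq_Rintegral => x _; rewrite mulrDl.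
  congr (_ + _).
    have Fsi := sin_bdd_int (- nu) (nu * a) measurableT Fi.
    have [_ e] := aff_change false a Fsi.
    transitivity (\int[leb]_x (F (aff false a x) * sin (- nu * aff false a x + nu * a))).
      by apply: eq_Rintegral => x _; rewrite /F1 /aff; congr (_ * sin _); ring.
    by rewrite e zextM -Rintegral_mkcond.
  have Gsi := sin_bdd_int nu (nu * a) measurableT Gi.
  have [_ e] := aff_change true (- a) Gsi.
  transitivity (\int[leb]_x (G (aff true (- a) x) * sin (nu * aff true (- a) x + nu * a))).
    by apply: eq_Rintegral => x _; rewrite /G1 /aff; congr (_ * sin _); ring.
  by rewrite e zextM -Rintegral_mkcond.
(* Vanishing almost everywhere is carried back through the affine map by the integral of the
   absolute value, which the change of variable preserves. *)
have zero (l : R) (h : R -> R) e c : integrableR leb (oo 0 l) h ->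
   ae_eq leb setT (fun x => zext l h (aff e c x)) (cst 0) -> ae_eq leb (oo 0 l) h (cst 0).
  move=> hi hae; have hZ : integrableR leb setT (zext l h) by exact: zext_int.
  have nZ := integrable_norm hZ; have [nZ1 e1] := aff_change e c nZ.
  have mZ : measurable_fun setT (EFin \o zext l h : mR -> \bar R) by case/integrableP: hZ.
  have mZ1 : measurable_fun setT (EFin \o (fun x => zext l h (aff e c x)) : mR -> \bar R).
    by case/integrableP: (aff_change e c hZ).1.
  have I1 : (\int[leb]_x `|(zext l h (aff e c x))%:E| = 0)%E.
    apply: (ae_eq_integral_abs leb measurableT mZ1).2.
    by move: hae; apply: filterS => x hx _ /=; rewrite hx.
  have I0 : (\int[leb]_x `|(zext l h x)%:E| = 0)%E.
    transitivity (\int[leb]_x (`|zext l h x|)%:E)%E; first by [].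
    rewrite EFin_Rintegral // -e1 -EFin_Rintegral //.
  have := (ae_eq_integral_abs leb measurableT mZ).1 I0.
  by apply: filterS => x /(_ I) /= [hx] xl; rewrite -(zext_in h xl) hx.
split.
  apply: (zero _ _ false a fi); move: w0.
  apply: filterS => x wx _; have [xa|xa] := pselect (oo 0 a x); last exact: F1out.
  have /ooP/andP[x0 xa'] := xa.
  have := wx; rewrite /w G1out ?addr0; first by apply; apply/ooP/andP; have := b0; lra.
  by move=> /ooP/andP[h1 h2]; lra.
apply: (zero _ _ true (- a) gi); move: w0.
apply: filterS => x wx _; have [xa|xa] := pselect (oo a (a + b) x); last exact: G1out.
have /ooP/andP[x0 xa'] := xa.
have := wx; rewrite /w F1out ?add0r; first by apply; apply/ooP/andP; have := a0; lra.
by move=> /ooP/andP[h1 h2]; lra.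
Qed.
End TwoIntervals.

(** * Eigenfunctions of the X graph: vertex conditions and orthonormality *)

Section SineSquare.
Context {R : realType}.
Local Notation leb := (@lebesgue_measure R).
Local Notation oo a b := (`]a, b[%classic : set R).

Lemma Rintegral_sin_sqr (nu L c d : R) : nu != 0 -> c <= d ->
  \int[leb]_(x in oo c d) (sin (- nu * x + nu * L) ^+ 2) =
  (d - c) / 2 + (sin (2 * nu * (L - d)) - sin (2 * nu * (L - c))) / (4 * nu).
Proof.
move=> nu0 cd.
pose F x : R := 2^-1 * x + (4 * nu)^-1 * sin (- (2 * nu) * x + 2 * nu * L).
have cS : continuous (fun x => sin (- nu * x + nu * L) ^+ 2).
  have -> : (fun x => sin (- nu * x + nu * L) ^+ 2) =
      (fun x => sin (- nu * x + nu * L) * sin (- nu * x + nu * L)).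
    by apply/funext => x; rewrite expr2.
  by move=> x; apply: cvgM; exact: continuous_sin_affine.
have dF x : is_derive x (1 : R) F (sin (- nu * x + nu * L) ^+ 2).
  have h1 := is_deriveZ (2^-1 : R) (is_derive_id x (1 : R)).
  have h2 := is_deriveZ (4 * nu)^-1 (is_derive_sin_affine (- (2 * nu)) (2 * nu * L) x).
  have h := is_deriveD h1 h2; apply: (is_derive_eq h); rewrite /GRing.scale /=.
  have -> : - (2 * nu) * x + 2 * nu * L = (- nu * x + nu * L) *+ 2 by rewrite mulr2n; ring.
  by rewrite cos_mulr2n sin2cos2 mulr2n; field.
rewrite (Rintegral_FTC cd dF cS) /F.
have -> : 2 * nu * (L - d) = - (2 * nu) * d + 2 * nu * L by ring.
have -> : 2 * nu * (L - c) = - (2 * nu) * c + 2 * nu * L by ring.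
by field.
Qed.
End SineSquare.

Section XGraph.
Context {R : realType}.
Local Notation leb := (@lebesgue_measure R).
Local Notation oo a b := (`]a, b[%classic : set R).
Variables (lb lt : R).
Hypotheses (hb : 0 < lb) (ht : 0 < lt).
Local Notation ell := (@X_length R lb lt).

Lemma X_length_gt0 j : 0 < ell j.
Proof. by rewrite /X_length; case: ifP. Qed.

(* Types 0 and 1: eigenfunctions supported on the pair of equal edges of length
   lb, resp. lt, odd under their exchange; type 2: eigenfunctions even under both
   exchanges, i.e. those of an interval of length lb + lt. *)
Definition xlen (t : nat) : R := match t with 0%N => lb | 1%N => lt | _ => lb + lt end.
Definition xfreq (t m : nat) : R := m%:R * pi / xlen t.
(** For the even family, [nu * lt = m%:R * pi - nu * lb], so the sines at the vertex on the two
    pairs differ by the factor [- (-1) ^+ m]; repeating this sign as amplitude makes the vertex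
    values agree. *)
Definition xsign (t m i : nat) : R := match t with
  | 0%N => nth 0 [:: 1; -1] i
  | 1%N => nth 0 [:: 0; 0; 1; -1] i
  | _ => nth 0 [:: 1; 1; - (-1) ^+ m; - (-1) ^+ m] i end.
(** The unnormalised mode has squared norm [xlen t]: in total, half of the length of the edges that
    carry it. *)
Definition xamp (t m : nat) (j : 'I_4) : R := xsign t m j / Num.sqrt (xlen t).
Definition xmode (t m : nat) := mode ell (xamp t m) (xfreq t m).

Lemma xlen_gt0 t : 0 < xlen t.
Proof. by case: t => [|[|t]] //=; exact: addr_gt0. Qed.
Lemma xlen_sqr t : Num.sqrt (xlen t) ^+ 2 = xlen t.
Proof. by rewrite sqr_sqrtr // ltW ?xlen_gt0. Qed.
Lemma xfreq_gt0 t m : (0 < m)%N -> 0 < xfreq t m.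
Proof. by move=> m0; rewrite divr_gt0 ?xlen_gt0 // mulr_gt0 ?pi_gt0 ?ltr0n. Qed.

Lemma xfreq_len t m : xfreq t m * xlen t = m%:R * pi.
Proof. by rewrite /xfreq divfK // gt_eqF ?xlen_gt0. Qed.

Lemma sin_freq_t m (nu := xfreq 2 m) : sin (nu * lt) = - (-1) ^+ m * sin (nu * lb).
Proof.
have -> : nu * lt = m%:R * pi - nu * lb.
  by have := xfreq_len 2 m; rewrite -/nu /=; lra.
by rewrite sinB sin_natpi cos_natpi; ring.
Qed.

Lemma cos_freq_t m (nu := xfreq 2 m) : cos (nu * lt) = (-1) ^+ m * cos (nu * lb).
Proof.
have -> : nu * lt = m%:R * pi - nu * lb.
  by have := xfreq_len 2 m; rewrite -/nu /=; lra.
by rewrite cosB sin_natpi cos_natpi; ring.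
Qed.

Lemma sqr_sign m : (-1) ^+ m * (-1) ^+ m = 1 :> R.
Proof. by rewrite -exprD addnn -mul2n exprM sqrrN !expr1n. Qed.

Lemma sum4 (V : nmodType) (F : nat -> V) : \sum_(j < 4) F j = F 0%N + F 1%N + F 2%N + F 3%N.
Proof. by rewrite !big_ord_recr big_ord0 /= add0r. Qed.

Definition len4 (i : nat) : R := if (i < 2)%N then lb else lt.

Lemma xmode_vertex t m : vertex_conditions ell (xamp t m) (xfreq t m).
Proof.
pose sg : R := if t is S (S _) then sin (xfreq t m * lb) / Num.sqrt (xlen t) else 0.
have key (j : 'I_4) : xamp t m j * sin (xfreq t m * ell j) = sg.
  have e0 : xfreq 0 m * lb = m%:R * pi := xfreq_len 0 m.
  have e1 : xfreq 1 m * lt = m%:R * pi := xfreq_len 1 m.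
  rewrite /xamp /X_length /sg /xsign.
  case: t {sg} => [|[|t]].
  - by case: j => [[|[|[|[|//]]]] /= hj]; rewrite ?mul0r ?e0 ?sin_natpi ?mulr0.
  - by case: j => [[|[|[|[|//]]]] /= hj]; rewrite ?mul0r ?e1 ?sin_natpi ?mulr0.
  rewrite (_ : xfreq t.+2 m = xfreq 2 m) // (_ : xlen t.+2 = xlen 2) //.
  have hp := sqr_sign m; set p := (-1) ^+ m in hp *.
  have e2 : sin (xfreq 2 m * lt) = - p * sin (xfreq 2 m * lb) by exact: sin_freq_t.
  case: j => [[|[|[|[|//]]]] /= hj]; rewrite ?e2; try ring.
  - by transitivity (p * p * (sin (xfreq 2 m * lb) / Num.sqrt (lb + lt))); [ring|rewrite hp mul1r].
  - by transitivity (p * p * (sin (xfreq 2 m * lb) / Num.sqrt (lb + lt))); [ring|rewrite hp mul1r].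
split; first by move=> j k; rewrite !key.
rewrite (sum4 (fun i => xsign t m i / Num.sqrt (xlen t) * cos (xfreq t m * len4 i))) /len4 /=.
case: t {key sg} => [|[|t]]; rewrite /xsign /=; try ring.
rewrite (_ : xfreq t.+2 m = xfreq 2 m) //.
have hp := sqr_sign m; set p := (-1) ^+ m in hp *.
have e2 : cos (xfreq 2 m * lt) = p * cos (xfreq 2 m * lb) by exact: cos_freq_t.
rewrite e2; set c := cos _; set r := Num.sqrt _.
by transitivity (2 * (1 - p * p) * (c / r)); [ring|rewrite hp subrr mulr0 mul0r].
Qed.

Lemma xmode_L2G t m : L2G ell (xmode t m).
Proof. exact: mode_L2G X_length_gt0 _ _. Qed.

Lemma xmode_laplacian t m :
  laplacian ell (xmode t m) (fun j x => (- xfreq t m ^+ 2)%:C * xmode t m j x).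
Proof. exact: mode_laplacian X_length_gt0 _ _ (xmode_vertex t m). Qed.

Lemma xmode_green t m phi psi : laplacian ell phi psi ->
  innerG ell psi (xmode t m) = (- xfreq t m ^+ 2)%:C * innerG ell phi (xmode t m).
Proof. by move=> h; exact: (green_mode X_length_gt0 h (xmode_vertex t m)). Qed.

Definition sprod (nu nu' L : R) : R :=
  \int[leb]_(x in oo 0 L) (sin (- nu * x + nu * L) * sin (- nu' * x + nu' * L)).

Lemma inner_mode (A A' : 'I_4 -> R) nu nu' :
  innerG ell (mode ell A nu) (mode ell A' nu') =
  (\sum_j A j * A' j * sprod nu nu' (ell j))%:C.
Proof.
rewrite rmorph_sum; apply: eq_bigr => j _; apply: complex_eqP.
  rewrite Re_cintegral [RHS]/= -RintegralZl ?mleb //.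
    by apply: eq_Rintegral => x _; rewrite ReM /= oppr0 mulr0 subr0 /mode_sin; ring.
  by apply: continuous_integrableR => x; apply: cvgM; exact: continuous_sin_affine.
rewrite Im_cintegral [RHS]/=.
transitivity (\int[leb]_(x in oo 0 (ell j)) (0 : R)); last by rewrite Rintegral_cst ?mleb // mul0r.
by apply: eq_Rintegral => x _; rewrite ImM /= oppr0 mulr0 mul0r addr0.
Qed.

Lemma inner_mode4 t m nu t' m' nu' : innerG ell (mode ell (xamp t m) nu) (mode ell (xamp t' m') nu') =
  ((xsign t m 0 * xsign t' m' 0 + xsign t m 1 * xsign t' m' 1) * sprod nu nu' lb +
   (xsign t m 2 * xsign t' m' 2 + xsign t m 3 * xsign t' m' 3) * sprod nu nu' lt)%:C /
  (Num.sqrt (xlen t) * Num.sqrt (xlen t'))%:C.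
Proof.
rewrite inner_mode -[RHS]fmorph_div; congr (_%:C).
rewrite (sum4 (fun i => xsign t m i / Num.sqrt (xlen t) * (xsign t' m' i / Num.sqrt (xlen t'))
  * sprod nu nu' (len4 i))) /len4 /= invfM; ring.
Qed.

(** [xlen] and [xsign] read every type from 2 on as the even family. *)
Definition ttype (t : nat) : nat := minn t 2.

Lemma inner_xmode_type t m t' m' : ttype t != ttype t' ->
  innerG ell (xmode t m) (xmode t' m') = 0.
Proof.
move=> tt'.
have [e1 e2] : xsign t m 0 * xsign t' m' 0 + xsign t m 1 * xsign t' m' 1 = 0 /\
    xsign t m 2 * xsign t' m' 2 + xsign t m 3 * xsign t' m' 3 = 0.
  by move: tt'; case: t => [|[|t]]; case: t' => [|[|t']] //= _; split; ring.
by rewrite /xmode inner_mode4 e1 e2 !mul0r addr0 rmorph0 mul0r.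
Qed.

Lemma sprod_same nu L : 0 < nu -> 0 < L -> sprod nu nu L = L / 2 - sin (2 * nu * L) / (4 * nu).
Proof.
move=> nu0 L0; have := @Rintegral_sin_sqr R nu L 0 L (lt0r_neq0 nu0) (ltW L0).
rewrite subrr mulr0 sin0 !subr0 sub0r mulNr => <-.
by apply: eq_Rintegral => x _; rewrite expr2.
Qed.

Lemma inner_xmode_same t m : (0 < m)%N -> innerG ell (xmode t m) (xmode t m) = 1.
Proof.
move=> m0; rewrite /xmode inner_mode4 !sprod_same ?xfreq_gt0 //.
have nu0 := xfreq_gt0 t m0; set nu := xfreq t m in nu0 *.
rewrite -[Num.sqrt _ * Num.sqrt _]expr2 xlen_sqr -[RHS](rmorph1 (real_complex R)) -[LHS]fmorph_div; congr (_%:C).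
have l0 := xlen_gt0 t.
have e := xfreq_len t m; rewrite -/nu in e.
have nu1 : nu != 0 by rewrite gt_eqF.
have sin2 x : sin (2 * nu * x) = 2 * (cos (nu * x) * sin (nu * x)).
  have -> : 2 * nu * x = (nu * x) *+ 2 by ring.
  by rewrite sin_mulr2n; ring.
have lne : xlen t != 0 by rewrite gt_eqF.
rewrite !sin2.
have es : (1 < t)%N -> sin (nu * lt) = - (-1) ^+ m * sin (nu * lb).
  by rewrite /nu; case: (t) => [|[|t']] // _; exact: sin_freq_t.
have ec : (1 < t)%N -> cos (nu * lt) = (-1) ^+ m * cos (nu * lb).
  by rewrite /nu; case: (t) => [|[|t']] // _; exact: cos_freq_t.
case: t nu nu0 l0 e nu1 sin2 lne es ec => [|[|t]] nu nu0 l0 e nu1 sin2 lne es ec; rewrite /xsign /=.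
- by rewrite /= in e lne; rewrite e sin_natpi; field; rewrite ?lne ?nu1.
- by rewrite /= in e lne; rewrite e sin_natpi; field; rewrite ?lne ?nu1.
rewrite /= in e lne.
rewrite es // ec //; have hp := sqr_sign m; set p := (-1) ^+ m in hp *.
have -> : p * cos (nu * lb) * (- p * sin (nu * lb)) = - (cos (nu * lb) * sin (nu * lb)).
  by transitivity (- (p * p) * (cos (nu * lb) * sin (nu * lb))); [ring|rewrite hp mulN1r].
have -> : - p * - p = 1 by rewrite mulrNN.
by field; rewrite ?lne ?nu1.
Qed.

(** Green's formula computes the scalar product with the Laplacian in two ways; inside one family
    distinct modes have distinct eigenvalues, so no integral is evaluated. *)
Lemma inner_xmode_diff t m m' : (0 < m)%N -> (0 < m')%N -> m != m' ->
  innerG ell (xmode t m) (xmode t m') = 0.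
Proof.
move=> m0 m'0 mm'; have := xmode_green t m' (xmode_laplacian t m).
have -> : innerG ell (fun j x => (- xfreq t m ^+ 2)%:C * xmode t m j x) (xmode t m') =
    (- xfreq t m ^+ 2)%:C * innerG ell (xmode t m) (xmode t m').
  have h := ipZ (L2G_hilbert ell) ((- xfreq t m ^+ 2)%:C) (xmode_L2G t m) (xmode_L2G t m').
  exact: h.
move/eqP; rewrite -subr_eq0 -mulrBl mulf_eq0 => /orP[|/eqP //].
rewrite -rmorphB => /eqP /(congr1 (@complex.Re R)) /= h; exfalso.
have h0 := xfreq_gt0 t m0; have h1 := xfreq_gt0 t m'0.
have : xfreq t m != xfreq t m'.
  apply: contra_neq mm' => /(congr1 (fun x => x * xlen t)).
  rewrite !xfreq_len => /(mulIf (lt0r_neq0 (pi_gt0 R))) /eqP.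
  by rewrite eqr_nat => /eqP.
by move/eqP; apply; nra.
Qed.
End XGraph.

(** * Completeness of the eigenfunctions *)

Section XBasis.
Context {R : realType}.
Local Notation leb := (@lebesgue_measure R).
Local Notation mR := (measurableTypeR R).
Local Notation oo a b := (`]a, b[%classic : set R).
Variables (lb lt : R).
Hypotheses (hb : 0 < lb) (ht : 0 < lt).
Local Notation ell := (@X_length R lb lt).

(** The remainder modulo 3 is the family and the quotient the rank in it. Ranks start at 1 because
    the mode of rank 0 is the zero function. *)
Definition xphi (k : nat) := xmode lb lt (k %% 3) (k %/ 3).+1.
Definition xnu (k : nat) : R := xfreq lb lt (k %% 3) (k %/ 3).+1.
Definition xlam (k : nat) : R := xnu k ^+ 2.

Lemma xphiE t m : (t < 3)%N -> xphi (m * 3 + t) = xmode lb lt t m.+1.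
Proof. by move=> t3; rewrite /xphi modnMDl divnMDl // modn_small // divn_small // addn0. Qed.

Lemma xphi_L2G k : L2G ell (xphi k).
Proof. exact: xmode_L2G. Qed.

Lemma xphi_orthonormal j k : innerG ell (xphi j) (xphi k) = (j == k)%:R.
Proof.
have [->|jk] := eqVneq j k; first exact: inner_xmode_same.
have [e|ne] := eqVneq (j %% 3)%N (k %% 3)%N; last first.
  apply: inner_xmode_type => //; rewrite /ttype.
  by rewrite !(minn_idPl _) // -ltnS ltn_mod.
rewrite /xphi e; apply: inner_xmode_diff => //.
by apply: contra_neq jk => -[e']; rewrite (divn_eq j 3) (divn_eq k 3) e e'.
Qed.

Lemma sum_inord4 (V : nmodType) (F : 'I_4 -> V) :
  \sum_j F j = F (inord 0) + (F (inord 1) + (F (inord 2) + F (inord 3))).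
Proof.
rewrite !big_ord_recl big_ord0 addr0; congr (F _ + (F _ + (F _ + F _)));
  by apply: val_inj; rewrite /= inordK.
Qed.

Definition edge_sin (F : R -> R) (nu L : R) : R :=
  \int[leb]_(x in oo 0 L) (F x * sin (- nu * x + nu * L)).

Lemma edge_sin_int (F : R -> R) nu L : integrableR leb (oo 0 L) F ->
  integrableR leb (oo 0 L) (fun x => F x * sin (- nu * x + nu * L)).
Proof.
move=> Fi; apply: (@integrableR_le _ _ _ _ _ (mleb _) _ (fun x => `|F x|)).
- apply: measurable_funM; first exact: integrableR_meas Fi.
  by apply: measurable_continuous; [exact: mleb | exact: continuous_sin_affine].
- by move=> x _; rewrite normrM ler_piMr // sin_max.
- exact: integrable_norm.
Qed.

Lemma edge_sinD (F G : R -> R) nu L : integrableR leb (oo 0 L) F -> integrableR leb (oo 0 L) G ->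
  edge_sin (fun x => F x + G x) nu L = edge_sin F nu L + edge_sin G nu L.
Proof.
move=> Fi Gi; rewrite /edge_sin -RintegralD ?mleb //; try exact: edge_sin_int.
by apply: eq_Rintegral => x _; rewrite mulrDl.
Qed.

Lemma edge_sinN (F : R -> R) nu L : integrableR leb (oo 0 L) F ->
  edge_sin (fun x => - F x) nu L = - edge_sin F nu L.
Proof.
move=> Fi; rewrite -[RHS]mulN1r /edge_sin -RintegralZl ?mleb //; last exact: edge_sin_int.
by apply: eq_Rintegral => x _; ring.
Qed.

Lemma edge_sin_complete (F : R -> R) L : 0 < L -> integrableR leb (oo 0 L) F ->
  (forall m, edge_sin F (m.+1%:R * pi / L) L = 0) -> ae_eq leb (oo 0 L) F (cst 0).
Proof.
move=> L0 Fi hF; apply: (sine_complete L0 Fi) => -[|m].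
  transitivity (\int[leb]_(x in oo 0 L) (0 : R)); last by rewrite Rintegral_cst ?mleb // mul0r.
  by apply: eq_Rintegral => x _; rewrite !mul0r sin0 mulr0.
transitivity (- (-1) ^+ m.+1 * edge_sin F (m.+1%:R * pi / L) L); last by rewrite hF mulr0.
rewrite /edge_sin -RintegralZl ?mleb //; last exact: edge_sin_int.
apply: eq_Rintegral => x _.
have -> : - (m.+1%:R * pi / L) * x + m.+1%:R * pi / L * L = m.+1%:R * pi - m.+1%:R * pi / L * x.
  by field; rewrite gt_eqF.
rewrite (sinB (m.+1%:R * pi)) sin_natpi cos_natpi mul0r sub0r.
have := sqr_sign (R := R) m.+1; set p := (-1) ^+ m.+1 => hp.
set s := sin _; transitivity (p * p * (F x * s)); first by rewrite hp mul1r.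
by ring.
Qed.

(** The differences on each pair see only the odd families, whose sines are complete on one edge.
    The sums see the even family and are joined into one interval. Sum and difference recover the
    functions on the edges. *)
Lemma X_real_complete (F0 F1 F2 F3 : R -> R) :
  integrableR leb (oo 0 lb) F0 -> integrableR leb (oo 0 lb) F1 ->
  integrableR leb (oo 0 lt) F2 -> integrableR leb (oo 0 lt) F3 ->
  (forall m, let nu := xfreq lb lt 0 m.+1 in edge_sin F0 nu lb - edge_sin F1 nu lb = 0) ->
  (forall m, let nu := xfreq lb lt 1 m.+1 in edge_sin F2 nu lt - edge_sin F3 nu lt = 0) ->
  (forall m, let nu := xfreq lb lt 2 m.+1 in edge_sin F0 nu lb + edge_sin F1 nu lb -
    (-1) ^+ m.+1 * (edge_sin F2 nu lt + edge_sin F3 nu lt) = 0) ->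
  [/\ ae_eq leb (oo 0 lb) F0 (cst 0), ae_eq leb (oo 0 lb) F1 (cst 0),
      ae_eq leb (oo 0 lt) F2 (cst 0) & ae_eq leb (oo 0 lt) F3 (cst 0)].
Proof.
move=> i0 i1 i2 i3 h0 h1 h2.
have D01i : integrableR leb (oo 0 lb) (fun x => F0 x + - F1 x).
  by apply: integrableRD; [exact: mleb| |exact: integrableRN].
have D23i : integrableR leb (oo 0 lt) (fun x => F2 x + - F3 x).
  by apply: integrableRD; [exact: mleb| |exact: integrableRN].
have S01i : integrableR leb (oo 0 lb) (fun x => F0 x + F1 x).
  by apply: integrableRD; [exact: mleb| |].
have S23i : integrableR leb (oo 0 lt) (fun x => F2 x + F3 x).
  by apply: integrableRD; [exact: mleb| |].
have d01 : ae_eq leb (oo 0 lb) (fun x => F0 x + - F1 x) (cst 0).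
  apply: edge_sin_complete => // m.
  by rewrite edge_sinD ?edge_sinN //; [exact: h0 | exact: integrableRN].
have d23 : ae_eq leb (oo 0 lt) (fun x => F2 x + - F3 x) (cst 0).
  apply: edge_sin_complete => // m.
  by rewrite edge_sinD ?edge_sinN //; [exact: h1 | exact: integrableRN].
have [s01 s23] : ae_eq leb (oo 0 lb) (fun x => F0 x + F1 x) (cst 0) /\
    ae_eq leb (oo 0 lt) (fun x => F2 x + F3 x) (cst 0).
  apply: two_interval_sine_complete => // -[|m] nu.
    have nu0 : nu = 0 by rewrite /nu !mul0r.
    have z (F : R -> R) (L c : R) s : \int[leb]_(x in oo 0 L) (F x * sin (s * nu * x + nu * c)) = 0.
      transitivity (\int[leb]_(x in oo 0 L) (0 : R)); last by rewrite Rintegral_cst ?mleb // mul0r.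
      by apply: eq_Rintegral => x _; rewrite nu0 mulr0 !mul0r addr0 sin0 mulr0.
    have z1 := z (fun x => F0 x + F1 x) lb lb (-1); have z2 := z (fun x => F2 x + F3 x) lt lb 1.
    by rewrite mulN1r in z1; rewrite mul1r in z2; rewrite z1 z2 addr0.
  have e := h2 m; rewrite -/nu in e.
  rewrite -[RHS](e) -[X in X - _]edge_sinD // -edge_sinD //; congr (_ + _).
  rewrite -mulNr /edge_sin -RintegralZl ?mleb //; last exact: edge_sin_int.
  apply: eq_Rintegral => x _.
  have ab : lb + lt != 0 by rewrite gt_eqF // addr_gt0.
  have -> : nu * x + nu * lb = m.+1%:R * pi - (- nu * x + nu * lt).
    by rewrite /nu; field.
  rewrite sinB sin_natpi cos_natpi; ring.
have halves (L : R) (F G : R -> R) : ae_eq leb (oo 0 L) (fun x => F x + G x) (cst 0) ->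
    ae_eq leb (oo 0 L) (fun x => F x + - G x) (cst 0) ->
    ae_eq leb (oo 0 L) F (cst 0) /\ ae_eq leb (oo 0 L) G (cst 0).
  move=> hs hd; split; move: hs hd; apply: filterS2 => x h1' h2' Dx;
    move: (h1' Dx) (h2' Dx) => /=; lra.
have [a0 a1] := halves _ _ _ s01 d01; have [a2 a3] := halves _ _ _ s23 d23.
by split.
Qed.

Lemma innerG_mode (f : 'I_4 -> R -> R[i]) A nu : L2G ell f ->
  innerG ell f (mode ell A nu) = Complex
   (\sum_j A j * edge_sin (fun x => Re (f j x)) nu (ell j))
   (\sum_j A j * edge_sin (fun x => Im (f j x)) nu (ell j)).
Proof.
move=> fL; have fi j : integrableR leb (oo 0 (ell j)) (fun x => Re (f j x)) /\
    integrableR leb (oo 0 (ell j)) (fun x => Im (f j x)).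
  have /(L2P _ (mleb _)) [h1 h2] := fL j.
  by split; apply: sq_int_integrableR => //; exact: leb_oo_lt.
apply: complex_eqP => /=; rewrite ?Re_sum ?Im_sum; apply: eq_bigr => j _.
  rewrite Re_cintegral /edge_sin -RintegralZl ?mleb //; last by apply: edge_sin_int; case: (fi j).
  by apply: eq_Rintegral => x _; rewrite ReM /= oppr0 mulr0 subr0 /mode_sin; ring.
rewrite Im_cintegral /edge_sin -RintegralZl ?mleb //; last by apply: edge_sin_int; case: (fi j).
by apply: eq_Rintegral => x _; rewrite ImM /= oppr0 mulr0 add0r /mode_sin; ring.
Qed.

Lemma xphi_total (f : 'I_4 -> R -> R[i]) : L2G ell f ->
  (forall k, innerG ell f (xphi k) = 0) -> Re (innerG ell f f) = 0.
Proof.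
move=> fL hf.
have hm t m : (t < 3)%N -> innerG ell f (xmode lb lt t m.+1) = 0.
  by move=> t3; rewrite -xphiE.
pose o (i : nat) : 'I_4 := inord i.
have l0 : ell (o 0%N) = lb by rewrite /X_length inordK.
have l1 : ell (o 1%N) = lb by rewrite /X_length inordK.
have l2 : ell (o 2%N) = lt by rewrite /X_length inordK.
have l3 : ell (o 3%N) = lt by rewrite /X_length inordK.
have part (P : R[i] -> R) :
  (forall t m, (t < 3)%N -> \sum_j xamp lb lt t m.+1 j *
     edge_sin (fun x => P (f j x)) (xfreq lb lt t m.+1) (ell j) = 0) ->
  (forall j, sq_int leb (oo 0 (ell j)) (fun x => P (f j x))) ->
  forall j, \int[leb]_(x in oo 0 (ell j)) P (f j x) ^+ 2 = 0.
  move=> hP sP.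
  have iP j : integrableR leb (oo 0 (ell j)) (fun x => P (f j x)).
    by apply: sq_int_integrableR => //; exact: leb_oo_lt.
  have sq t m : (t < 3)%N -> let E i L := edge_sin (fun x => P (f (o i) x)) (xfreq lb lt t m.+1) L in
     @xsign R t m.+1 0 * E 0%N lb + (@xsign R t m.+1 1 * E 1%N lb +
     (@xsign R t m.+1 2 * E 2%N lt + @xsign R t m.+1 3 * E 3%N lt)) = 0.
    move=> t3 /=; have := hP t m t3.
    rewrite sum_inord4 -/(o 0%N) -/(o 1%N) -/(o 2%N) -/(o 3%N) l0 l1 l2 l3 /xamp !inordK //.
    set r := Num.sqrt _; have r0 : r != 0 by rewrite gt_eqF // sqrtr_gt0 xlen_gt0.
    move=> h; apply: (mulfI (invr_neq0 r0)); rewrite mulr0 -[RHS]h; ring.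
  have i0 := iP (o 0%N); have i1 := iP (o 1%N); have i2 := iP (o 2%N); have i3 := iP (o 3%N).
  rewrite l0 in i0; rewrite l1 in i1; rewrite l2 in i2; rewrite l3 in i3.
  have [||| a0 a1 a2 a3] := X_real_complete i0 i1 i2 i3.
  - by move=> m nu; have := sq 0%N m isT; rewrite /= /xsign /= -/nu; lra.
  - by move=> m nu; have := sq 1%N m isT; rewrite /= /xsign /= -/nu; lra.
  - by move=> m nu; have := sq 2%N m isT; rewrite /= /xsign /= -/nu; lra.
  have all j : ae_eq leb (oo 0 (ell j)) (fun x => P (f j x)) (cst 0).
    have -> : j = o j by apply: val_inj; rewrite /= inordK.
    by case: j => [[|[|[|[|//]]]] /= _]; rewrite ?l0 ?l1 ?l2 ?l3.
  move=> j; transitivity (\int[leb]_(x in oo 0 (ell j)) (0 : R)); last first.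
    by rewrite Rintegral_cst ?mleb // mul0r.
  rewrite /Rintegral; congr fine; apply: ae_eq_integral => //.
    by have [_ /integrableP[]] := sP j.
  by have := all j; apply: filterS => x hx Dx; rewrite hx //= expr0n.
have inn t m : (t < 3)%N -> _ := fun t3 => etrans (esym (innerG_mode (xamp lb lt t m.+1)
  (xfreq lb lt t m.+1) fL)) (hm t m t3).
have HL j : sq_int leb (oo 0 (ell j)) (fun x => Re (f j x)) /\
    sq_int leb (oo 0 (ell j)) (fun x => Im (f j x)).
  by have /(L2P _ (mleb _)) := fL j.
have -> : Re (innerG ell f f) = \sum_j
  (\int[leb]_(x in oo 0 (ell j)) (Re (f j x)) ^+ 2 + \int[leb]_(x in oo 0 (ell j)) (Im (f j x)) ^+ 2).
  exact: (@sq_ips _ _ _ leb 4 _ (fun j => mleb _) _ fL).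
apply: big1 => j _.
rewrite (part (@complex.Re R)) ?(part (@complex.Im R)) ?addr0 //.
- by move=> t m /(inn t m) [].
- by move=> i; case: (HL i).
- by move=> t m /(inn t m) [].
- by move=> i; case: (HL i).
Qed.
End XBasis.

(** * Bounded multipliers and weighted Fubini *)

Section BoundedMultiplier.
Context d (X : measurableType d) (R : realType) (mu : {measure set X -> \bar R}).
Variable D : set X.
Hypothesis mD : measurable D.

Lemma integrableR_bddM (a f : X -> R) (M : R) : measurable_fun D a ->
  (forall x, D x -> `|a x| <= M) -> integrableR mu D f ->
  integrableR mu D (fun x => a x * f x).
Proof.
move=> ma aM fi; apply: (@integrableR_le _ _ _ _ _ mD _ (fun x => M * `|f x|)).
- by apply: measurable_funM => //; exact: integrableR_meas fi.
- by move=> x Dx; rewrite normrM ler_wpM2r // aM.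
- by apply: integrableRZ => //; exact: integrable_norm.
Qed.

Definition cbounded (a : X -> R[i]) : Prop :=
  [/\ measurable_fun D (fun x => Re (a x)), measurable_fun D (fun x => Im (a x)) &
   exists M, forall x, D x -> `|Re (a x)| <= M /\ `|Im (a x)| <= M].

Lemma cintegrable_bddM (a f : X -> R[i]) : cbounded a -> cintegrable mu D f ->
  cintegrable mu D (fun x => a x * f x).
Proof.
move=> [ma1 ma2 [M hM]] [f1 f2].
have h1 x : D x -> `|Re (a x)| <= M by move=> /hM [].
have h2 x : D x -> `|Im (a x)| <= M by move=> /hM [].
have i11 := integrableR_bddM ma1 h1 f1; have i12 := integrableR_bddM ma1 h1 f2.
have i21 := integrableR_bddM ma2 h2 f1; have i22 := integrableR_bddM ma2 h2 f2.
split.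
  by apply: (eq_integrable mD) (integrableRD mD i11 (integrableRN i22)) => x _ /=; rewrite ReM.
by apply: (eq_integrable mD) (integrableRD mD i12 i21) => x _ /=; rewrite ImM.
Qed.

Lemma L2_bddM (a f : X -> R[i]) : cbounded a -> L2 mu D f -> L2 mu D (fun x => a x * f x).
Proof.
move=> [ma1 ma2 [M hM]] [mf1 mf2 fi]; split.
- by under eq_fun do rewrite ReM; apply: measurable_funB; exact: measurable_funM.
- by under eq_fun do rewrite ImM; apply: measurable_funD; exact: measurable_funM.
have h : integrableR mu D (fun x => sqn (a x) * (Normc.normc (f x) ^+ 2)).
  apply: (integrableR_bddM (M := M ^+ 2 + M ^+ 2)) => //.
    by apply: measurable_funD; exact: measurable_sqr.
  move=> x Dx; rewrite ger0_norm ?sqn_ge0 // /sqn; have [h1 h2] := hM x Dx.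
  rewrite -(real_normK (num_real (Re (a x)))) -(real_normK (num_real (Im (a x)))).
  by apply: lerD; apply: lerXn2r; rewrite ?nnegrE // (le_trans _ h1).
by apply: (eq_integrable mD) h => x _ /=; rewrite !normc_sqn sqnM.
Qed.

Lemma cbounded_conj a : cbounded a -> cbounded (fun x => conjc (a x)).
Proof.
move=> [m1 m2 [M hM]]; split.
- by under eq_fun do rewrite Re_conjc.
- by under eq_fun do rewrite Im_conjc; exact: measurable_funN.
- by exists M => x /hM; rewrite Re_conjc Im_conjc normrN.
Qed.
End BoundedMultiplier.

Section FubiniWeight.
Context d1 d2 (T1 : measurableType d1) (T2 : measurableType d2) (R : realType).
Variable m1 : {sigma_finite_measure set T1 -> \bar R}.
Variable m2 : {sigma_finite_measure set T2 -> \bar R}.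
Variables (D1 : set T1) (D2 : set T2).
Hypotheses (mD1 : measurable D1) (mD2 : measurable D2).
Local Notation m12 := (m1 \x m2)%E.

Lemma measurable_fst_prod (f : T1 -> R) : measurable_fun D1 f ->
  measurable_fun (D1 `*` D2) (fun z => f z.1).
Proof.
move=> mf; apply: (@measurable_comp _ _ _ _ _ _ D1 f _ fst) => //.
- by move=> _ [z [hz _] <-].
- by apply: measurable_funTS.
Qed.

Lemma measurable_snd_prod (f : T2 -> R) : measurable_fun D2 f ->
  measurable_fun (D1 `*` D2) (fun z => f z.2).
Proof.
move=> mf; apply: (@measurable_comp _ _ _ _ _ _ D2 f _ snd) => //.
- by move=> _ [z [_ hz] <-].
- by apply: measurable_funTS.
Qed.

Lemma cbounded_fst (a : T1 -> R[i]) : cbounded D1 a -> cbounded (D1 `*` D2) (fun z => a z.1).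
Proof.
move=> [h1 h2 [M hM]]; split; [exact: (measurable_fst_prod h1) | exact: (measurable_fst_prod h2)|].
by exists M => z [h _]; exact: hM.
Qed.

Lemma ae_section_integrable (f : T1 * T2 -> R) : integrableR m12 (D1 `*` D2) f ->
  {ae m1, forall x, D1 x -> integrableR m2 D2 (fun y => f (x, y))}.
Proof.
move=> fi; have mD12 : measurable (D1 `*` D2) by exact: measurableX.
have := ae_integrable1 ((integrable_mkcond _ mD12).1 fi).
apply: filterS => x hx D1x; apply: (integrable_mkcond _ mD2).2.
apply: (eq_integrable measurableT) hx => y _.
rewrite !patchE; congr (if _ then _ else _).
by apply/idP/idP => /set_mem h; apply/mem_set => //; case: h.
Qed.

(** Moving [a x] inside the inner integral requires an integrable section, which is available only
    for almost every [x]; that is enough for the outer integral. *)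
Lemma cfubini1_weight (f : T1 * T2 -> R[i]) (a : T1 -> R[i]) :
  cintegrable m12 (D1 `*` D2) f -> cbounded D1 a ->
  cintegrable m1 D1 (fun x => a x * cintegral m2 D2 (fun y => f (x, y))) /\
  cintegral m1 D1 (fun x => a x * cintegral m2 D2 (fun y => f (x, y))) =
  cintegral m12 (D1 `*` D2) (fun z => a z.1 * f z).
Proof.
move=> fi ba; have mD12 : measurable (D1 `*` D2) by exact: measurableX.
have [gi _] := cfubini1 mD1 mD2 fi.
have agi := cintegrable_bddM mD1 ba gi; split=> //.
have afi : cintegrable m12 (D1 `*` D2) (fun z => a z.1 * f z).
  by apply: cintegrable_bddM => //; exact: cbounded_fst.
have [h2 <-] := cfubini1 mD1 mD2 afi.
apply: ae_eq_cintegral => //.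
have := ae_section_integrable fi.2; have := ae_section_integrable fi.1.
apply: filterS2 => x i1 i2 D1x.
have fx : cintegrable m2 D2 (fun y => f (x, y)) by split; [exact: i1|exact: i2].
by have := cintegralZ mD2 (a x) fx; move=> ->.
Qed.
End FubiniWeight.

(** * Duhamel's formula for the scalar equation *)

Section Duhamel.
Context {R : realType}.
Local Notation leb := (@lebesgue_measure R).
Local Notation mR := (measurableTypeR R).
Local Notation oo a b := (`]a, b[%classic : set R).

Definition cexp (la s : R) : R[i] := Complex (cos (la * s)) (sin (la * s)).
Definition ci : R[i] := Complex 0 1.

Lemma ci_sqr : ci * ci = -1.
Proof. by apply: complex_eqP; rewrite ?ReImE /=; ring. Qed.

Lemma cexp0 la : cexp la 0 = 1.
Proof. by rewrite /cexp mulr0 cos0 sin0. Qed.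

Lemma sqn_cexp la s : sqn (cexp la s) = 1.
Proof. by rewrite /sqn /= cos2Dsin2. Qed.

Lemma conj_cexp la s : conjc (cexp la s) = cexp (- la) s.
Proof. by apply: complex_eqP; rewrite ?Re_conjc ?Im_conjc /= mulNr ?cosN ?sinN. Qed.

Lemma cexp_mulN la s : cexp (- la) s * cexp la s = 1.
Proof.
rewrite -conj_cexp mulrC; apply: complex_eqP; first by rewrite Re_mulc_conj sqn_cexp.
by rewrite Im_mulc_conj.
Qed.

Lemma is_derive_cos_la (la x : R) : is_derive x (1 : R) (fun s => cos (la * s)) (- (la * sin (la * x))).
Proof.
have := is_derive_cos_affine la 0 x; rewrite addr0.
by congr (is_derive _ _ _ _); apply/funext => y; rewrite addr0.
Qed.

Lemma is_derive_sin_la (la x : R) : is_derive x (1 : R) (fun s => sin (la * s)) (la * cos (la * x)).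
Proof.
have := is_derive_sin_affine la 0 x; rewrite addr0.
by congr (is_derive _ _ _ _); apply/funext => y; rewrite addr0.
Qed.

Lemma continuous_cos_la la : continuous (fun s : R => cos (la * s)).
Proof. by apply: is_derive_continuous => x; exact: is_derive_cos_la. Qed.
Lemma continuous_sin_la la : continuous (fun s : R => sin (la * s)).
Proof. by apply: is_derive_continuous => x; exact: is_derive_sin_la. Qed.

Lemma cexp_bounded la a b : @cbounded _ mR R (oo a b) (cexp la).
Proof.
split.
- by apply: measurable_continuous; [exact: mleb | exact: continuous_cos_la].
- by apply: measurable_continuous; [exact: mleb | exact: continuous_sin_la].
- by exists 1 => x _; split; [exact: cos_max | exact: sin_max].
Qed.

Definition cprim (k : R -> R[i]) (t : R) : R[i] := cintegral leb (oo 0 t) k.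

Lemma cprim_ibp (T : R) (k : R -> R[i]) la : 0 <= T -> cintegrable leb (oo 0 T) k ->
  cintegrable leb (oo 0 T) (fun s => ci * la%:C * cexp la s * cprim k s) /\
  cintegral leb (oo 0 T) (fun s => ci * la%:C * cexp la s * cprim k s) =
  cintegral leb (oo 0 T) (fun s => k s * (cexp la T - cexp la s)).
Proof.
move=> T0 [k1 k2].
have cc : continuous (fun s : R => - (la * sin (la * s))).
  by move=> x; apply: cvgN; apply: cvgM; [exact: cvg_cst | exact: continuous_sin_la].
have cs : continuous (fun s : R => la * cos (la * s)).
  by move=> x; apply: cvgM; [exact: cvg_cst | exact: continuous_cos_la].
have [i11 e11] := prim_ibp T0 k1 (is_derive_cos_la la) cc.
have [i12 e12] := prim_ibp T0 k2 (is_derive_cos_la la) cc.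
have [i21 e21] := prim_ibp T0 k1 (is_derive_sin_la la) cs.
have [i22 e22] := prim_ibp T0 k2 (is_derive_sin_la la) cs.
have eR s : Re (ci * la%:C * cexp la s * cprim k s) =
   - (la * sin (la * s)) * prim (fun x => Re (k x)) s +
   - (la * cos (la * s) * prim (fun x => Im (k x)) s).
  by rewrite !ReImE /prim /=; ring.
have eI s : Im (ci * la%:C * cexp la s * cprim k s) =
   - (la * sin (la * s)) * prim (fun x => Im (k x)) s +
   la * cos (la * s) * prim (fun x => Re (k x)) s.
  by rewrite !ReImE /prim /=; ring.
have m := @mleb R (`]0, T[).
have ki (f c : R -> R) : integrableR leb (oo 0 T) f -> continuous c -> (forall x, `|c x| <= 1) ->
    integrableR leb (oo 0 T) (fun x => f x * (c T - c x)).
  move=> fi cc' c1; apply: (eq_integrable m) (integrableR_bddM m (M := 2) (a := fun x => c T - c x) _ _ fi).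
  - by move=> x _ /=; rewrite mulrC.
  - by apply: measurable_continuous => // x; apply: cvgB; [exact: cvg_cst | exact: cc'].
  - by move=> x _; apply: (le_trans (ler_normB _ _)); apply: lerD.
have cM x : `|cos (la * x)| <= 1 by exact: cos_max.
have sM x : `|sin (la * x)| <= 1 by exact: sin_max.
split.
  split.
    by apply: (eq_integrable m) (integrableRD m i11 (integrableRN i22)) => s _; exact: (congr1 EFin (esym (eR s))).
  by apply: (eq_integrable m) (integrableRD m i12 i21) => s _; exact: (congr1 EFin (esym (eI s))).
apply: complex_eqP; rewrite ?Re_cintegral ?Im_cintegral.
  transitivity (\int[leb]_(s in oo 0 T) (- (la * sin (la * s)) * prim (fun x => Re (k x)) s) -
      \int[leb]_(s in oo 0 T) (la * cos (la * s) * prim (fun x => Im (k x)) s)).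
    by rewrite -RintegralB //; apply: eq_Rintegral => s _; exact: eR.
  rewrite e11 e22 -RintegralB //; try (apply: ki => //; try exact: continuous_cos_la;
    exact: continuous_sin_la).
  by apply: eq_Rintegral => s _; rewrite !ReImE /=; ring.
transitivity (\int[leb]_(s in oo 0 T) (- (la * sin (la * s)) * prim (fun x => Im (k x)) s) +
    \int[leb]_(s in oo 0 T) (la * cos (la * s) * prim (fun x => Re (k x)) s)).
  by rewrite -RintegralD //; apply: eq_Rintegral => s _; exact: eI.
rewrite e12 e21 -RintegralD //; try (apply: ki => //; try exact: continuous_cos_la;
    exact: continuous_sin_la).
by apply: eq_Rintegral => s _; rewrite !ReImE /=; ring.
Qed.

Lemma cintegral_cexp (T la : R) : 0 <= T ->
  cintegral leb (oo 0 T) (fun s => ci * la%:C * cexp la s) = cexp la T - 1.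
Proof.
move=> T0.
have cc : continuous (fun s : R => - (la * sin (la * s))).
  by move=> x; apply: cvgN; apply: cvgM; [exact: cvg_cst | exact: continuous_sin_la].
have cs : continuous (fun s : R => la * cos (la * s)).
  by move=> x; apply: cvgM; [exact: cvg_cst | exact: continuous_cos_la].
apply: complex_eqP; rewrite ?Re_cintegral ?Im_cintegral.
  have := Rintegral_FTC T0 (is_derive_cos_la la) cc; rewrite mulr0 cos0 ReD ReN /= => <-.
  by apply: eq_Rintegral => s _; rewrite ?ReImE /=; ring.
have := Rintegral_FTC T0 (is_derive_sin_la la) cs; rewrite mulr0 sin0 ImD ImN /= oppr0 addr0 => <-.
by apply: eq_Rintegral => s _; rewrite ?ReImE /=; ring.
Qed.

Lemma cexp_cintegrable la a b : cintegrable leb (oo a b) (cexp la).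
Proof.
have m := @mleb R (`]a, b[); have [h1 h2 [M hM]] := cexp_bounded la a b.
apply: (cintegrable_bounded m (B := M)) => //; first exact: leb_oo_lt.
  by move=> x /hM [].
by move=> x /hM [].
Qed.

(** The equation is known in integrated form only, so [y] is a primitive of an integrable function.
    Multiplying by the exponential and using [cprim_ibp] replaces differentiation, and the integrals
    containing [y] cancel. *)
Lemma duhamel (T la : R) (y g : R -> R[i]) : 0 <= T ->
  cintegrable leb (oo 0 T) y -> cintegrable leb (oo 0 T) g ->
  (forall t, 0 <= t <= T -> y t = y 0 +
     cintegral leb (oo 0 t) (fun s => ci * (- la%:C * y s) - ci * g s)) ->
  cexp la T * y T = y 0 - ci * cintegral leb (oo 0 T) (fun s => cexp la s * g s).
Proof.
move=> T0 yi gi hy; have m := @mleb R (`]0, T[).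
pose k s := ci * (- la%:C * y s) - ci * g s.
have ki : cintegrable leb (oo 0 T) k.
  by apply: cintegrableB => //; apply: cintegrableZ => //; exact: cintegrableZ.
have [i1 e1] := cprim_ibp la T0 ki.
have Ei := cexp_cintegrable la 0 T; have Eb := cexp_bounded la 0 T.
have kK s : 0 <= s <= T -> cprim k s = y s - y 0.
  by move=> sT; rewrite [y s]hy // addrC addKr.
have Eyi : cintegrable leb (oo 0 T) (fun s => ci * la%:C * (cexp la s * y s)).
  by apply: cintegrableZ => //; exact: cintegrable_bddM.
have Egi : cintegrable leb (oo 0 T) (fun s => cexp la s * g s) by exact: cintegrable_bddM.
have Eki : cintegrable leb (oo 0 T) (fun s => cexp la s * k s) by exact: cintegrable_bddM.
set I := cintegral _ _ _.
have lhs : cintegral leb (oo 0 T) (fun s => ci * la%:C * cexp la s * cprim k s) =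
    cintegral leb (oo 0 T) (fun s => ci * la%:C * (cexp la s * y s)) - y 0 * (cexp la T - 1).
  rewrite -(cintegral_cexp la T0) -cintegralZ //; last by apply: cintegrableZ.
  rewrite -cintegralB //; last by apply: cintegrableZ => //; exact: cintegrableZ.
  by apply: eq_cintegral => s /ooP/andP[s0 sT]; rewrite kK ?ltW //; ring.
have rhs : cintegral leb (oo 0 T) (fun s => k s * (cexp la T - cexp la s)) =
    cexp la T * (y T - y 0) +
    cintegral leb (oo 0 T) (fun s => ci * la%:C * (cexp la s * y s)) + ci * I.
  transitivity (cexp la T * cintegral leb (oo 0 T) k - cintegral leb (oo 0 T) (fun s => cexp la s * k s)).
    rewrite -cintegralZ // -cintegralB //; last by exact: cintegrableZ.
    by apply: eq_cintegral => s _; ring.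
  have -> : cintegral leb (oo 0 T) k = y T - y 0 by rewrite -[LHS]/(cprim k T) kK ?lexx ?T0.
  rewrite -addrA; congr (_ + _).
  rewrite -cintegralN // /I -cintegralZ // -cintegralD //; last by exact: cintegrableZ.
  by apply: eq_cintegral => s _; rewrite /k; ring.
move: e1; rewrite lhs rhs; set J := cintegral _ _ _ => e1.
have : - (y 0 * (cexp la T - 1)) = cexp la T * (y T - y 0) + ci * I.
  have := congr1 (fun z => z - J) e1; rewrite /= => e2.
  transitivity (J - y 0 * (cexp la T - 1) - J); first by ring.
  by rewrite e2; ring.
move=> e2; transitivity (cexp la T * (y T - y 0) + ci * I + cexp la T * y 0 - ci * I).
  by ring.
by rewrite -e2; ring.
Qed.

(** The converse of [duhamel]: variation of constants does satisfy the integrated equation. It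
    supplies the equation for the coefficients of the state built later. *)
Lemma duhamel_inv (t la : R) (y0 : R[i]) (g : R -> R[i]) : 0 <= t ->
  cintegrable leb (oo 0 t) g ->
  let y s := cexp (- la) s * (y0 - ci * cprim (fun r => cexp la r * g r) s) in
  cintegrable leb (oo 0 t) y /\
  y t = y0 + cintegral leb (oo 0 t) (fun s => ci * (- la%:C * y s) - ci * g s).
Proof.
move=> t0 gi y; have m := @mleb R (`]0, t[).
pose k r := cexp la r * g r.
have ki : cintegrable leb (oo 0 t) k by apply: cintegrable_bddM => //; exact: cexp_bounded.
have [i1 e1] := cprim_ibp (- la) t0 ki.
have Ei := cexp_cintegrable (- la) 0 t.
have Eb : cintegrable leb (oo 0 t) (fun s => cexp (- la) s * cprim k s).
  (* [cprim_ibp] carries a factor [la] and says nothing when it is zero; the exponential is then 1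
     and the primitive is bounded. *)
  have [la0|la0] := eqVneq la 0; last first.
    apply: (eq_cintegrable m) (cintegrableZ m ((ci * (- la)%:C)^-1) i1) => s _.
    have n0 : ci * (- la)%:C != 0.
      apply/eqP => /(congr1 (@complex.Im R)); rewrite ImM /= mul0r add0r mul1r => h.
      by move/eqP: la0; apply; lra.
    by rewrite -mulrA mulKf.
  have e s : cexp (- la) s = 1 by rewrite la0 oppr0 /cexp mul0r cos0 sin0.
  have bd (f : R -> R) : integrableR leb (oo 0 t) f -> integrableR leb (oo 0 t) (prim f).
    move: t0; rewrite le_eqVlt => /orP[/eqP <-|t0'] fi.
      by rewrite set_itvoo0; exact: integrable_set0.
    exact: bdd_meas_int (bdd_meas_prim t0' fi).
  have [k1 k2] := ki.
  have : cintegrable leb (oo 0 t) (cprim k) by split; [exact: bd k1 | exact: bd k2].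
  by apply: (eq_cintegrable m) => s _; rewrite e mul1r.
have yi : cintegrable leb (oo 0 t) y.
  apply: (eq_cintegrable m) (cintegrableB m (cintegrableZ m y0 Ei) (cintegrableZ m ci Eb)).
  by move=> s _; rewrite /y -/k; ring.
split=> //.
have I1 : cintegral leb (oo 0 t) (fun s => ci * (- la%:C * y s)) =
    y0 * (cexp (- la) t - 1) - ci * cintegral leb (oo 0 t) (fun s => k s * (cexp (- la) t - cexp (- la) s)).
  rewrite -e1 -(cintegral_cexp (- la) t0) -!cintegralZ //; last by apply: cintegrableZ.
  rewrite -cintegralB //; last 2 first.
  - by apply: cintegrableZ => //; exact: cintegrableZ.
  - exact: cintegrableZ.
  by apply: eq_cintegral => s _; rewrite /y -/k rmorphN; ring.
have I2 : cintegral leb (oo 0 t) (fun s => k s * (cexp (- la) t - cexp (- la) s)) =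
    cexp (- la) t * cprim k t - cintegral leb (oo 0 t) g.
  rewrite /cprim -cintegralZ // -cintegralB //; last exact: cintegrableZ.
  apply: eq_cintegral => s _; rewrite /k.
  transitivity (cexp (- la) t * (cexp la s * g s) - (cexp (- la) s * cexp la s) * g s).
    by ring.
  by rewrite cexp_mulN mul1r.
rewrite cintegralB //; last 2 first.
- by apply: cintegrableZ => //; exact: cintegrableZ.
- exact: cintegrableZ.
by rewrite I1 I2 cintegralZ // /y -/k; ring.
Qed.
End Duhamel.

(** * The control space and the moments of a solution *)

Section ControlPairing.
Context {R : realType} {n : nat}.
Local Notation leb := (@lebesgue_measure R).
Local Notation mR := (measurableTypeR R).
Local Notation oo a b := (`]a, b[%classic : set R).
Variables (ell : 'I_n -> R) (omega : 'I_n -> set R).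
Hypothesis ho : open_subset ell omega.

Lemma omega_meas j : measurable (omega j : set mR).
Proof. by apply: open_measurable; exact: (ho j).1. Qed.

Lemma cylinder_meas r t j : measurable (oo r t `*` omega j : set (mR * mR)).
Proof. by apply: measurableX; [exact: mleb | exact: omega_meas]. Qed.

Definition tensor (a : R -> R[i]) (f : 'I_n -> R -> R[i]) (j : 'I_n) (z : R * R) : R[i] :=
  a z.1 * f j z.2.

Definition control_ip r t := ips (leb \x leb)%E (fun j => oo r t `*` omega j).

Lemma control_hilbert r t :
  hilbert_form (L2s (leb \x leb)%E (fun j => oo r t `*` omega j)) (control_ip r t).
Proof. exact: (@L2s_hilbert _ _ _ _ n _ (cylinder_meas r t)). Qed.

Lemma L2_snd r t j (f : R -> R[i]) : L2 leb (omega j) f ->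
  L2 (leb \x leb)%E (oo r t `*` omega j) (fun z : mR * mR => f z.2).
Proof.
move=> [m1 m2 fi]; split.
- by apply: (measurable_snd_prod (omega_meas j) m1).
- by apply: (measurable_snd_prod (omega_meas j) m2).
have := integrableR_prod (mleb _) (omega_meas j) (integrableR_cst (mleb `]r, t[) (1 : R) (leb_oo_lt r t)) fi.
by apply: (eq_integrable (cylinder_meas r t j)) => z _ /=; rewrite mul1r.
Qed.

Lemma tensor_L2 r t a f : @cbounded _ mR R (oo r t) a -> L2G ell f ->
  L2s (leb \x leb)%E (fun j => oo r t `*` omega j) (tensor a f).
Proof.
move=> ba fL j; apply: (L2_bddM (cylinder_meas r t j) (a := fun z => a z.1) (f := fun z => f j z.2)).
  exact: (@cbounded_fst _ _ mR mR R (oo r t) (omega j) (mleb _) a ba).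
by apply: L2_snd; apply: L2S (fL j); [exact: mleb | exact: omega_meas | exact: (ho j).2].
Qed.

Lemma cintegral_cut_off j (F G : R -> R[i]) :
  cintegral leb (oo 0 (ell j)) (fun x => F x * (\1_(omega j) x)%:C * G x) =
  cintegral leb (omega j) (fun x => F x * G x).
Proof.
have sub := (ho j).2.
apply: complex_eqP; rewrite ?Re_cintegral ?Im_cintegral [LHS]Rintegral_mkcond [RHS]Rintegral_mkcond;
  apply: eq_Rintegral => x _; rewrite !patchE; (have [xo|xo] := boolP (x \in omega j);
  [rewrite (mem_set (sub _ (set_mem xo)))|]; rewrite indicE ?xo ?(negbTE xo) ?mulr1 ?rmorph1 ?mulr1 ?mulr0 ?mul0r //);
  by case: ifP.
Qed.

(** Fubini turns the time integral of the spatial pairing into one scalar product on the cylinder,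
    which makes Hilbert space tools applicable to the control. *)
Lemma control_pairing r t (h : 'I_n -> R * R -> R[i]) (a : R -> R[i]) phi :
  L2s (leb \x leb)%E (fun j => oo r t `*` omega j) h -> L2G ell phi ->
  @cbounded _ mR R (oo r t) a ->
  cintegrable leb (oo r t) (fun s => a s * innerG ell (cut_off omega h s) phi) /\
  cintegral leb (oo r t) (fun s => a s * innerG ell (cut_off omega h s) phi) =
  control_ip r t h (tensor (fun s => conjc (a s)) phi).
Proof.
move=> hL pL ba.
have p2L j : L2 (leb \x leb)%E (oo r t `*` omega j) (fun z : mR * mR => phi j z.2).
  by apply: L2_snd; apply: L2S (pL j); [exact: mleb | exact: omega_meas | exact: (ho j).2].
have hp j := L2_mul_conj (cylinder_meas r t j) (hL j) (p2L j).
have F j := cfubini1_weight (mleb _) (omega_meas j) (hp j) ba.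
have E s : a s * innerG ell (cut_off omega h s) phi =
    \sum_j a s * cintegral leb (omega j) (fun y => h j (s, y) * conjc (phi j y)).
  rewrite /innerG mulr_sumr; apply: eq_bigr => j _; congr (_ * _).
  exact: (cintegral_cut_off j (fun x => h j (s, x)) (fun x => conjc (phi j x))).
have [i e] : cintegrable leb (oo r t) (fun s => \sum_j a s * cintegral leb (omega j) (fun y => h j (s, y) * conjc (phi j y)))
  /\ cintegral leb (oo r t) (fun s => \sum_j a s * cintegral leb (omega j) (fun y => h j (s, y) * conjc (phi j y))) =
   \sum_j cintegral leb (oo r t) (fun s => a s * cintegral leb (omega j) (fun y => h j (s, y) * conjc (phi j y))).
  split.
    by apply: (cintegrable_sum (mleb _)) => j; exact: (F j).1.
  by apply: (cintegral_sum (mleb _)) => j; exact: (F j).1.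
split; first by apply: (eq_cintegrable (mleb _)) i => s _; rewrite E.
under eq_cintegral => s _ do rewrite E.
rewrite e; apply: eq_bigr => j _; rewrite (F j).2.
by apply: eq_cintegral => z _; rewrite /tensor conjcM conjcK; ring.
Qed.
End ControlPairing.

Section SolutionMoments.
Context {R : realType} {n : nat}.
Local Notation leb := (@lebesgue_measure R).
Local Notation mR := (measurableTypeR R).
Local Notation oo a b := (`]a, b[%classic : set R).
Variables (ell : 'I_n -> R) (omega : 'I_n -> set R).
Hypothesis ho : open_subset ell omega.

Lemma normG_sqr (f : 'I_n -> R -> R[i]) : normG ell f ^+ 2 = Re (innerG ell f f).
Proof.
rewrite /normG sqr_sqrtr; last first.
  by apply: sumr_ge0 => j _; apply: Rintegral_ge0 => x _; exact: sqr_ge0.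
rewrite /innerG Re_sum; apply: eq_bigr => j _; rewrite Re_cintegral.
by apply: eq_Rintegral => x _; rewrite Re_mulc_conj normc_sqn.
Qed.

Lemma normG_ge0 f : 0 <= normG ell f.
Proof. exact: sqrtr_ge0. Qed.

Lemma innerG_lipschitz f g phi : L2G ell f -> L2G ell g -> L2G ell phi ->
  sqn (innerG ell f phi - innerG ell g phi) <=
  normG ell (fun j x => f j x - g j x) ^+ 2 * normG ell phi ^+ 2.
Proof.
move=> fL gL pL; have H := L2G_hilbert ell; rewrite -(ipB H) // !normG_sqr.
exact: (cauchy_schwarz H (domB H fL gL) pL).
Qed.

Lemma moment_continuous T u phi : continuous_L2G ell T u -> L2G ell phi ->
  {within `[0, T], continuous (fun s => Re (innerG ell (u s) phi))} /\
  {within `[0, T], continuous (fun s => Im (innerG ell (u s) phi))}.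
Proof.
move=> [uL uc] pL; set M := normG ell phi + 1.
have M0 : 0 < M by rewrite /M; have := normG_ge0 phi; lra.
have key (P : R[i] -> R) (PB : forall x y, P x - P y = P (x - y)) (PN : forall z, P z ^+ 2 <= sqn z) :
    {within `[0, T], continuous (fun s => P (innerG ell (u s) phi))}.
  apply/subspace_continuousP => t tT; apply/cvgrPdist_le => e e0.
  have tT' : t \in `[0, T] by exact: tT.
  have /cvgr0Pnorm_le /(_ (e / M)) h := uc t tT'.
  have eM : 0 < e / M by rewrite divr_gt0.
  near=> s.
  have sT : s \in `[0, T] by near: s; exact: withinT.
  have hs : normG ell (fun j x => u s j x - u t j x) <= e / M.
    by rewrite -[leLHS]ger0_norm ?normG_ge0 //; near: s; exact: h.
  rewrite distrC PB -(@ler_pXn2r _ 2) ?nnegrE ?normr_ge0 ?(ltW e0) // real_normK ?num_real //.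
  apply: (le_trans (PN _)); apply: (le_trans (innerG_lipschitz (uL s sT) (uL t tT') pL)).
  have -> : e = (e / M) * M by rewrite divfK // gt_eqF.
  rewrite [leRHS]exprMn; apply: ler_pM; rewrite ?sqr_ge0 //.
    by apply: lerXn2r; rewrite ?nnegrE ?normG_ge0 // ltW.
  by apply: lerXn2r; rewrite ?nnegrE ?normG_ge0 // ?ltW // /M; lra.
split; apply: key => [x y|z].
- by rewrite ReD ReN.
- by rewrite /sqn lerDl sqr_ge0.
- by rewrite ImD ImN.
- by rewrite /sqn lerDr sqr_ge0.
Unshelve. all: by end_near.
Qed.

Lemma moment_cintegrable T u phi : 0 < T -> continuous_L2G ell T u -> L2G ell phi ->
  cintegrable leb (oo 0 T) (fun s => innerG ell (u s) phi).
Proof.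
move=> T0 uc pL; have [c1 c2] := moment_continuous uc pL.
by split; [exact: bdd_meas_int (within_continuous_bdd_meas T0 c1) |
  exact: bdd_meas_int (within_continuous_bdd_meas T0 c2)].
Qed.

Lemma conj_cexp_bounded (la a b : R) : @cbounded _ mR R (oo a b) (fun s => conjc (cexp la s)).
Proof. by apply: cbounded_conj; exact: cexp_bounded. Qed.

(** For an eigenfunction the weak equation closes on the single coefficient and becomes the scalar
    equation solved by [duhamel]. This turns controllability into a moment problem. *)
Lemma solution_moment T h u phi (la : R) : 0 < T ->
  L2_control omega T h -> schrodinger_solution ell omega T h u ->
  L2G ell phi -> laplacian ell phi (fun j x => (- la)%:C * phi j x) ->
  cexp la T * innerG ell (u T) phi = innerG ell (u 0) phi -
    ci * control_ip omega 0 T h (tensor (fun s => conjc (cexp la s)) phi).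
Proof.
move=> T0 hL [uc hu] pL pla.
have b1 : @cbounded _ mR R (oo 0 T) (fun=> 1).
  by split=> //; exists 1 => x _; rewrite /= normr1 normr0.
have [gi _] := control_pairing ho hL pL b1.
have gi' : cintegrable leb (oo 0 T) (fun s => innerG ell (cut_off omega h s) phi).
  by apply: (eq_cintegrable (mleb _)) gi => s _; rewrite mul1r.
rewrite -(control_pairing ho hL pL (cexp_bounded la 0 T)).2.
apply: (duhamel (ltW T0) (moment_cintegrable T0 uc pL) gi') => t tT.
have tT' : t \in `[0, T] by rewrite in_itv.
rewrite (hu _ _ pla t tT'); congr (_ + _); apply: eq_cintegral => s /ooP/andP[s0 st].
congr (_ * _ - _).
have H := L2G_hilbert ell.
have sT : s \in `[0, T].
  by move/andP: tT => [_ tT]; rewrite in_itv /= (ltW s0) (ltW (lt_le_trans st tT)).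
have e := ipZr H (- la)%:C (uc.1 s sT) pL.
transitivity (conjc (- la)%:C * innerG ell (u s) phi); first by exact: e.
by rewrite conjc_real rmorphN.
Qed.
End SolutionMoments.

(** * Necessity: nearly cancelling waves *)

Section Lipschitz.
Context {R : realType}.

Lemma lipschitz_of_derive (f df : R -> R) (x y : R) : (forall x, is_derive x (1 : R) f (df x)) ->
  (forall x, `|df x| <= 1) -> `|f x - f y| <= `|x - y|.
Proof.
move=> fd d1; wlog xy : x y / x <= y.
  by move=> h; have [/h //|/ltW/h] := leP x y; rewrite distrC (distrC x).
have [c _ e] := MVT_segment xy (fun z _ => fd z)
  (continuous_subspaceT (is_derive_continuous fd)).
by rewrite distrC e normrM (distrC x) ler_piMl.
Qed.

Lemma sin_lipschitz (x y : R) : `|sin x - sin y| <= `|x - y|.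
Proof. by apply: (lipschitz_of_derive (df := cos)) => z; exact: cos_max. Qed.

Lemma cos_lipschitz (x y : R) : `|cos x - cos y| <= `|x - y|.
Proof.
by apply: (lipschitz_of_derive (df := fun z => - sin z)) => z; rewrite normrN; exact: sin_max.
Qed.

Lemma sqr_le_norm (x y : R) : `|x| <= `|y| -> x ^+ 2 <= y ^+ 2.
Proof. by move=> h; rewrite -(real_normK (num_real x)) -(real_normK (num_real y)) lerXn2r ?nnegrE. Qed.

(** The time factors differ through [a ^+ 2 - b ^+ 2 = (a - b) * (a + b)], which brings
    [(a + b) ^+ 2 * T ^+ 2]; the space factors differ through [a - b] times a length. Sine and
    cosine are 1-Lipschitz. *)
Lemma sqn_sin_cexp (a b s y T L : R) : 0 <= a -> 0 <= b -> 0 <= s <= T -> 0 <= y <= L ->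
  sqn (conjc (cexp (a ^+ 2) s) * (sin (a * y))%:C - conjc (cexp (b ^+ 2) s) * (sin (b * y))%:C) <=
  (a - b) ^+ 2 * (4 * (a + b) ^+ 2 * T ^+ 2 + 2 * L ^+ 2).
Proof.
move=> a0 b0 /andP[s0 sT] /andP[y0 yL].
have hc := sqr_le_norm (cos_lipschitz (a ^+ 2 * s) (b ^+ 2 * s)).
have hs := sqr_le_norm (sin_lipschitz (a ^+ 2 * s) (b ^+ 2 * s)).
have hy := sqr_le_norm (sin_lipschitz (a * y) (b * y)).
set ca := cos (a ^+ 2 * s) in hc *; set cb := cos (b ^+ 2 * s) in hc *.
set sa := sin (a ^+ 2 * s) in hs *; set sb := sin (b ^+ 2 * s) in hs *.
set u := sin (a * y) in hy *; set v := sin (b * y) in hy *.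
have u1 : u ^+ 2 <= 1 by have := sqr_le_norm (x := u) (y := 1); rewrite normr1 expr1n; apply; exact: sin_max.
have cs : cb ^+ 2 + sb ^+ 2 = 1 by exact: cos2Dsin2.
have -> : sqn (conjc (cexp (a ^+ 2) s) * u%:C - conjc (cexp (b ^+ 2) s) * v%:C) =
    ((ca - cb) * u + cb * (u - v)) ^+ 2 + ((sa - sb) * u + sb * (u - v)) ^+ 2.
  by rewrite /sqn !ReImE /= -/ca -/cb -/sa -/sb; ring.
apply: (@le_trans _ _ (2 * ((ca - cb) ^+ 2 + (sa - sb) ^+ 2) * u ^+ 2 + 2 * (u - v) ^+ 2)).
  have -> : 2 * (u - v) ^+ 2 = 2 * (u - v) ^+ 2 * (cb ^+ 2 + sb ^+ 2) by rewrite cs mulr1.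
  rewrite -subr_ge0.
  have -> : 2 * ((ca - cb) ^+ 2 + (sa - sb) ^+ 2) * u ^+ 2 + 2 * (u - v) ^+ 2 * (cb ^+ 2 + sb ^+ 2) -
    (((ca - cb) * u + cb * (u - v)) ^+ 2 + ((sa - sb) * u + sb * (u - v)) ^+ 2) =
    ((ca - cb) * u - cb * (u - v)) ^+ 2 + ((sa - sb) * u - sb * (u - v)) ^+ 2 by ring.
  by rewrite addr_ge0 ?sqr_ge0.
have e1 : (a ^+ 2 * s - b ^+ 2 * s) ^+ 2 <= (a - b) ^+ 2 * ((a + b) ^+ 2 * T ^+ 2).
  have -> : (a ^+ 2 * s - b ^+ 2 * s) ^+ 2 = (a - b) ^+ 2 * ((a + b) ^+ 2 * s ^+ 2) by ring.
  by rewrite !ler_wpM2l ?sqr_ge0 // lerXn2r ?nnegrE // (le_trans s0).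
have e2 : (a * y - b * y) ^+ 2 <= (a - b) ^+ 2 * L ^+ 2.
  have -> : (a * y - b * y) ^+ 2 = (a - b) ^+ 2 * y ^+ 2 by ring.
  by rewrite !ler_wpM2l ?sqr_ge0 // lerXn2r ?nnegrE // (le_trans y0).
have e3 : 2 * ((ca - cb) ^+ 2 + (sa - sb) ^+ 2) * u ^+ 2 <= 2 * ((ca - cb) ^+ 2 + (sa - sb) ^+ 2).
  by rewrite ler_piMr // mulr_ge0 // addr_ge0 ?sqr_ge0.
have -> : (a - b) ^+ 2 * (4 * (a + b) ^+ 2 * T ^+ 2 + 2 * L ^+ 2) =
  4 * ((a - b) ^+ 2 * ((a + b) ^+ 2 * T ^+ 2)) + 2 * ((a - b) ^+ 2 * L ^+ 2) by ring.
lra.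
Qed.
End Lipschitz.

Section SpreadCoefficients.
Context {R : realType}.

(** The indices [n_ j] may repeat. Each index receives the weight of the smallest [j] that reaches
    it, so later visits are bounded below a fortiori and the squares are dominated by the geometric
    series of ratio [1 / 4]. *)
Lemma spread_coefficients (n_ : nat -> nat) : exists d : nat -> R,
  [/\ forall j, (1 / 2) ^+ j <= d (n_ j),
      forall k, (forall j, n_ j != k) -> d k = 0 &
      forall n, \sum_(k < n) d k ^+ 2 <= 2].
Proof.
pose hit k := exists j, n_ j == k.
pose d k : R := if pselect (hit k) is left e then (1 / 2) ^+ ex_minn e else 0.
pose mi k := if pselect (hit k) is left e then ex_minn e else 0%N.
exists d; split=> [j|k hk|n].
- rewrite /d; case: pselect => [e|[]]; last by exists j.
  case: ex_minnP => m _ hm; apply: ler_wiXn2l; [lra|lra|exact: hm].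
- by rewrite /d; case: pselect => // e; have [j ej] := e; have := hk j; rewrite ej.
have q0 j : 0 <= (1 / 4 : R) ^+ j by apply: exprn_ge0; lra.
pose M := (\max_(k < n) mi k).+1.
(* The minimal visit is one term of the sum on the right, the other terms being nonnegative. *)
have dk (k : 'I_n) : d k ^+ 2 <= \sum_(j < M) ((n_ j == k)%:R * (1 / 4 : R) ^+ j).
  have : (mi k < M)%N by rewrite ltnS (@leq_bigmax _ (fun k : 'I_n => mi k)).
  rewrite /mi /d; case: pselect => [e|_] mM; last first.
    by rewrite expr0n; apply: sumr_ge0 => j _; apply: mulr_ge0 => //; exact: ler0n.
  have em : n_ (ex_minn e) == k by case: ex_minnP.
  rewrite (bigD1 (Ordinal mM)) //= em mul1r exprAC.
  have -> : (2^-1 : R) ^+ 2 = 1 / 4 by field.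
  rewrite mulr1n [X in _ <= X + _]mul1r lerDl; apply: sumr_ge0 => j _; apply: mulr_ge0 => //; exact: ler0n.
apply: (le_trans (ler_sum _ (fun k _ => dk k))); rewrite exchange_big /=.
apply: (@le_trans _ _ (\sum_(j < M) (1 / 4 : R) ^+ j)).
  apply: ler_sum => j _; rewrite -mulr_suml; apply: ler_piMl => //.
  rewrite -natr_sum -[leRHS](mulr1n 1) ler_nat.
  have [jn|jn] := ltnP (n_ j) n.
    by rewrite (bigD1 (Ordinal jn)) //= eqxx big1 // => k; rewrite -val_eqE /= eq_sym => /negbTE ->.
  by rewrite big1 // => k _; case: eqP => // e; have := ltn_ord k; rewrite -e ltnNge jn.
have : \sum_(j < M) (1 / 4 : R) ^+ j <= 2 - 2 * (1 / 4) ^+ M.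
  elim: {dk} M => [|m IH]; first by rewrite big_ord0 expr0; lra.
  by rewrite big_ord_recr /= exprS; have := q0 m; lra.
by have := q0 M; lra.
Qed.
End SpreadCoefficients.

Section ControlBound.
Context {R : realType} {n : nat}.
Local Notation leb := (@lebesgue_measure R).
Local Notation mR := (measurableTypeR R).
Local Notation oo a b := (`]a, b[%classic : set R).
Variables (ell : 'I_n -> R) (omega : 'I_n -> set R).
Hypothesis ho : open_subset ell omega.

Lemma omega_finite j : (leb (omega j) < +oo)%E.
Proof.
apply: (le_lt_trans _ (leb_oo_lt 0 (ell j))); apply: le_measure.
- by rewrite inE; exact: (omega_meas ho).
- by rewrite inE; exact: mleb.
- exact: (ho j).2.
Qed.

Lemma cst_cylinder_integrable r t j (B : R) :
  integrableR (leb \x leb)%E (oo r t `*` omega j) (fun=> B).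
Proof.
have := integrableR_prod (mleb _) (omega_meas ho j) (integrableR_cst (mleb `]r, t[) B (leb_oo_lt r t))
  (integrableR_cst (omega_meas ho j) (1 : R) (omega_finite j)).
by apply: (eq_integrable (cylinder_meas ho r t j)) => z _ /=; rewrite mulr1.
Qed.

Lemma control_sq_le r t f (B : R) : L2s (leb \x leb)%E (fun j => oo r t `*` omega j) f ->
  (forall j z, (oo r t `*` omega j) z -> sqn (f j z) <= B) ->
  Re (control_ip omega r t f f) <= B * \sum_j \int[(leb \x leb)%E]_(z in oo r t `*` omega j) 1.
Proof.
move=> fL fB; rewrite Re_sum mulr_sumr; apply: ler_sum => j _.
have mC := cylinder_meas ho r t j.
rewrite -RintegralZl ?Re_cintegral //; last exact: cst_cylinder_integrable.
apply: le_Rintegral => //.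
- have [_ _] := fL j; apply: (eq_integrable mC) => z _ /=.
  by rewrite Re_mulc_conj normc_sqn.
- by have := cst_cylinder_integrable r t j B; apply: (eq_integrable mC) => z _ /=; rewrite mulr1.
- by move=> z hz; rewrite mulr1 Re_mulc_conj; exact: fB.
Qed.
End ControlBound.

Section Necessity.
Context {R : realType}.
Local Notation leb := (@lebesgue_measure R).
Local Notation mR := (measurableTypeR R).
Local Notation oo a b := (`]a, b[%classic : set R).
Variables (lb lt : R).
Hypotheses (hb : 0 < lb) (ht : 0 < lt).
Local Notation ell := (@X_length R lb lt).
Local Notation al := (lt / lb).

(** Failure of the defining inequality for the constant [C] gives an integer [p]; it is positive
    because [q * al - p < C <= al / 2] while [q * al >= al]. *)
Lemma good_approximation (C : R) : ~ badly_approximable al -> 0 < C -> C <= al / 2 ->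
  exists p q : nat, [/\ (0 < p)%N, (0 < q)%N & `|q%:R * al - p%:R| * q%:R <= C].
Proof.
move=> nba C0 Ca; apply: contrapT => hn; apply: nba; exists C => // p q q0.
rewrite leNgt; apply/negP => hlt; apply: hn.
have al0 : 0 < al by rewrite divr_gt0.
have qR : (0 : R) < q%:R by rewrite ltr0n.
have q1 : (1 : R) <= q%:R by rewrite ler1n.
have h : `|q%:R * al - p%:~R| * q%:R < C.
  have e : `|q%:R * al - p%:~R| = q%:R * `|al - p%:~R / q%:R|.
    have -> : q%:R * al - p%:~R = q%:R * (al - p%:~R / q%:R) by field; rewrite !gt_eqF.
    by rewrite normrM ger0_norm // ltW.
  rewrite e mulrAC -expr2 mulrC -ltr_pdivlMr ?exprn_gt0 //.
have pR : (0 : R) < p%:~R.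
  have h1 : `|q%:R * al - p%:~R| < C.
    by apply: le_lt_trans h; rewrite ler_peMr.
  have : al <= q%:R * al by rewrite ler_peMl // ltW.
  by move: h1; rewrite ltr_norml => /andP[_]; lra.
case: p pR {hlt} h => [p|p] pR h; last by move: pR; rewrite ltr0z.
exists p, q; split=> //; last exact: ltW.
by move: pR; rewrite ltr0z.
Qed.

(** A frequency gap of order [C / q] multiplied by a frequency sum of order [q] leaves an eigenvalue
    gap of order [C], uniformly in [q]. *)
Lemma quasi_frequency (W k C T L s y a b : R) (q : nat) : (0 < q)%N ->
  0 <= a -> 0 <= b -> a <= W * q%:R -> b <= W * q%:R -> `|a - b| * q%:R <= k * C ->
  0 <= s <= T -> 0 <= y <= L ->
  sqn (conjc (cexp (a ^+ 2) s) * (sin (a * y))%:C - conjc (cexp (b ^+ 2) s) * (sin (b * y))%:C) <=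
  (k * C) ^+ 2 * (16 * W ^+ 2 * T ^+ 2 + 2 * L ^+ 2).
Proof.
move=> q0 a0 b0 aW bW ab hs hy; apply: (le_trans (sqn_sin_cexp a0 b0 hs hy)).
have q1 : (1 : R) <= q%:R by rewrite ler1n.
have q2 : 1 <= q%:R ^+ 2 :> R by rewrite exprn_ege1.
have abq : (a - b) ^+ 2 * q%:R ^+ 2 <= (k * C) ^+ 2.
  have h0 : 0 <= `|a - b| * q%:R by rewrite mulr_ge0.
  by rewrite -(real_normK (num_real (a - b))) -exprMn lerXn2r // nnegrE // (le_trans h0).
have d0 := sqr_ge0 (a - b).
have abW : (a + b) ^+ 2 <= 4 * W ^+ 2 * q%:R ^+ 2.
  have -> : 4 * W ^+ 2 * q%:R ^+ 2 = (W * q%:R + W * q%:R) ^+ 2 by ring.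
  have h0 := addr_ge0 a0 b0; have h1 := lerD aW bW.
  by rewrite lerXn2r // nnegrE // (le_trans h0).
apply: (@le_trans _ _ ((a - b) ^+ 2 * q%:R ^+ 2 * (16 * W ^+ 2 * T ^+ 2 + 2 * L ^+ 2))); last first.
  have g1 := mulr_ge0 (sqr_ge0 W) (sqr_ge0 T); have g2 := sqr_ge0 L.
  by rewrite ler_wpM2r // -mulrA; lra.
rewrite -[leRHS]mulrA ler_wpM2l // [leRHS]mulrDr lerD //.
  have -> : q%:R ^+ 2 * (16 * W ^+ 2 * T ^+ 2) = 4 * (4 * W ^+ 2 * q%:R ^+ 2) * T ^+ 2 by ring.
  by rewrite ler_wpM2r ?sqr_ge0 // ler_wpM2l.
by rewrite ler_peMl // mulr_ge0 ?sqr_ge0.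
Qed.

Variables (omega : 'I_4 -> set R) (T : R).
Hypotheses (ho : open_subset ell omega).
Hypotheses (ho1 : omega (inord 1) = set0) (ho3 : omega (inord 3) = set0).
Hypothesis T0 : 0 < T.

Definition wave (t m : nat) : 'I_4 -> R * R -> R[i] :=
  tensor (fun s => conjc (cexp (xfreq lb lt t m ^+ 2) s)) (xmode lb lt t m).

Lemma wave_L2 t m : L2s (leb \x leb)%E (fun j => oo 0 T `*` omega j) (wave t m).
Proof. by apply: (tensor_L2 ho); [exact: conj_cexp_bounded | exact: xmode_L2G]. Qed.

Lemma scaled_wave t m j z : (Num.sqrt (xlen lb lt t))%:C * wave t m j z =
  (xsign t m j : R)%:C * (conjc (cexp (xfreq lb lt t m ^+ 2) z.1) *
    (sin (xfreq lb lt t m * (ell j - z.2)))%:C).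
Proof.
rewrite /wave /tensor /xmode /mode /xamp /mode_sin.
have s0 : Num.sqrt (xlen lb lt t) != 0 by rewrite gt_eqF // sqrtr_gt0 xlen_gt0.
set S := Num.sqrt _ in s0 *; set c := conjc _; set g := xsign _ _ _.
have -> : - xfreq lb lt t m * z.2 + xfreq lb lt t m * ell j = xfreq lb lt t m * (ell j - z.2) by ring.
rewrite [LHS]mulrCA [RHS]mulrCA; congr (c * _).
by rewrite -!rmorphM; congr (_%:C); field.
Qed.

(** When [p] over [q] is close to [al] the three frequencies nearly agree. The coefficients undo the
    normalisations and are such that the even wave nearly cancels the type 0 wave on [e_1] and the
    type 1 wave on [e_3]; on [e_2] and [e_4] the terms add up instead, but [omega] does not meet
    those edges. *)
Definition quasi_mode (p q : nat) : 'I_4 -> R * R -> R[i] :=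
  (Num.sqrt (xlen lb lt 2))%:C *: wave 2 (p + q) - (Num.sqrt (xlen lb lt 0))%:C *: wave 0 q +
  ((-1) ^+ (p + q) * Num.sqrt (xlen lb lt 1))%:C *: wave 1 p.

Lemma quasi_modeE p q j z : quasi_mode p q j z =
  (Num.sqrt (xlen lb lt 2))%:C * wave 2 (p + q) j z - (Num.sqrt (xlen lb lt 0))%:C * wave 0 q j z +
  ((-1) ^+ (p + q) * Num.sqrt (xlen lb lt 1))%:C * wave 1 p j z.
Proof. by []. Qed.

Lemma quasi_mode_small : exists2 K : R, 0 <= K & forall p q (C : R), (0 < q)%N -> 0 <= C -> C <= al ->
  `|q%:R * al - p%:R| * q%:R <= C ->
  Re (control_ip omega 0 T (quasi_mode p q) (quasi_mode p q)) <= K * C ^+ 2.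
Proof.
have al0 : 0 < al by rewrite divr_gt0.
have l0 : 0 < lb + lt by rewrite addr_gt0.
(* [W * q] bounds the three frequencies, using [p <= 2 * al * q]; [k] converts the error
   [|q * al - p|] into the gaps between the even frequency [mu] and the other two. *)
pose W : R := pi * (2 * al + 1) / (lb + lt) + pi / lb + 2 * al * pi / lt.
pose k : R := pi / (lb + lt) + pi * lb / ((lb + lt) * lt).
pose M : R := \sum_j \int[(leb \x leb)%E]_(z in oo 0 T `*` omega j) 1.
pose B : R := 16 * W ^+ 2 * T ^+ 2 + 2 * (lb + lt) ^+ 2.
have M0 : 0 <= M by apply: sumr_ge0 => j _; apply: Rintegral_ge0.
have B0 : 0 <= B.
  have g1 := mulr_ge0 (sqr_ge0 W) (sqr_ge0 T); have g2 := sqr_ge0 (lb + lt).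
  by rewrite /B -mulrA; lra.
exists (k ^+ 2 * B * M); first exact: mulr_ge0 (mulr_ge0 (sqr_ge0 k) B0) M0.
move=> p q C q0 C0 Cal hpq.
have qR : (0 : R) < q%:R by rewrite ltr0n.
have q1 : (1 : R) <= q%:R by rewrite ler1n.
have Np : 0 < pi :> R := pi_gt0 R.
have dC : `|q%:R * al - p%:R| <= C by apply: le_trans hpq; rewrite ler_peMr.
have pq : p%:R <= 2 * al * q%:R :> R.
  have : al <= q%:R * al by rewrite ler_peMl // ltW.
  by move: dC; rewrite ler_norml => /andP[h _]; lra.
pose mu := xfreq lb lt 2 (p + q); pose nb := xfreq lb lt 0 q; pose nt := xfreq lb lt 1 p.
have f1 : 0 <= pi * (2 * al + 1) / (lb + lt) by apply: divr_ge0; [apply: mulr_ge0; lra|exact: ltW].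
have f2 : 0 <= pi / lb by rewrite divr_ge0 // ltW.
have f3 : 0 <= 2 * al * pi / lt by apply: divr_ge0; [apply: mulr_ge0; lra|exact: ltW].
have muW : mu <= W * q%:R.
  apply: (@le_trans _ _ (pi * (2 * al + 1) / (lb + lt) * q%:R)); last first.
    by rewrite ler_wpM2r ?ler0n // /W; lra.
  have -> : pi * (2 * al + 1) / (lb + lt) * q%:R = (2 * al + 1) * q%:R * pi / (lb + lt) by ring.
  by rewrite /mu /xfreq /= ler_pM2r ?invr_gt0 // ler_pM2r // natrD; lra.
have nbW : nb <= W * q%:R.
  apply: (@le_trans _ _ (pi / lb * q%:R)); last by rewrite ler_wpM2r ?ler0n // /W; lra.
  by have -> : nb = pi / lb * q%:R by rewrite /nb /xfreq /=; ring.
have ntW : nt <= W * q%:R.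
  apply: (@le_trans _ _ (2 * al * pi / lt * q%:R)); last by rewrite ler_wpM2r ?ler0n // /W; lra.
  have -> : 2 * al * pi / lt * q%:R = 2 * al * q%:R * pi / lt by ring.
  by rewrite /nt /xfreq /= ler_pM2r ?invr_gt0 // ler_pM2r.
have k1 : 0 <= pi / (lb + lt) by rewrite divr_ge0 // ltW.
have k2 : 0 <= pi * lb / ((lb + lt) * lt) by apply: divr_ge0; apply: mulr_ge0; exact: ltW.
have mub : `|mu - nb| * q%:R <= k * C.
  have -> : mu - nb = - (pi / (lb + lt) * (q%:R * al - p%:R)).
    by rewrite /mu /nb /xfreq /= natrD; field; rewrite !gt_eqF.
  rewrite normrN normrM (ger0_norm k1) -[leLHS]mulrA.
  apply: (@le_trans _ _ (pi / (lb + lt) * C)); first by rewrite ler_wpM2l.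
  by rewrite ler_wpM2r // /k; lra.
have mut : `|mu - nt| * q%:R <= k * C.
  have -> : mu - nt = pi * lb / ((lb + lt) * lt) * (q%:R * al - p%:R).
    by rewrite /mu /nt /xfreq /= natrD; field; rewrite !gt_eqF.
  rewrite normrM (ger0_norm k2) -[leLHS]mulrA.
  apply: (@le_trans _ _ (pi * lb / ((lb + lt) * lt) * C)); first by rewrite ler_wpM2l.
  by rewrite ler_wpM2r // /k; lra.
have fge t m : 0 <= xfreq lb lt t m.
  by rewrite /xfreq divr_ge0 ?mulr_ge0 ?ler0n ?pi_ge0 // ltW // xlen_gt0.
have -> : k ^+ 2 * B * M * C ^+ 2 = ((k * C) ^+ 2 * B) * M by ring.
have H := control_hilbert ho 0 T.
apply: (control_sq_le ho).
  apply: (domD H); last by apply: (domZ H); exact: wave_L2.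
  by apply: (domB H); apply: (domZ H); exact: wave_L2.
move=> j [s x] [/= /ooP/andP[s0 sT] xo].
have /ooP/andP[x0 xl] : oo 0 (ell j) x := (ho j).2 x xo.
have hs : 0 <= s <= T by rewrite !ltW.
have y0 : 0 <= ell j - x <= lb + lt.
  by move: xl; rewrite /X_length; case: ifP => _ xl; have := hb; have := ht; lra.
have [j0|[j2|]] : j = inord 0 \/ j = inord 2 \/ (j = inord 1 \/ j = inord 3).
  have : j = inord j by rewrite inord_val.
  by case: j {x xo x0 xl y0} => [] [|[|[|[|//]]]] hj /=; auto.
- have -> : quasi_mode p q j (s, x) =
    conjc (cexp (mu ^+ 2) s) * (sin (mu * (ell j - x)))%:C -
    conjc (cexp (nb ^+ 2) s) * (sin (nb * (ell j - x)))%:C.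
    rewrite quasi_modeE rmorphM -mulrA !scaled_wave j0 /= inordK //= rmorph1 rmorph0.
    by rewrite !mul1r mul0r mulr0 addr0.
  apply: (@quasi_frequency W k C T (lb + lt) _ _ _ _ q q0) => //; exact: fge.
- have -> : quasi_mode p q j (s, x) = (- (-1) ^+ (p + q))%:C *
    (conjc (cexp (mu ^+ 2) s) * (sin (mu * (ell j - x)))%:C -
     conjc (cexp (nt ^+ 2) s) * (sin (nt * (ell j - x)))%:C).
    rewrite quasi_modeE rmorphM -mulrA !scaled_wave j2 /= inordK //= rmorph1 rmorph0 rmorphN.
    by rewrite /mu /nt; ring.
  rewrite sqnM; have -> : sqn (- (-1) ^+ (p + q))%:C = 1 :> R.
    by rewrite /sqn /= expr0n addr0 sqrrN expr2 sqr_sign.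
  by rewrite mul1r; apply: (@quasi_frequency W k C T (lb + lt) _ _ _ _ q q0) => //; exact: fge.
by case=> jE; move: xo; rewrite jE ?ho1 ?ho3.
Qed.
End Necessity.

Section Necessity.
Context {R : realType}.
Local Notation leb := (@lebesgue_measure R).
Local Notation mR := (measurableTypeR R).
Local Notation oo a b := (`]a, b[%classic : set R).

Lemma innerG_eqG n (ell : 'I_n -> R) f g phi : L2G ell f -> L2G ell g -> L2G ell phi ->
  eqG ell f g -> innerG ell f phi = innerG ell g phi.
Proof.
move=> fL gL pL fg; apply: eq_bigr => j _.
apply: (ae_eq_cintegral (mleb _)); try exact: (L2_mul_conj (mleb _)).
by have := fg j; apply: filterS => x h xD; rewrite h.
Qed.

Variables (lb lt : R).
Hypotheses (hb : 0 < lb) (ht : 0 < lt).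
Local Notation ell := (@X_length R lb lt).
Local Notation al := (lt / lb).
Variables (omega : 'I_4 -> set R) (T : R).
Hypotheses (ho : open_subset ell omega).
Hypotheses (ho1 : omega (inord 1) = set0) (ho3 : omega (inord 3) = set0).
Hypothesis T0 : 0 < T.

(** Steer 0 to a state with nonzero coefficients only on type 0 modes. The control paired with a
    quasi-mode then sees a single wave, and Cauchy-Schwarz bounds the target coefficient by the
    small norm of the quasi-mode. *)
Lemma necessity : exactly_controllable ell omega T -> badly_approximable al.
Proof.
move=> hc; apply: contrapT => nba.
have al0 : 0 < al by rewrite divr_gt0.
pose c0 : R := al / 2; have c0p : 0 < c0 by rewrite divr_gt0.
(* The squared norms of the quasi-modes decay like [(1 / 64) ^+ j], against [(1 / 4) ^+ j] for the
   squared target coefficients: the ratio 16 gives the contradiction. *)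
pose C j : R := c0 * (1 / 8) ^+ j.
have C0 j : 0 < C j by rewrite mulr_gt0 // exprn_gt0 //; lra.
have Cc j : C j <= c0 by rewrite ler_piMr ?(ltW c0p) // exprn_ile1 //; lra.
have /choice[pq hpq] j : exists pq : nat * nat,
    [/\ (0 < pq.1)%N, (0 < pq.2)%N & `|pq.2%:R * al - pq.1%:R| * pq.2%:R <= C j].
  by have [p [q h]] := good_approximation hb ht nba (C0 j) (Cc j); exists (p, q).
(* [q.-1 * 3] is the index in [xphi] of the type 0 mode of rank [q]. *)
have [d [d1 d0 d2]] := @spread_coefficients R (fun j => ((pq j).2.-1 * 3)%N).
have HG := L2G_hilbert ell.
have [u1 u1L hu1] : exists2 u1, L2G ell u1 & forall k, innerG ell u1 (xphi lb lt k) = (d k)%:C.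
  apply: (moment_problem HG (xphi_L2G hb ht) (c := 1) ltr01 _ (B := 2)).
    by move=> n a; exact: (riesz_orthonormal HG (xphi_L2G hb ht) (xphi_orthonormal hb ht)).
  by move=> n; under eq_bigr do rewrite /sqn /= expr0n addr0; exact: d2.
have z0 := dom0 HG.
have [h [hL [u [hu e0 e1]]]] := hc 0 u1 z0 u1L.
have HK := control_hilbert ho 0 T.
have uL := hu.1.1.
have tT : T \in `[0, T] by rewrite in_itv /= lexx ltW.
have t0 : 0 \in `[0, T] by rewrite in_itv /= lexx ltW.
have mom t m : innerG ell u1 (xmode lb lt t m) = 0 - ci * control_ip omega 0 T h (wave lb lt t m) * cexp (- xfreq lb lt t m ^+ 2) T.
  have pL := xmode_L2G hb ht t m.
  have := solution_moment ho T0 hL hu pL (xmode_laplacian hb ht t m).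
  rewrite (innerG_eqG (uL _ t0) z0 pL e0) (innerG_eqG (uL _ tT) u1L pL e1) (ip0 HG pL) => e.
  rewrite -[LHS]mul1r -(cexp_mulN (xfreq lb lt t m ^+ 2) T) -mulrA e /wave; ring.
have mom_sqn t m : sqn (control_ip omega 0 T h (wave lb lt t m)) = sqn (innerG ell u1 (xmode lb lt t m)).
  rewrite mom sub0r sqnN !sqnM sqn_cexp mulr1 /sqn /=; ring.
have momxt t q : (t < 3)%N -> (0 < q)%N -> innerG ell u1 (xmode lb lt t q) = (d (q.-1 * 3 + t)%N)%:C.
  by move=> t3 q0; rewrite -hu1 xphiE // prednK.
(* Indices with a nonzero coefficient are multiples of 3, so the type 1 and type 2 waves have zero
   moment. *)
have mom0 t q : (0 < t < 3)%N -> (0 < q)%N -> control_ip omega 0 T h (wave lb lt t q) = 0.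
  move=> /andP[t0' t3] q0; apply: sqn_eq0; rewrite mom_sqn momxt // d0 ?sqn0 // => j.
  apply/eqP => /(congr1 (fun k => k %% 3)%N); rewrite modnMl modnMDl modn_small // => e.
  by rewrite -e in t0'.
have [K K0 hK] := quasi_mode_small hb ht T ho ho1 ho3.
set N := Re (control_ip omega 0 T h h).
have N0 : 0 <= N by exact: ip_ge0 HK _ hL.
(* Cauchy-Schwarz between the control and the quasi-mode of rank [j], after division by
   [(1 / 64) ^+ j]. *)
have main j : lb * 16 ^+ j <= N * K * c0 ^+ 2.
  have [p0 q0 hC] := hpq j; set p := (pq j).1 in p0 hC; set q := (pq j).2 in q0 hC.
  have Cal : C j <= al by apply: le_trans (Cc j) _; rewrite /c0; lra.
  have small := hK p q (C j) q0 (ltW (C0 j)) Cal hC.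
  have wL t m : L2s (leb \x leb)%E (fun j => oo 0 T `*` omega j) (wave lb lt t m) by exact: wave_L2.
  have QL : L2s (leb \x leb)%E (fun j => oo 0 T `*` omega j) (quasi_mode lb lt p q).
    apply: (domD HK); last by apply: (domZ HK); exact: wL.
    by apply: (domB HK); apply: (domZ HK); exact: wL.
  have cs := cauchy_schwarz HK hL QL.
  have ipQ : control_ip omega 0 T h (quasi_mode lb lt p q) =
      - conjc (Num.sqrt lb)%:C * control_ip omega 0 T h (wave lb lt 0 q).
    have -> : quasi_mode lb lt p q = (Num.sqrt (lb + lt))%:C *: wave lb lt 2 (p + q) +
      (- (Num.sqrt lb)%:C) *: wave lb lt 0 q + ((-1) ^+ (p + q) * Num.sqrt lt)%:C *: wave lb lt 1 p.
      by rewrite scaleNr.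
    have ZL c t m := domZ HK c (wL t m).
    have Z c t m : control_ip omega 0 T h (c *: wave lb lt t m) = conjc c * control_ip omega 0 T h (wave lb lt t m).
      exact: (ipZr HK).
    rewrite (ipDr HK (domD HK (ZL _ _ _) (ZL _ _ _)) (ZL _ _ _) hL) (ipDr HK (ZL _ _ _) (ZL _ _ _) hL) !Z.
    by rewrite [control_ip _ _ _ _ (wave _ _ 2 _)]mom0 ?addn_gt0 ?p0 // [control_ip _ _ _ _ (wave _ _ 1 _)]mom0 // !mulr0 add0r addr0 conjcN.
  have := le_trans cs (ler_wpM2l N0 small).
  rewrite ipQ sqnM sqnN sqn_conjc mom_sqn momxt // addn0.
  have -> : sqn (Num.sqrt lb)%:C = lb by rewrite /sqn /= expr0n addr0 sqr_sqrtr // ltW.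
  have -> : sqn (d (q.-1 * 3)%N)%:C = d (q.-1 * 3)%N ^+ 2 by rewrite /sqn /= expr0n addr0.
  move=> hle.
  have : lb * ((1 / 2) ^+ j) ^+ 2 <= N * (K * C j ^+ 2).
    have a0 : 0 <= (1 / 2 : R) ^+ j by apply: exprn_ge0; lra.
    have a1 : (1 / 2 : R) ^+ j <= d (q.-1 * 3)%N := d1 j.
    apply: le_trans hle; rewrite ler_pM2l //; apply: lerXn2r => //; rewrite nnegrE //.
    exact: le_trans a0 a1.
  have e1' : ((1 / 2 : R) ^+ j) ^+ 2 = 16 ^+ j * (1 / 64) ^+ j.
    by rewrite exprAC -exprMn; congr (_ ^+ _); field.
  have e2' : C j ^+ 2 = c0 ^+ 2 * (1 / 64) ^+ j.
    by rewrite /C exprMn exprAC; congr (_ * _ ^+ _); field.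
  have ep : 0 < (1 / 64 : R) ^+ j by apply: exprn_gt0; lra.
  rewrite e1' e2' => e3; rewrite -(ler_pM2r ep); apply: le_trans (le_trans e3 _); by rewrite !mulrA.
pose X := N * K * c0 ^+ 2 / lb.
have X0 : 0 <= X by rewrite divr_ge0 ?(ltW hb) // mulr_ge0 ?sqr_ge0 // mulr_ge0.
have := archi_boundP X0; set j := Num.bound X => hj.
have := main j; rewrite mulrC -ler_pdivlMr // -/X leNgt => /negP; apply.
apply: (lt_le_trans hj); rewrite -[16 ^+ j]natrX ler_nat ltnW //; exact: ltn_expl.
Qed.
End Necessity.

(** * The spectral gap for badly approximable ratios *)

Section SeparatedPoints.
Context {R : realType}.

(** Telescoping comparison of the inverse square of [a + 1] with [a^-1 - (a + 1)^-1]. The term of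
    index 0 is zero, since the inverse of 0 is 0. *)
Lemma sum_inv_sqr (M : nat) : \sum_(d < M) (d%:R ^+ 2 : R)^-1 <= 2.
Proof.
have key m : \sum_(d < m.+2) (d%:R ^+ 2 : R)^-1 <= 2 - m.+1%:R^-1.
  elim: m => [|m IH].
    by rewrite !big_ord_recr big_ord0 /= expr0n expr1n invr0 invr1 !add0r; lra.
  rewrite big_ord_recr /=; apply: (le_trans (lerD IH (lexx _))).
  have a0 : (0 : R) < m.+1%:R by rewrite ltr0n.
  have -> : m.+2%:R = m.+1%:R + 1 :> R by rewrite natr1.
  set a := m.+1%:R in a0 *.
  have b0 : 0 < a + 1 by lra.
  rewrite -subr_ge0.
  have -> : 2 - (a + 1)^-1 - (2 - a^-1 + ((a + 1) ^+ 2)^-1) = (a * (a + 1) ^+ 2)^-1.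
    by field; rewrite !gt_eqF.
  by rewrite invr_ge0 mulr_ge0 ?sqr_ge0 // ltW.
apply: (le_trans (@sum_ord_mono R (fun d => (d%:R ^+ 2)^-1) M M.+2 _ _)).
- by move=> d; rewrite invr_ge0 sqr_ge0.
- by rewrite -addn2 leq_addr.
- by apply: (le_trans (key M)); rewrite lerBlDr lerDl invr_ge0 ler0n.
Qed.

(** Truncation to an integer is injective on points at mutual distance at least 1, so the sum is
    compared with that of the inverse squares of distinct integers. *)
Lemma separated_sum_pos n (x : nat -> R) (P : pred nat) : (forall j, P j -> 1 <= x j) ->
  (forall i j, P i -> P j -> i != j -> 1 <= `|x i - x j|) ->
  \sum_(j < n | P j) (x j ^+ 2)^-1 <= 2.
Proof.
move=> x1 sep; pose f j := Num.truncn (x j).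
have fx j : P j -> [/\ (0 < f j)%N, (f j)%:R <= x j & x j < (f j)%:R + 1].
  move=> Pj; have xj := x1 j Pj; have x0 : 0 <= x j by lra.
  have /andP[h1 h2] := truncn_itv x0; split=> //; last by rewrite natr1.
  by rewrite /f truncn_gt0.
pose M := (\max_(j < n) f j).+1.
have fM (j : 'I_n) : (f j < M)%N by rewrite ltnS (@leq_bigmax _ (fun j : 'I_n => f j)).
apply: (@le_trans _ _ (\sum_(j < n | P j) \sum_(d < M) ((f j == d)%:R * (d%:R ^+ 2)^-1 : R))).
  apply: ler_sum => j Pj; have [f0 fl _] := fx j Pj.
  have f0R : (0 : R) < (f j)%:R by rewrite ltr0n.
  rewrite (bigD1 (Ordinal (fM j))) //= eqxx mul1r.
  apply: (@le_trans _ _ ((f j)%:R ^+ 2)^-1).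
    by rewrite lef_pV2 ?posrE ?exprn_gt0 // ?(lt_le_trans f0R) // lerXn2r ?nnegrE ?(ltW f0R) // (le_trans (ltW f0R)).
  rewrite lerDl; apply: sumr_ge0 => d _; apply: mulr_ge0; first exact: ler0n.
  by rewrite invr_ge0 sqr_ge0.
rewrite exchange_big /=; apply: le_trans (sum_inv_sqr M).
apply: ler_sum => d _; rewrite -mulr_suml; apply: ler_piMl; first by rewrite invr_ge0 sqr_ge0.
rewrite -natr_sum -[leRHS](mulr1n 1) ler_nat -big_mkcondr /= sum1_card.
apply/card_le1_eqP => i j /andP[Pi /eqP fi] /andP[Pj /eqP fj].
apply/eqP; apply: contraT => ij; have := sep j i Pj Pi ij.
have [_ i1 i2] := fx i Pi; have [_ j1 j2] := fx j Pj.
rewrite fi in i1 i2; rewrite fj in j1 j2.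
by rewrite leNgt => /negP[]; rewrite ltr_norml; apply/andP; split; lra.
Qed.

(** After rescaling by [g], the points on the right of [lam k] and those on its left contribute at
    most 2 each. *)
Lemma separated_sum (lam : nat -> R) (g : R) n k : 0 < g ->
  (forall i j, i != j -> g <= `|lam i - lam j|) ->
  \sum_(j < n | (j : nat) != k) ((lam j - lam k) ^+ 2)^-1 <= 4 / g ^+ 2.
Proof.
move=> g0 sep; pose x j := (lam j - lam k) / g.
have xsep i j : i != j -> 1 <= `|x i - x j|.
  move=> ij; have -> : x i - x j = (lam i - lam j) / g by rewrite /x; ring.
  by rewrite normrM normfV (ger0_norm (ltW g0)) ler_pdivlMr // mul1r sep.
have x1 j : j != k -> 1 <= `|x j|.
  by move=> jk; rewrite /x normrM normfV (ger0_norm (ltW g0)) ler_pdivlMr // mul1r sep.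
have e j : ((lam j - lam k) ^+ 2)^-1 = (x j ^+ 2)^-1 / g ^+ 2.
  by rewrite /x expr_div_n invf_div mulrAC mulfV ?mul1r // expf_neq0 // gt_eqF.
under eq_bigr do rewrite e.
rewrite -mulr_suml ler_pM2r ?invr_gt0 ?exprn_gt0 //.
rewrite (bigID (fun j : 'I_n => 0 < x j)) /=.
have -> : 4 = 2 + 2 :> R by lra.
apply: lerD.
  apply: (@separated_sum_pos n x (fun j => (j != k) && (0 < x j))).
    by move=> j /andP[jk xj]; have := x1 j jk; rewrite gtr0_norm.
  by move=> i j _ _; exact: xsep.
have := @separated_sum_pos n (fun j => - x j) (fun j => (j != k) && ~~ (0 < x j)).
have -> : \sum_(j < n | ((j : nat) != k) && ~~ (0 < x j)) ((- x j) ^+ 2)^-1 =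
  \sum_(j < n | ((j : nat) != k) && ~~ (0 < x j)) (x j ^+ 2)^-1.
  by apply: eq_bigr => j _; rewrite sqrrN.
apply.
  by move=> j /andP[jk]; rewrite -leNgt => xj; have := x1 j jk; rewrite ler0_norm.
by move=> i j _ _ ij; rewrite -opprD normrN; exact: xsep.
Qed.
End SeparatedPoints.

Section SpectralGap.
Context {R : realType}.
Variables (lb lt : R).
Hypotheses (hb : 0 < lb) (ht : 0 < lt).
Local Notation al := (lt / lb).

(** The factor [k] lost in the difference of frequencies is regained in their sum: this is where the
    exponent 2 of bad approximability matches the quadratic dispersion. *)
Lemma gap_of_factors (P Q k a b : R) : 0 < k -> 0 <= Q -> 0 <= P -> 0 <= a -> 0 <= b ->
  P / k <= `|a - b| -> Q * k <= a + b -> P * Q <= `|a ^+ 2 - b ^+ 2|.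
Proof.
move=> k0 Q0 P0 a0 b0 h1 h2; rewrite subr_sqr normrM (ger0_norm (addr_ge0 a0 b0)).
have -> : P * Q = P / k * (Q * k) by field; rewrite gt_eqF.
by apply: ler_pM => //; [rewrite divr_ge0 // ltW | rewrite mulr_ge0 // ltW].
Qed.

Definition family_gap (t t' : nat) (g : R) : Prop :=
  forall m m', (0 < m)%N -> (0 < m')%N -> (t != t') || (m != m') ->
  g <= `|xfreq lb lt t m ^+ 2 - xfreq lb lt t' m' ^+ 2|.

Lemma family_gapC t t' g : family_gap t t' g -> family_gap t' t g.
Proof. by move=> h m m' m0 m0' d; rewrite distrC; apply: h => //; rewrite eq_sym [m' == m]eq_sym. Qed.

Lemma xfreq_ge0 t m : 0 <= xfreq lb lt t m.
Proof. by apply: divr_ge0; [rewrite mulr_ge0 ?ler0n ?pi_ge0 | exact: ltW (xlen_gt0 hb ht t)]. Qed.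

Lemma same_gap t : family_gap t t ((pi / xlen lb lt t) * (pi / xlen lb lt t)).
Proof.
move=> m m' m0 m0'; rewrite eqxx /= => mm; have l0 := xlen_gt0 hb ht t.
have p0 : 0 <= pi / xlen lb lt t by rewrite divr_ge0 ?pi_ge0 // ltW.
apply: (gap_of_factors (k := 1)); rewrite ?xfreq_ge0 //.
  rewrite divr1 /xfreq -mulrBl -mulrBl -mulrA normrM (ger0_norm p0) ler_peMl //.
  have -> : m%:R - m'%:R = (m%:Z - m'%:Z)%:~R :> R by rewrite intrB.
  rewrite -intr_norm -[1]/(1%:~R) ler_int -gtz0_ge1 normr_gt0 subr_eq0.
  by rewrite eqz_nat.
rewrite mulr1; apply: (@le_trans _ _ (xfreq lb lt t m)); last by rewrite lerDl xfreq_ge0.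
by rewrite /xfreq -mulrA ler_peMl // ler1n.
Qed.

Hypothesis ba : badly_approximable al.

Lemma badly_approximable_mult : exists2 C : R, 0 < C & forall (p : int) (q : nat), (0 < q)%N ->
  C / q%:R <= `|q%:R * al - p%:~R|.
Proof.
have [C C0 hC] := ba; exists C => // p q q0; have := hC p q q0.
have qR : (0 : R) < q%:R by rewrite ltr0n.
have -> : q%:R * al - p%:~R = q%:R * (al - p%:~R / q%:R) by field; rewrite !gt_eqF.
rewrite normrM (ger0_norm (ltW qR)) => h.
have -> : C / q%:R = q%:R * (C / q%:R ^+ 2) by field; rewrite gt_eqF.
by rewrite ler_pM2l.
Qed.

(** The difference of frequencies is [pi / lt * (k * al - m)], with [k] itself as the denominator of
    the approximation. *)
Lemma gap01 : exists2 g, 0 < g & family_gap 0 1 g.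
Proof.
have [C C0 hC] := badly_approximable_mult; have p0 := pi_gt0 R.
exists ((pi / lt * C) * (pi / lb)); first by rewrite !(mulr_gt0, invr_gt0).
have w1 : 0 < pi / lt by rewrite divr_gt0.
move=> k m k0 m0 _; have kR : (0 : R) < k%:R by rewrite ltr0n.
apply: (gap_of_factors (k := k%:R)); rewrite ?xfreq_ge0 //.
- by rewrite divr_ge0 // ltW.
- by rewrite !mulr_ge0 ?invr_ge0 // ltW.
- have -> : xfreq lb lt 0 k - xfreq lb lt 1 m = pi / lt * (k%:R * al - m%:~R).
    by rewrite /xfreq /=; field; rewrite !gt_eqF.
  by rewrite normrM (ger0_norm (ltW w1)) -[leLHS]mulrA ler_pM2l // hC.
- have -> : pi / lb * k%:R = xfreq lb lt 0 k by rewrite /xfreq /=; ring.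
  by rewrite lerDl xfreq_ge0.
Qed.

(** The difference of frequencies is a multiple of [k * al - (n - k)]; the numerator [n - k] may be
    negative, which [badly_approximable] allows. *)
Lemma gap02 : exists2 g, 0 < g & family_gap 0 2 g.
Proof.
have [C C0 hC] := badly_approximable_mult; have p0 := pi_gt0 R.
have l0 : 0 < lb + lt by rewrite addr_gt0.
exists ((pi / (lb + lt) * C) * (pi / lb)); first by rewrite !(mulr_gt0, invr_gt0).
have w1 : 0 < pi / (lb + lt) by rewrite divr_gt0.
move=> k n k0 n0 _; have kR : (0 : R) < k%:R by rewrite ltr0n.
apply: (gap_of_factors (k := k%:R)); rewrite ?xfreq_ge0 //.
- by rewrite divr_ge0 // ltW.
- by rewrite !mulr_ge0 ?invr_ge0 // ltW.
- have -> : xfreq lb lt 0 k - xfreq lb lt 2 n = pi / (lb + lt) * (k%:R * al - (n%:Z - k%:Z)%:~R).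
    by rewrite /xfreq /= intrB; field; rewrite !gt_eqF.
  by rewrite normrM (ger0_norm (ltW w1)) -[leLHS]mulrA ler_pM2l // hC.
- have -> : pi / lb * k%:R = xfreq lb lt 0 k by rewrite /xfreq /=; ring.
  by rewrite lerDl xfreq_ge0.
Qed.

(** The difference of frequencies is a multiple of [m - (n - m) * al]. For [m < n] the denominator
    of the approximation is [n - m], which the even frequency dominates. *)
Lemma gap12 : exists2 g, 0 < g & family_gap 1 2 g.
Proof.
have [C C0 hC] := badly_approximable_mult; have p0 := pi_gt0 R.
have l0 : 0 < lb + lt by rewrite addr_gt0.
have w0 : 0 < pi * lb / (lt * (lb + lt)) by rewrite !(mulr_gt0, invr_gt0).
pose g1 := (pi * lb / (lt * (lb + lt)) * C) * (pi / (lb + lt)).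
pose g2 := (pi * lb / (lt * (lb + lt)) * 1) * (pi / (lb + lt)).
have e m n : xfreq lb lt 1 m - xfreq lb lt 2 n =
    pi * lb / (lt * (lb + lt)) * (m%:R - (n%:R - m%:R) * al).
  by rewrite /xfreq /=; field; rewrite !gt_eqF.
have f2 n : xfreq lb lt 2 n = pi / (lb + lt) * n%:R by rewrite /xfreq /=; ring.
exists (Num.min g1 g2).
  by rewrite lt_min /g1 /g2; apply/andP; split; rewrite !(mulr_gt0, invr_gt0).
move=> m n m0 n0 _; have [mn|nm] := ltnP m n.
  have kR : (0 : R) < (n - m)%N%:R by rewrite ltr0n subn_gt0.
  apply: (@le_trans _ _ g1); first by rewrite ge_min lexx.
  apply: (gap_of_factors (k := (n - m)%N%:R)); rewrite ?xfreq_ge0 //.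
  - by rewrite divr_ge0 // ltW.
  - by rewrite mulr_ge0 // ltW.
  - rewrite e normrM ger0_norm ?(ltW w0) // -[leLHS]mulrA ler_pM2l // -natrB ?(ltnW mn) // distrC.
    by have := hC m%:Z (n - m)%N; rewrite subn_gt0; apply.
  - apply: (@le_trans _ _ (xfreq lb lt 2 n)); last by rewrite lerDr xfreq_ge0.
    by rewrite f2 ler_pM2l ?divr_gt0 // ler_nat leq_subr.
(* For [n <= m] both terms of [m + (m - n) * al] are nonnegative and the first is at least 1, so no
   arithmetic is involved. *)
have mR : (1 : R) <= m%:R by rewrite ler1n.
apply: (@le_trans _ _ g2); first by rewrite ge_min lexx orbT.
apply: (gap_of_factors (k := 1)); rewrite ?xfreq_ge0 //.
- by rewrite divr_ge0 // ltW.
- by rewrite mulr_ge0 // ltW.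
- rewrite divr1 e normrM ger0_norm ?(ltW w0) // ler_pM2l //.
  have al0 : 0 <= al by rewrite divr_ge0 // ltW.
  have nmR : 0 <= m%:R - n%:R :> R by rewrite subr_ge0 ler_nat.
  have h := mulr_ge0 nmR al0; apply: (le_trans _ (ler_norm _)).
  by rewrite (_ : m%:R - _ = m%:R + (m%:R - n%:R) * al); [lra | ring].
- have n1 : (1 : R) <= n%:R by rewrite ler1n.
  apply: (@le_trans _ _ (xfreq lb lt 2 n)); last by rewrite lerDr xfreq_ge0.
  by rewrite f2 ler_pM2l ?divr_gt0.
Qed.

Lemma family_gap_le t t' g g' : g' <= g -> family_gap t t' g -> family_gap t t' g'.
Proof. by move=> gg h m m' m0 m0' d; apply: (le_trans gg); exact: h. Qed.

Lemma spectral_gap : exists2 g, 0 < g & forall j k, j != k -> g <= `|xlam lb lt j - xlam lb lt k|.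
Proof.
have [g1 g10 h01] := gap01; have [g2 g20 h02] := gap02; have [g3 g30 h12] := gap12.
have s0 t : 0 < pi / xlen lb lt t by rewrite divr_gt0 ?pi_gt0 // xlen_gt0.
have s2 t := mulr_gt0 (s0 t) (s0 t).
have [g [g0 [a1 a2 a3] [b1 b2 b3]]] : exists g, [/\ 0 < g, [/\ g <= g1, g <= g2 & g <= g3] &
   [/\ g <= pi / xlen lb lt 0 * (pi / xlen lb lt 0), g <= pi / xlen lb lt 1 * (pi / xlen lb lt 1)
     & g <= pi / xlen lb lt 2 * (pi / xlen lb lt 2)]].
  exists (Num.min (Num.min g1 (Num.min g2 g3)) (Num.min (pi / xlen lb lt 0 * (pi / xlen lb lt 0))
    (Num.min (pi / xlen lb lt 1 * (pi / xlen lb lt 1)) (pi / xlen lb lt 2 * (pi / xlen lb lt 2))))).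
  by split; [rewrite !lt_min g10 g20 g30 !s2 | split; rewrite !ge_min !lexx ?orbT | split; rewrite !ge_min !lexx ?orbT].
exists g => // j k jk.
have dist : ((j %% 3)%N != (k %% 3)%N) || ((j %/ 3).+1 != (k %/ 3).+1).
  rewrite -negb_and; apply: contra jk => /andP[/eqP e1]; rewrite eqSS => /eqP e2.
  by apply/eqP; rewrite (divn_eq j 3) (divn_eq k 3) e1 e2.
have : family_gap (j %% 3) (k %% 3) g.
  have : (j %% 3 < 3)%N by rewrite ltn_mod.
  have : (k %% 3 < 3)%N by rewrite ltn_mod.
  have H t : (t < 3)%N -> family_gap t t g.
    case: t => [|[|[|//]]] _.
    - exact: (family_gap_le b1 (@same_gap 0)).
    - exact: (family_gap_le b2 (@same_gap 1)).
    - exact: (family_gap_le b3 (@same_gap 2)).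
  case: (j %% 3)%N => [|[|[|//]]]; case: (k %% 3)%N => [|[|[|//]]] // _ _; try exact: H.
  - exact: family_gap_le a1 h01.
  - exact: family_gap_le a2 h02.
  - exact: family_gap_le a1 (family_gapC h01).
  - exact: family_gap_le a3 h12.
  - exact: family_gap_le a2 (family_gapC h02).
  - exact: family_gap_le a3 (family_gapC h12).
by apply.
Qed.
End SpectralGap.

(** * Sufficiency: damped waves and the moment problem *)

Section RintegralSubset.
Context d (X : measurableType d) (R : realType) (mu : {measure set X -> \bar R}).

Lemma le_Rintegral_subset (A B : set X) (f : X -> R) : measurable A -> measurable B -> A `<=` B ->
  integrableR mu B f -> (forall x, B x -> 0 <= f x) ->
  \int[mu]_(x in A) f x <= \int[mu]_(x in B) f x.
Proof.
move=> mA mB AB fi f0; have fA : integrableR mu A f by exact: integrableS fi.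
apply: fine_le; try exact: integral_fune_fin_num.
apply: ge0_subset_integral => //; first by case/integrableP: fi.
Qed.
End RintegralSubset.

Section Weight.
Context {R : realType}.
Local Notation leb := (@lebesgue_measure R).
Local Notation mR := (measurableTypeR R).
Local Notation oo a b := (`]a, b[%classic : set R).

(** Two integrations by parts, packed into the explicit antiderivative [F]. The squared sine
    vanishes to second order at both ends, so no boundary term appears and a factor [t ^- 2] is
    gained. [A] and [B] stand for a sine and cosine pair, in either order up to sign. *)
Lemma weighted_integral_decay (T t : R) (A B : R -> R) : 0 < T -> t != 0 ->
  (forall s, is_derive s (1 : R) A (t * B s)) -> (forall s, is_derive s (1 : R) B (- (t * A s))) ->
  (forall s, `|B s| <= 1) ->
  `|\int[leb]_(s in oo 0 T) (sin (pi / T * s) ^+ 2 * B s)| <= 2 * pi ^+ 2 / (T * t ^+ 2).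
Proof.
move=> T0 t0 dA dB B1; pose w : R := pi / T.
pose p s : R := sin (w * s); pose q s : R := cos (w * s).
pose F s := t^-1 * (p s * p s * A s) + (t ^+ 2)^-1 * (2 * w * (p s * q s * B s)).
pose r2 s := 2 * w ^+ 2 * (q s * q s - p s * p s).
have dp s : is_derive s (1 : R) p (w * q s) by exact: is_derive_sin_la.
have dq s : is_derive s (1 : R) q (- (w * p s)) by exact: is_derive_cos_la.
pose f s := p s * p s * B s + (t ^+ 2)^-1 * (r2 s * B s).
have dF s : is_derive s (1 : R) F (f s).
  have h1 := is_deriveZ t^-1 (is_deriveM (is_deriveM (dp s) (dp s)) (dA s)).
  have h2 := is_deriveZ (t ^+ 2)^-1 (is_deriveZ (2 * w) (is_deriveM (is_deriveM (dp s) (dq s)) (dB s))).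
  have h := is_deriveD h1 h2; apply: (is_derive_eq h); rewrite /f /r2 /GRing.scale /=.
  have -> : (p * p) s = p s * p s by []. have -> : (p * q) s = p s * q s by []. by field.
have cp := is_derive_continuous dp; have cq := is_derive_continuous dq; have cB := is_derive_continuous dB.
have c1 : continuous (fun s => p s * p s * B s).
  by move=> s; apply: cvgM; [apply: cvgM; exact: cp | exact: cB].
have c2 : continuous (fun s => r2 s * B s).
  move=> s; apply: cvgM; last exact: cB.
  apply: cvgM; first exact: cvg_cst.
  by apply: cvgB; apply: cvgM; [exact: cq | exact: cq | exact: cp | exact: cp].
have c3 : continuous f.
  by move=> s; apply: cvgD; [exact: c1 | apply: cvgM; [exact: cvg_cst | exact: c2]].
have mD := @mleb R (`]0, T[).
have i1 := continuous_integrableR 0 T c1; have i2 := continuous_integrableR 0 T c2.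
have FTC := Rintegral_FTC (ltW T0) dF c3.
have F0 : F 0 = 0 by rewrite /F /p mulr0 sin0 !mul0r !mulr0 addr0.
have FT : F T = 0.
  by rewrite /F /p /w divfK ?gt_eqF // sinpi !mul0r !mulr0 addr0.
have e : \int[leb]_(s in oo 0 T) (p s * p s * B s) = - ((t ^+ 2)^-1 * \int[leb]_(s in oo 0 T) (r2 s * B s)).
  apply/eqP; rewrite -subr_eq0 opprK; apply/eqP; rewrite -RintegralZl // -RintegralD //.
    by rewrite FT F0 subrr in FTC; exact: FTC.
  exact: integrableRZ.
have -> : \int[leb]_(s in oo 0 T) (sin (pi / T * s) ^+ 2 * B s) = \int[leb]_(s in oo 0 T) (p s * p s * B s).
  by apply: eq_Rintegral => s _; rewrite expr2.
rewrite e normrN normrM ger0_norm ?invr_ge0 ?sqr_ge0 //.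
have bd : `|\int[leb]_(s in oo 0 T) (r2 s * B s)| <= 2 * w ^+ 2 * T.
  have := Rintegral_bound mD (B := 2 * w ^+ 2) (leb_oo_lt 0 T) i2.
  have -> : fine (leb (oo 0 T)) = T by rewrite fine_leb_oo ?subr0 // ltW.
  apply=> s _.
  have cs : q s * q s - p s * p s = cos (w * s *+ 2).
    by rewrite cos_mulr2n /q /p -!expr2 sin2cos2; rewrite mulr2n; ring.
  have W2 : 0 <= 2 * w ^+ 2 by apply: mulr_ge0 => //; exact: sqr_ge0.
  rewrite normrM -[leRHS]mulr1; apply: ler_pM => //.
  by rewrite /r2 cs normrM (ger0_norm W2) ler_piMr //; exact: cos_max.
apply: (@le_trans _ _ ((t ^+ 2)^-1 * (2 * w ^+ 2 * T))); first by rewrite ler_wpM2l // invr_ge0 sqr_ge0.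
by rewrite le_eqVlt; apply/orP; left; apply/eqP; rewrite /w; field; rewrite t0 gt_eqF.
Qed.

(** The Fourier transform of the squared cutoff on the time interval: the time factor of the Gram
    matrix of the damped waves. *)
Definition weight_hat (T t : R) : R[i] :=
  cintegral leb (oo 0 T) (fun s => (sin (pi / T * s) ^+ 2)%:C * cexp t s).

Lemma weight_hat0 T : 0 < T -> weight_hat T 0 = (T / 2)%:C.
Proof.
move=> T0; have w0 : - (pi / T) != 0 :> R by rewrite oppr_eq0 gt_eqF // divr_gt0 ?pi_gt0.
have := Rintegral_sin_sqr 0 w0 (ltW T0).
have -> : sin (2 * - (pi / T) * (0 - T)) = 0 :> R.
  have -> : 2 * - (pi / T) * (0 - T) = pi *+ 2 by rewrite mulr2n; field; rewrite gt_eqF.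
  exact: sin2pi.
have -> : sin (2 * - (pi / T) * (0 - 0)) = 0 :> R by rewrite subrr mulr0 sin0.
rewrite !subr0 mul0r addr0 => e.
apply: complex_eqP; rewrite ?Re_cintegral ?Im_cintegral.
  rewrite -[RHS]e; apply: eq_Rintegral => s _.
  by rewrite ReM /= mul0r cos0 opprK mulr0 addr0 mulr1 mul0r subr0.
transitivity (\int[leb]_(s in oo 0 T) (0 : R)); last by rewrite Rintegral_cst ?mleb // mul0r.
by apply: eq_Rintegral => s _; rewrite ImM /= !mul0r sin0 mulr0 addr0.
Qed.

Lemma weight_hat_decay T t : 0 < T -> t != 0 ->
  Normc.normc (weight_hat T t) <= 4 * pi ^+ 2 / (T * t ^+ 2).
Proof.
move=> T0 t0; set a := 2 * pi ^+ 2 / (T * t ^+ 2).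
have a0 : 0 <= a.
  by apply: divr_ge0; apply: mulr_ge0; rewrite ?sqr_ge0 ?(ltW T0).
have hR : `|Re (weight_hat T t)| <= a.
  rewrite Re_cintegral.
  have -> : \int[leb]_(s in oo 0 T) Re ((sin (pi / T * s) ^+ 2)%:C * cexp t s) =
      \int[leb]_(s in oo 0 T) (sin (pi / T * s) ^+ 2 * cos (t * s)).
    by apply: eq_Rintegral => s _; rewrite ReM /= mul0r subr0.
  apply: (weighted_integral_decay T0 t0 (A := fun s => sin (t * s))) => s.
  - exact: is_derive_sin_la.
  - exact: is_derive_cos_la.
  - exact: cos_max.
have hI : `|Im (weight_hat T t)| <= a.
  rewrite Im_cintegral.
  have -> : \int[leb]_(s in oo 0 T) Im ((sin (pi / T * s) ^+ 2)%:C * cexp t s) =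
      \int[leb]_(s in oo 0 T) (sin (pi / T * s) ^+ 2 * sin (t * s)).
    by apply: eq_Rintegral => s _; rewrite ImM /= mul0r addr0.
  apply: (weighted_integral_decay T0 t0 (A := fun s => - cos (t * s))) => s.
  - have h := is_deriveN (is_derive_cos_la t s); apply: (is_derive_eq h).
    by rewrite opprK.
  - by rewrite mulrN opprK; exact: is_derive_sin_la.
  - exact: sin_max.
have -> : 4 * pi ^+ 2 / (T * t ^+ 2) = 2 * a by rewrite /a; ring.
have h1 := sqr_le_norm (le_trans hR (ler_norm a)); have h2 := sqr_le_norm (le_trans hI (ler_norm a)).
have h : Normc.normc (weight_hat T t) ^+ 2 <= (2 * a) ^+ 2.
  rewrite normc_sqn /sqn; have -> : (2 * a) ^+ 2 = 4 * a ^+ 2 by ring.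
  by have := sqr_ge0 a; lra.
have n0 := normc_ge0 (weight_hat T t); rewrite leNgt; apply/negP => lt2.
by have := ltrXn2r 2 (mulr_ge0 (ler0n R 2) a0) lt2; rewrite ltNge h.
Qed.
End Weight.

Section SineLowerBound.
Context {R : realType}.
Local Notation leb := (@lebesgue_measure R).
Local Notation mR := (measurableTypeR R).
Local Notation oo a b := (`]a, b[%classic : set R).

(** For [z >= 2] the bound 1 on the sine suffices. For smaller [z], write
    [sin z = 2 * cos (z / 2) * sin (z / 2)], where the cosine stays below [cos y < 1] away from
    0. *)
Lemma sin_deficit (z0 : R) : 0 < z0 -> exists2 k : R, 0 < k & forall z, z0 <= z ->
  `|sin z| <= (1 - k) * z.
Proof.
move=> z00; pose y : R := Num.min (z0 / 2) 1.
have y0 : 0 < y by rewrite lt_min ltr01 andbT divr_gt0.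
have y1 : y <= 1 by rewrite ge_min lexx orbT.
have pi2 : 2 <= pi :> R := pi_ge2 R.
have cy : cos y < 1.
  by rewrite -cos0 ltr_cos // in_itv /=; apply/andP; split; lra.
exists (Num.min (1 / 2) (1 - cos y)); first by rewrite lt_min; apply/andP; split; lra.
move=> z hz; set k := Num.min _ _.
have k1 : k <= 1 / 2 by rewrite /k ge_min lexx.
have k2 : k <= 1 - cos y by rewrite /k ge_min lexx orbT.
have [z2|z2] := leP 2 z.
  apply: (le_trans (sin_max z)).
  have : 1 / 2 * z <= (1 - k) * z by rewrite ler_wpM2r; lra.
  lra.
have yz : y <= z / 2 by rewrite /y ge_min ler_wpM2r ?invr_ge0.
have cz : cos (z / 2) <= cos y.
  by rewrite leNgt ltr_cos ?in_itv /= -?leNgt //; apply/andP; split; lra.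
have cz0 : 0 <= cos (z / 2).
  by apply: cos_ge0_pihalf; apply/andP; split; lra.
have sz : `|sin (z / 2)| <= z / 2.
  have := sin_lipschitz (z / 2) 0; rewrite sin0 !subr0 => h; apply: (le_trans h).
  by rewrite ger0_norm //; lra.
have -> : sin z = 2 * cos (z / 2) * sin (z / 2).
  have {1}-> : z = z / 2 *+ 2 by rewrite mulr2n; lra.
  by rewrite sin_mulr2n mulr2n; ring.
rewrite normrM ger0_norm ?mulr_ge0 //.
apply: (@le_trans _ _ (2 * cos (z / 2) * (z / 2))); first by rewrite ler_wpM2l // mulr_ge0.
have -> : 2 * cos (z / 2) * (z / 2) = cos (z / 2) * z by field.
by rewrite ler_wpM2r; lra.
Qed.

(** On an interval of radius [e] inside [U] the integral is [e] minus [cos m * sin z / (2 * nu)]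
    with [z = 2 * nu * e]. As [nu] stays above [nu0], [sin_deficit] keeps that term below a fixed
    fraction of [e]. *)
Lemma open_sine_lower (U : set R) (L nu0 : R) : open U -> U `<=` oo 0 L -> U !=set0 -> 0 < nu0 ->
  exists2 c : R, 0 < c & forall nu, nu0 <= nu ->
    c <= \int[leb]_(x in U) (sin (- nu * x + nu * L) ^+ 2).
Proof.
move=> oU UL [x0 Ux0] nu00.
have [e /= e0 he] : exists2 e : R, 0 < e & ball x0 e `<=` U.
  by have /nbhs_ballP[e e0 h] := open_nbhs_nbhs (conj oU Ux0); exists e.
have IU : oo (x0 - e) (x0 + e) `<=` U.
  by move=> x /ooP/andP[h1 h2]; apply: he; rewrite /ball /= distrC ltr_norml; apply/andP; split; lra.
have mU : measurable (U : set mR) by exact: open_measurable.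
have [k k0 hk] := sin_deficit (mulr_gt0 nu00 (mulr_gt0 (ltr0Sn R 1) e0)).
exists (e * k); first exact: mulr_gt0.
move=> nu hnu; have nup : 0 < nu by apply: lt_le_trans hnu.
have ab : x0 - e <= x0 + e by lra.
have cS : continuous (fun x => sin (- nu * x + nu * L) ^+ 2).
  have -> : (fun x => sin (- nu * x + nu * L) ^+ 2) =
      (fun x => sin (- nu * x + nu * L) * sin (- nu * x + nu * L)).
    by apply/funext => x; rewrite expr2.
  by move=> x; apply: cvgM; exact: continuous_sin_affine.
have iU : integrableR leb U (fun x => sin (- nu * x + nu * L) ^+ 2).
  by apply: integrableS (continuous_integrableR 0 L cS) => //; exact: mleb.
apply: le_trans (le_Rintegral_subset (mleb `]x0 - e, x0 + e[) mU IU iU _); last first.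
  by move=> x _; exact: sqr_ge0.
rewrite (Rintegral_sin_sqr L (lt0r_neq0 nup) ab).
set z := nu * (2 * e); have hz : nu0 * (2 * e) <= z by rewrite ler_wpM2r // mulr_ge0 // ltW.
have sz := hk z hz.
set m := nu * (2 * (L - x0)).
have -> : 2 * nu * (L - (x0 + e)) = m - z by rewrite /m /z; ring.
have -> : 2 * nu * (L - (x0 - e)) = m + z by rewrite /m /z; ring.
have -> : sin (m - z) - sin (m + z) = - (2 * cos m * sin z) by rewrite sinB sinD; ring.
have h : `|cos m * sin z| <= (1 - k) * z.
  by rewrite normrM; apply: le_trans sz; rewrite ler_piMl // cos_max.
have hz2 : z / (2 * nu) = e by rewrite /z; field; rewrite gt_eqF.
have -> : (x0 + e - (x0 - e)) / 2 + - (2 * cos m * sin z) / (4 * nu) = e - cos m * sin z / (2 * nu).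
  by field; rewrite gt_eqF.
have : cos m * sin z / (2 * nu) <= (1 - k) * e.
  rewrite -hz2 mulrA ler_wpM2r ?invr_ge0 ?mulr_ge0 ?(ltW nup) //.
  exact: le_trans (ler_norm _) h.
lra.
Qed.
End SineLowerBound.

Section Monotone.
Context d (X : measurableType d) (R : realType) (mu : {measure set X -> \bar R}).

Lemma le_ips_subset n (E F : 'I_n -> set X) (f : 'I_n -> X -> R[i]) :
  (forall j, measurable (E j)) -> (forall j, measurable (F j)) -> (forall j, E j `<=` F j) ->
  L2s mu F f -> Re (ips mu E f f) <= Re (ips mu F f f).
Proof.
move=> mE mF EF fL; rewrite !Re_sum; apply: ler_sum => j _.
rewrite !Re_cintegral; apply: le_Rintegral_subset => //.
  have [_ _] := fL j; apply: (eq_integrable (mF j)) => z _ /=.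
  by rewrite Re_mulc_conj normc_sqn.
by move=> x _; rewrite Re_mulc_conj sqn_ge0.
Qed.
End Monotone.

Section TensorProduct.
Context {R : realType} {n : nat}.
Local Notation leb := (@lebesgue_measure R).
Local Notation mR := (measurableTypeR R).
Local Notation oo a b := (`]a, b[%classic : set R).
Variables (ell : 'I_n -> R) (omega : 'I_n -> set R).
Hypothesis ho : open_subset ell omega.

Definition omega_ip := ips leb omega.

Lemma omega_hilbert : hilbert_form (L2s leb omega) omega_ip.
Proof. exact: (@L2s_hilbert _ mR _ _ n _ (omega_meas ho)). Qed.

Lemma L2G_omega f : L2G ell f -> L2s leb omega f.
Proof. by move=> fL j; apply: L2S (fL j); [exact: mleb | exact: omega_meas | exact: (ho j).2]. Qed.

Lemma le_omega_innerG f : L2G ell f -> Re (omega_ip f f) <= Re (innerG ell f f).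
Proof.
move=> fL; exact: (@le_ips_subset _ mR R leb n omega (fun j => oo 0 (ell j)) f
  (omega_meas ho) (fun j => mleb _) (fun j => (ho j).2) fL).
Qed.

Lemma cbounded_cintegrable r t (a : R -> R[i]) : @cbounded _ mR R (oo r t) a -> cintegrable leb (oo r t) a.
Proof.
move=> [m1 m2 [M hM]]; apply: (cintegrable_bounded (mleb _) (B := M)) => //; first exact: leb_oo_lt.
  by move=> x /hM [].
by move=> x /hM [].
Qed.

Lemma tensor_ip r t a b f g : @cbounded _ mR R (oo r t) a -> @cbounded _ mR R (oo r t) b ->
  L2G ell f -> L2G ell g ->
  control_ip omega r t (tensor a f) (tensor b g) =
  cintegral leb (oo r t) (fun s => a s * conjc (b s)) * omega_ip f g.
Proof.
move=> ba bb fL gL; rewrite /control_ip /omega_ip /ips mulr_sumr; apply: eq_bigr => j _.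
have abi : cintegrable leb (oo r t) (fun s => a s * conjc (b s)).
  apply: (cintegrable_bddM (mleb _) ba); apply: cbounded_cintegrable.
  exact: cbounded_conj.
have fgi := L2_mul_conj (omega_meas ho j) (L2G_omega fL j) (L2G_omega gL j).
rewrite -(cintegral_prod (mleb _) (omega_meas ho j) abi fgi).
by apply: eq_cintegral => z _; rewrite /tensor conjcM; ring.
Qed.
End TensorProduct.

Section ControlMoments.
Context {R : realType}.
Local Notation leb := (@lebesgue_measure R).
Local Notation mR := (measurableTypeR R).
Local Notation oo a b := (`]a, b[%classic : set R).
Variables (lb lt : R).
Hypotheses (hb : 0 < lb) (ht : 0 < lt).
Local Notation ell := (@X_length R lb lt).
Local Notation al := (lt / lb).
Variables (omega : 'I_4 -> set R).
Hypotheses (ho : open_subset ell omega).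
Hypotheses (ho0 : omega (inord 0) !=set0) (ho2 : omega (inord 2) !=set0).

Lemma xfreq_lower t m : (0 < m)%N -> pi / (lb + lt) <= xfreq lb lt t m.
Proof.
move=> m0; have l0 := xlen_gt0 hb ht t.
have lel : xlen lb lt t <= lb + lt.
  by move: t {l0} => [|[|t]] /=; rewrite ?lerDl ?lerDr ?(ltW hb) ?(ltW ht).
apply: (@le_trans _ _ (pi / xlen lb lt t)).
  by rewrite ler_pM2l ?pi_gt0 // lef_pV2 ?posrE // addr_gt0.
by rewrite /xfreq -mulrA ler_peMl ?ler1n // divr_ge0 ?pi_ge0 // ltW.
Qed.

Lemma mode_part j A nu : Re (cintegral leb (omega j) (fun x => mode ell A nu j x * conjc (mode ell A nu j x))) =
  A j ^+ 2 * \int[leb]_(x in omega j) (sin (- nu * x + nu * ell j) ^+ 2).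
Proof.
have cS : continuous (fun x : R => sin (- nu * x + nu * ell j) * sin (- nu * x + nu * ell j)).
  by move=> x; apply: cvgM; exact: continuous_sin_affine.
have i : integrableR leb (omega j) (fun x => sin (- nu * x + nu * ell j) ^+ 2).
  apply: (@integrableS _ _ _ leb (oo 0 (ell j))); [exact: mleb | exact: (omega_meas ho) | exact: (ho j).2 |].
  by apply: (eq_integrable (mleb _)) (continuous_integrableR 0 (ell j) cS) => x _ /=; rewrite expr2.
rewrite Re_cintegral -RintegralZl //; last exact: (omega_meas ho).
by apply: eq_Rintegral => x _; rewrite Re_mulc_conj /sqn /mode /mode_sin /= expr0n addr0 exprMn.
Qed.

(** Both open parts are used: type 1 modes are seen in [e_3], types 0 and 2 in [e_1]. There the sign
    has square 1 and the amplitude is at least that of the longest length [lb + lt]. *)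
Lemma omega_lower : exists2 c : R, 0 < c & forall k, c <= Re (omega_ip omega (xphi lb lt k) (xphi lb lt k)).
Proof.
have l0 : 0 < lb + lt by rewrite addr_gt0.
have nu0 : 0 < pi / (lb + lt) by rewrite divr_gt0 ?pi_gt0.
have lower j : omega j !=set0 -> exists2 c : R, 0 < c & forall nu, pi / (lb + lt) <= nu ->
    c <= \int[leb]_(x in omega j) (sin (- nu * x + nu * ell j) ^+ 2).
  by move=> oj; exact: (open_sine_lower (ho j).1 (ho j).2 oj nu0).
have [c0 c00 h0] := lower _ ho0; have [c2 c20 h2] := lower _ ho2.
have cl (c : R) : 0 < c -> 0 < c / (lb + lt) by move=> c1; rewrite divr_gt0.
exists (Num.min (c0 / (lb + lt)) (c2 / (lb + lt))); first by rewrite lt_min !cl.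
move=> k; rewrite /xphi /xmode; set t := (k %% 3)%N; set m := (k %/ 3).+1.
have hnu := xfreq_lower t (ltn0Sn (k %/ 3)); rewrite -/m in hnu.
have ge j : xamp lb lt t m j ^+ 2 * \int[leb]_(x in omega j) (sin (- xfreq lb lt t m * x + xfreq lb lt t m * ell j) ^+ 2)
    <= Re (omega_ip omega (mode ell (xamp lb lt t m) (xfreq lb lt t m)) (mode ell (xamp lb lt t m) (xfreq lb lt t m))).
  rewrite /omega_ip /ips Re_sum (bigD1 j) // mode_part lerDl; apply: sumr_ge0 => i _.
  by rewrite mode_part mulr_ge0 ?sqr_ge0 // Rintegral_ge0 // => x _; exact: sqr_ge0.
have amp (j : 'I_4) (c : R) : 0 < c -> xsign t m j ^+ 2 = 1 :> R ->
    c <= \int[leb]_(x in omega j) (sin (- xfreq lb lt t m * x + xfreq lb lt t m * ell j) ^+ 2) ->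
    c / (lb + lt) <= Re (omega_ip omega (mode ell (xamp lb lt t m) (xfreq lb lt t m)) (mode ell (xamp lb lt t m) (xfreq lb lt t m))).
  move=> c1 s1 hc; apply: le_trans (ge j).
  have xl := xlen_gt0 hb ht t.
  have lel : xlen lb lt t <= lb + lt.
    by move: (t) => [|[|t']] /=; rewrite ?lerDl ?lerDr ?(ltW hb) ?(ltW ht).
  have -> : xamp lb lt t m j ^+ 2 = (xlen lb lt t)^-1.
    by rewrite /xamp expr_div_n s1 xlen_sqr // mul1r.
  rewrite mulrC; apply: ler_pM => //; rewrite ?invr_ge0 ?(ltW l0) ?(ltW c1) //.
  by rewrite lef_pV2 ?posrE.
have t3 : (t < 3)%N by rewrite ltn_mod.
have [t1|t1] := eqVneq t 1%N.
  apply: (@le_trans _ _ (c2 / (lb + lt))); first by rewrite ge_min lexx orbT.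
  apply: amp (h2 _ hnu) => //.
  by rewrite t1 /xsign inordK //= expr1n.
apply: (@le_trans _ _ (c0 / (lb + lt))); first by rewrite ge_min lexx.
apply: amp (h0 _ hnu) => //.
by move: t1 t3; case: (t) => [|[|[|//]]] // _ _; rewrite /xsign inordK //= expr1n.
Qed.

(** A square root of the weight: each of the two waves in a Gram entry carries one factor. Being
    real, it can later be moved from the wave to the control. *)
Definition cutoff (T : R) (s : R) : R[i] := (sin (pi / T * s))%:C.

Definition damped_wave (T : R) (k : nat) : 'I_4 -> R * R -> R[i] :=
  tensor (fun s => cutoff T s * conjc (cexp (xlam lb lt k) s)) (xphi lb lt k).

Lemma cutoff_bounded T a b : @cbounded _ mR R (oo a b) (cutoff T).
Proof.
split.
- by apply: measurable_continuous; [exact: mleb | exact: continuous_sin_la].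
- by [].
- by exists 1 => x _; rewrite /= normr0; split => //; exact: sin_max.
Qed.

Lemma cboundedM r t (a b : R -> R[i]) : @cbounded _ mR R (oo r t) a -> @cbounded _ mR R (oo r t) b ->
  @cbounded _ mR R (oo r t) (fun s => a s * b s).
Proof.
move=> [a1 a2 [M hM]] [b1 b2 [N hN]]; split.
- by apply: (eq_measurable_fun (fun s => Re (a s) * Re (b s) - Im (a s) * Im (b s)));
    [move=> x _; rewrite ReM | apply: measurable_funB; exact: measurable_funM].
- by apply: (eq_measurable_fun (fun s => Re (a s) * Im (b s) + Im (a s) * Re (b s)));
    [move=> x _; rewrite ImM | apply: measurable_funD; exact: measurable_funM].
exists (M * N + M * N) => x hx; have [m1 m2] := hM x hx; have [n1 n2] := hN x hx.
have pm (u v : R) : `|u| <= M -> `|v| <= N -> `|u * v| <= M * N.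
  by move=> hu hv; rewrite normrM; apply: ler_pM.
split; first by rewrite ReM (le_trans (ler_normB _ _)) // lerD // pm.
by rewrite ImM (le_trans (ler_normD _ _)) // lerD // pm.
Qed.

Lemma damped_bounded T k a b :
  @cbounded _ mR R (oo a b) (fun s => cutoff T s * conjc (cexp (xlam lb lt k) s)).
Proof. by apply: cboundedM; [exact: cutoff_bounded | exact: conj_cexp_bounded]. Qed.

Lemma damped_wave_L2 T k : L2s (leb \x leb)%E (fun j => oo 0 T `*` omega j) (damped_wave T k).
Proof. by apply: (tensor_L2 ho); [exact: damped_bounded | exact: xphi_L2G]. Qed.

Lemma damped_gram T j k : control_ip omega 0 T (damped_wave T j) (damped_wave T k) =
  weight_hat T (xlam lb lt k - xlam lb lt j) * omega_ip omega (xphi lb lt j) (xphi lb lt k).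
Proof.
rewrite /damped_wave (tensor_ip ho (damped_bounded T j 0 T) (damped_bounded T k 0 T)); try exact: xphi_L2G.
congr (_ * _); apply: eq_cintegral => s _.
have e : (xlam lb lt k - xlam lb lt j) * s = xlam lb lt k * s - xlam lb lt j * s by ring.
by rewrite /cutoff /cexp e cosB sinB; apply: complex_eqP; rewrite !ReImE /=; ring.
Qed.

(** The diagonal Gram entries are at least [c * (T / 2)]. Off the diagonal, the decay of
    [weight_hat] and the gap bound each row sum by a constant over [T], so dominance holds once [T]
    is large. *)
Lemma control_moments : badly_approximable al -> exists2 T : R, 0 < T & forall (d : nat -> R[i]) (B : R),
  (forall n, \sum_(k < n) sqn (d k) <= B) ->
  exists2 h, L2s (leb \x leb)%E (fun j => oo 0 T `*` omega j) h &
    forall k, control_ip omega 0 T h (damped_wave T k) = d k.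
Proof.
move=> ba; have [g g0 gap] := spectral_gap hb ht ba; have [c c0 hc] := omega_lower.
have p0 := pi_gt0 R.
(* Dominance asks that [c / 4 * T ^+ 2 >= 16 * pi ^+ 2 / g ^+ 2]; with this [T] it becomes
   [c + 2 + c^-1 >= 1]. *)
pose T : R := 8 * pi / g * (1 + c^-1).
have ic0 : 0 < c^-1 by rewrite invr_gt0.
have T0 : 0 < T by apply: mulr_gt0; [apply: divr_gt0 => //; exact: mulr_gt0 | exact: addr_gt0].
exists T => // d B hd.
have H := control_hilbert ho 0 T.
pose cT := c * (T / 2).
have cT0 : 0 < cT by rewrite /cT mulr_gt0 ?divr_gt0.
have normal k : Re (omega_ip omega (xphi lb lt k) (xphi lb lt k)) <= 1.
  apply: (le_trans (le_omega_innerG ho (xphi_L2G hb ht k))).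
  by rewrite (xphi_orthonormal hb ht) eqxx.
have off j k : Normc.normc (omega_ip omega (xphi lb lt j) (xphi lb lt k)) <= 1.
  have HO := omega_hilbert ho.
  have Lo i := L2G_omega ho (xphi_L2G hb ht i).
  have := cauchy_schwarz HO (Lo j) (Lo k); rewrite -normc_sqn => h.
  have h1 : Normc.normc (omega_ip omega (xphi lb lt j) (xphi lb lt k)) ^+ 2 <= 1.
    apply: (le_trans h); rewrite -[leRHS]mulr1; apply: ler_pM; rewrite ?normal //.
      exact: (ip_ge0 HO (Lo j)).
    exact: (ip_ge0 HO (Lo k)).
  rewrite leNgt; apply/negP => lt1.
  by have := ltrXn2r 2 (ler01 : 0 <= 1 :> R) lt1; rewrite expr1n ltNge h1.
apply: (moment_problem H (damped_wave_L2 T) (c := cT / 2) _ _ hd); first by rewrite divr_gt0.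
apply: (diagonal_dominance H (damped_wave_L2 T)).
  move=> k; rewrite damped_gram subrr weight_hat0 // mulrC Re_mulr.
  by rewrite ler_pM2r ?divr_gt0.
move=> n k kn.
apply: (@le_trans _ _ (4 * pi ^+ 2 / T * \sum_(j < n | (j : nat) != k) ((xlam lb lt j - xlam lb lt k) ^+ 2)^-1)).
  rewrite mulr_sumr; apply: ler_sum => j jk; rewrite damped_gram Normc.normcM.
  have lam0 : xlam lb lt k - xlam lb lt j != 0.
    rewrite subr_eq0; apply/eqP => e; have := gap _ _ jk.
    by rewrite e subrr normr0 leNgt g0.
  rewrite -[leRHS]mulr1; apply: ler_pM; rewrite ?normc_ge0 ?off //.
  apply: (le_trans (weight_hat_decay T0 lam0)).
  by rewrite -(sqrrN (xlam lb lt k - _)) opprB invfM mulrA.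
have := separated_sum n k g0 gap; set S := \sum_(_ < _ | _) _ => hS.
have p2 := sqr_ge0 (pi : R).
have pT : 0 <= 4 * pi ^+ 2 / T by apply: divr_ge0 (ltW T0); lra.
apply: (le_trans (ler_wpM2l pT hS)).
have -> : 4 * pi ^+ 2 / T * (4 / g ^+ 2) = (16 * pi ^+ 2 / g ^+ 2) / T.
  by field; rewrite !gt_eqF.
rewrite ler_pdivrMr // /cT.
have -> : c * (T / 2) / 2 * T = c / 4 * T ^+ 2 by field.
have -> : c / 4 * T ^+ 2 = (16 * pi ^+ 2 / g ^+ 2) * (c * (1 + c^-1) ^+ 2).
  by rewrite /T; field; rewrite !gt_eqF.
apply: ler_peMr; first by apply: divr_ge0 (sqr_ge0 g); lra.
have -> : c * (1 + c^-1) ^+ 2 = c + 2 + c^-1 by field; rewrite gt_eqF.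
lra.
Qed.
End ControlMoments.

(** * Construction of the state and the weak equation *)

Section PrimitiveIncrement.
Context {R : realType}.
Local Notation leb := (@lebesgue_measure R).
Local Notation mR := (measurableTypeR R).
Local Notation oo a b := (`]a, b[%classic : set R).

Lemma Rintegral_increment (r t : R) (f : R -> R) : 0 <= r -> r <= t -> integrableR leb (oo 0 t) f ->
  \int[leb]_(s in oo 0 t) f s - \int[leb]_(s in oo 0 r) f s = \int[leb]_(s in oo r t) f s.
Proof.
move=> r0; rewrite le_eqVlt => /orP[/eqP <- _|rt fi].
  by rewrite subrr set_itvoo0 Rintegral_set0.
have fr : integrableR leb (oo 0 r) f.
  apply: integrableS fi; [exact: mleb | exact: mleb |].
  by move=> s /ooP/andP[s0 sr]; apply/ooP; rewrite s0 (lt_trans sr rt).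
have e := Rintegral_itv_bndo_bndc fr; rewrite [X in _ - X]e; apply: Rintegral_itvB => //.
Qed.

Lemma cprim_increment (r t : R) (f : R -> R[i]) : 0 <= r -> r <= t -> cintegrable leb (oo 0 t) f ->
  cprim f t - cprim f r = cintegral leb (oo r t) f.
Proof.
move=> r0 rt [f1 f2]; apply: complex_eqP.
  by rewrite ReD ReN /cprim !Re_cintegral Rintegral_increment.
by rewrite ImD ImN /cprim !Im_cintegral Rintegral_increment.
Qed.

Lemma oo_sub (a b c d : R) : a <= c -> d <= b -> oo c d `<=` oo a b.
Proof. by move=> ac db s /ooP/andP[h1 h2]; apply/ooP; rewrite (le_lt_trans ac) // (lt_le_trans h2). Qed.
End PrimitiveIncrement.

Section WaveBessel.
Context {R : realType}.
Local Notation leb := (@lebesgue_measure R).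
Local Notation mR := (measurableTypeR R).
Local Notation oo a b := (`]a, b[%classic : set R).
Variables (lb lt : R).
Hypotheses (hb : 0 < lb) (ht : 0 < lt).
Local Notation ell := (@X_length R lb lt).
Variables (omega : 'I_4 -> set R) (T : R).
Hypotheses (ho : open_subset ell omega).

Definition eigenwave (k : nat) : 'I_4 -> R * R -> R[i] :=
  tensor (fun s => conjc (cexp (xlam lb lt k) s)) (xphi lb lt k).

Local Notation edges := (fun j => oo 0 (ell j)).

Lemma open_edges : open_subset ell edges.
Proof. by move=> j; split=> //; exact: interval_open. Qed.

Lemma eigenwave_L2 (omega' : 'I_4 -> set R) r t k : open_subset ell omega' ->
  L2s (leb \x leb)%E (fun j => oo r t `*` omega' j) (eigenwave k).
Proof. by move=> h; apply: (tensor_L2 h); [exact: conj_cexp_bounded | exact: xphi_L2G]. Qed.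

Lemma eigenwave_gram r t j k : r <= t ->
  control_ip edges r t (eigenwave j) (eigenwave k) = ((t - r) * (j == k)%:R)%:C.
Proof.
move=> rt; rewrite (tensor_ip open_edges (conj_cexp_bounded _ _ _) (conj_cexp_bounded _ _ _)); try exact: xphi_L2G.
have -> : omega_ip edges (xphi lb lt j) (xphi lb lt k) = (j == k)%:R by exact: xphi_orthonormal.
have [<-|jk] := eqVneq j k; last by rewrite !mulr0.
rewrite !mulr1.
transitivity (cintegral leb (oo r t) (fun=> 1 : R[i])).
  by apply: eq_cintegral => s _; rewrite conjcK conj_cexp cexp_mulN.
apply: complex_eqP; rewrite ?Re_cintegral ?Im_cintegral /= Rintegral_cst ?mleb //.
  by rewrite fine_leb_oo // mul1r.
by rewrite mul0r.
Qed.

(** On the full edges the eigenwaves are orthogonal with squared norm [t - r], and restriction to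
    [omega] only decreases norms. Pairing [h] with the combination [Psi] whose coefficients are the
    moments themselves gives the bound by Cauchy-Schwarz. *)
Lemma wave_bessel r t h n : r <= t -> L2s (leb \x leb)%E (fun j => oo r t `*` omega j) h ->
  \sum_(k < n) sqn (control_ip omega r t h (eigenwave k)) <= (t - r) * Re (control_ip omega r t h h).
Proof.
move=> rt hL; have H := control_hilbert ho r t; have HE := control_hilbert open_edges r t.
pose B k := control_ip omega r t h (eigenwave k); pose Psi := lincomb eigenwave n B.
have WL k := eigenwave_L2 r t k ho; have WE k := eigenwave_L2 r t k open_edges.
set S := \sum_(k < n) _.
have S0 : 0 <= S by apply: sumr_ge0 => k _; exact: sqn_ge0.
have hPsi : Re (control_ip omega r t h Psi) = S.
  rewrite /Psi (ip_lincombr H WL) // Re_sum; apply: eq_bigr => k _.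
  by rewrite mulrC Re_mulc_conj.
have sqE : Re (control_ip edges r t Psi Psi) = (t - r) * S.
  rewrite {2}/Psi (ip_lincombr HE WE); last exact: (dom_lincomb HE WE).
  rewrite Re_sum mulr_sumr; apply: eq_bigr => k _.
  have -> : control_ip edges r t Psi (eigenwave k) = (t - r)%:C * B k.
    rewrite /Psi (ip_lincombl HE WE) // (bigD1 k) //= eigenwave_gram // eqxx mulr1 big1 ?addr0 => [|j].
      by rewrite mulrC.
    by rewrite -val_eqE /= => /negbTE jk; rewrite eigenwave_gram // jk mulr0 mulr0.
  by rewrite mulrC -mulrA mulrC Re_mulr Re_mulc_conj mulrC.
have PE := dom_lincomb HE WE n B.
have sqO : Re (control_ip omega r t Psi Psi) <= (t - r) * S.
  rewrite -sqE; apply: (@le_ips_subset _ _ R _ 4 _ _ _ (cylinder_meas ho r t) (cylinder_meas open_edges r t) _ PE).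
  by move=> j z [z1 z2]; split=> //; exact: (ho j).2.
have N0 := ip_ge0 H hL.
have cs := cauchy_schwarz H hL (dom_lincomb H WL n B).
have S2 : S ^+ 2 <= Re (control_ip omega r t h h) * ((t - r) * S).
  apply: le_trans (le_trans cs (ler_wpM2l N0 sqO)).
  by rewrite -hPsi /sqn lerDl sqr_ge0.
move: S0; rewrite le_eqVlt => /orP[/eqP <-|S0]; first by rewrite mulr_ge0 // subr_ge0.
rewrite -(ler_pM2r S0) -expr2; apply: (le_trans S2); rewrite le_eqVlt; apply/orP; left.
by apply/eqP; ring.
Qed.
End WaveBessel.

Section Solution.
Context {R : realType}.
Local Notation leb := (@lebesgue_measure R).
Local Notation mR := (measurableTypeR R).
Local Notation oo a b := (`]a, b[%classic : set R).
Variables (lb lt : R).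
Hypotheses (hb : 0 < lb) (ht : 0 < lt).
Local Notation ell := (@X_length R lb lt).
Local Notation phi := (xphi lb lt).
Local Notation la := (xlam lb lt).
Variables (omega : 'I_4 -> set R) (T : R).
Hypotheses (ho : open_subset ell omega) (T0 : 0 < T).
Variables (h : 'I_4 -> R * R -> R[i]) (u0 : 'I_4 -> R -> R[i]).
Hypotheses (hL : L2_control omega T h) (u0L : L2G ell u0).

Let N := Re (control_ip omega 0 T h h).
Let M := 2 * Re (innerG ell u0 u0) + 2 * (T * N).

Definition source k s := innerG ell (cut_off omega h s) (phi k).
Definition bcoef k := cprim (fun s => cexp (la k) s * source k s).
(** The coefficient seen in the frame that rotates with the free evolution: it varies in time
    through the control alone, and has the same modulus as the actual coefficient [ycoef]. *)
Definition zcoef k t := innerG ell u0 (phi k) - ci * bcoef k t.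
Definition ycoef k t := cexp (- la k) t * zcoef k t.

Let HG := L2G_hilbert ell.
Let pL := xphi_L2G hb ht.

Lemma control_L2S r t : 0 <= r -> t <= T -> L2s (leb \x leb)%E (fun j => oo r t `*` omega j) h.
Proof.
move=> r0 tT j; apply: L2S (hL j); try exact: (cylinder_meas ho).
by move=> z [z1 z2]; split=> //; exact: oo_sub z1.
Qed.

Lemma control_norm_le r t : 0 <= r -> t <= T -> Re (control_ip omega r t h h) <= N.
Proof.
move=> r0 tT; apply: (@le_ips_subset _ _ R _ 4 _ _ _ (cylinder_meas ho r t) (cylinder_meas ho 0 T) _ hL).
by move=> j z [z1 z2]; split=> //; exact: oo_sub z1.
Qed.

Lemma N_ge0 : 0 <= N.
Proof. exact: (ip_ge0 (control_hilbert ho 0 T) hL). Qed.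

Lemma M_ge0 : 0 <= M.
Proof.
have := mulr_ge0 (ltW T0) N_ge0; have := ip_ge0 HG u0L; rewrite /M; lra.
Qed.

Lemma cst1_bounded (a b : R) : @cbounded _ mR R (oo a b) (fun=> 1).
Proof. by split=> //; exists 1 => x _; rewrite /= normr1 normr0. Qed.

Lemma source_cintegrable k t : t <= T -> cintegrable leb (oo 0 t) (source k).
Proof.
move=> tT; have [i _] := control_pairing ho (control_L2S (lexx 0) tT) (pL k) (cst1_bounded 0 t).
by apply: (eq_cintegrable (mleb _)) i => s _; rewrite mul1r.
Qed.

Lemma bcoef_increment k r t : 0 <= r -> r <= t -> t <= T ->
  bcoef k t - bcoef k r = control_ip omega r t h (eigenwave lb lt k).
Proof.
move=> r0 rt tT; rewrite /bcoef cprim_increment //; last first.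
  exact: (control_pairing ho (control_L2S (lexx 0) tT) (pL k) (cexp_bounded _ _ _)).1.
exact: (control_pairing ho (control_L2S r0 tT) (pL k) (cexp_bounded _ _ _)).2.
Qed.

Lemma bcoef0 k : bcoef k 0 = 0.
Proof. by rewrite /bcoef /cprim set_itvoo0 cintegral_set0. Qed.

Lemma bcoef_bessel n r t : 0 <= r -> r <= t -> t <= T ->
  \sum_(k < n) sqn (bcoef k t - bcoef k r) <= (t - r) * N.
Proof.
move=> r0 rt tT; under eq_bigr do rewrite bcoef_increment //.
apply: (le_trans (wave_bessel hb ht ho n rt (control_L2S r0 tT))).
by rewrite ler_wpM2l ?subr_ge0 // control_norm_le.
Qed.

Lemma zcoef_increment n s t : 0 <= s <= T -> 0 <= t <= T ->
  \sum_(k < n) sqn (zcoef k s - zcoef k t) <= `|s - t| * N.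
Proof.
move=> sT tT.
have e k : sqn (zcoef k s - zcoef k t) = sqn (bcoef k s - bcoef k t).
  have -> : zcoef k s - zcoef k t = - (ci * (bcoef k s - bcoef k t)) by rewrite /zcoef; ring.
  by rewrite sqnN sqnM /sqn /=; ring.
under eq_bigr do rewrite e.
move: sT tT => /andP[s0 sT] /andP[t0 tT].
have [ts|st] := leP t s; first by rewrite ger0_norm ?subr_ge0 //; exact: bcoef_bessel.
rewrite ltr0_norm ?subr_lt0 // opprB.
by under eq_bigr do rewrite -sqnN opprB; apply: bcoef_bessel => //; exact: ltW.
Qed.

Lemma zcoef_bound n t : 0 <= t <= T -> \sum_(k < n) sqn (zcoef k t) <= M.
Proof.
move=> /andP[t0 tT].
apply: (@le_trans _ _ (\sum_(k < n) (2 * sqn (innerG ell u0 (phi k)) + 2 * sqn (bcoef k t - bcoef k 0)))).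
  apply: ler_sum => k _; apply: (le_trans (sqnD_le _ _)).
  rewrite bcoef0 subr0 sqnN sqnM.
  have -> : sqn (ci : R[i]) = 1 by rewrite /sqn /= expr0n expr1n add0r.
  by rewrite mul1r.
rewrite big_split /= -!mulr_sumr; apply: lerD; rewrite ler_wpM2l //.
  exact: (bessel HG pL (xphi_orthonormal hb ht)).
apply: (le_trans (bcoef_bessel n (lexx 0) t0 tT)).
by rewrite subr0 ler_wpM2r // N_ge0.
Qed.

Lemma sqn_ycoef k t : sqn (ycoef k t) = sqn (zcoef k t).
Proof. by rewrite /ycoef sqnM sqn_cexp mul1r. Qed.

(** Square-summable coefficients on an orthonormal family are a moment problem with constant 1. The
    states are chosen independently at each time; continuity is recovered afterwards from the
    coefficients. *)
Lemma state_exists : exists u : R -> 'I_4 -> R -> R[i], forall t, 0 <= t <= T ->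
  L2G ell (u t) /\ forall k, innerG ell (u t) (phi k) = ycoef k t.
Proof.
suff /choice[u hu] : forall t, exists f, 0 <= t <= T ->
    L2G ell f /\ forall k, innerG ell f (phi k) = ycoef k t by exists u.
move=> t; have [tT|ntT] := boolP (0 <= t <= T); last by exists 0.
have [||f fL hf] := moment_problem HG pL (c := 1) ltr01 _ (d := fun k => ycoef k t) (B := M).
- by move=> n a; exact: (riesz_orthonormal HG pL (xphi_orthonormal hb ht)).
- by move=> n; under eq_bigr do rewrite sqn_ycoef; exact: zcoef_bound.
by exists f.
Qed.

Variable u : R -> 'I_4 -> R -> R[i].
Hypothesis hu : forall t, 0 <= t <= T ->
  L2G ell (u t) /\ forall k, innerG ell (u t) (phi k) = ycoef k t.

Let parseval f B := @parseval_le _ _ _ _ HG phi pL (xphi_orthonormal hb ht) (xphi_total hb ht) f B.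

Lemma state_bound t : 0 <= t <= T -> Re (innerG ell (u t) (u t)) <= M.
Proof.
move=> tT; have [uL uy] := hu tT; apply: parseval => // n.
by under eq_bigr do rewrite uy sqn_ycoef; exact: zcoef_bound.
Qed.

Lemma sqn_cexpB_le (a s t : R) : sqn (cexp a s - cexp a t) <= 2 * (a * (s - t)) ^+ 2.
Proof.
have e : a * (s - t) = a * s - a * t by ring.
have hc := sqr_le_norm (cos_lipschitz (a * s) (a * t)).
have hs := sqr_le_norm (sin_lipschitz (a * s) (a * t)).
rewrite e /sqn ReD ImD ReN ImN /=; lra.
Qed.

Lemma sqn_cexpB_le4 (a s t : R) : sqn (cexp a s - cexp a t) <= 4.
Proof. by apply: (le_trans (sqnD_le _ _)); rewrite sqnN !sqn_cexp; lra. Qed.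

(** A coefficient changes through [zcoef], controlled by Bessel, and through its phase. The phases
    are Lipschitz for the first [K] modes; beyond [K] they are only bounded, but the tail of the
    coefficients at [t] is at most [e]. *)
Lemma state_modulus t : 0 <= t <= T -> forall e : R, 0 < e -> exists2 D : R, 0 <= D &
  forall s, 0 <= s <= T ->
    normG ell (fun j x => u s j x - u t j x) ^+ 2 <= 2 * `|s - t| * N + D * (s - t) ^+ 2 + 8 * e.
Proof.
move=> tT e e0; have [utL uty] := hu tT.
pose F k := sqn (zcoef k t); have F0 k : 0 <= F k by exact: sqn_ge0.
have [K hK] := monotone_bounded_cauchy (s := fun n => \sum_(k < n) F k)
  (fun m n => sum_ord_mono F0) (fun n => zcoef_bound n tT) e0.
exists (\sum_(k < K) 4 * la k ^+ 2 * F k).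
  apply: sumr_ge0 => k _; apply: mulr_ge0 => //; apply: mulr_ge0 => //; exact: sqr_ge0.
move=> s sT; have [usL usy] := hu sT.
rewrite normG_sqr; apply: parseval; first exact: (domB HG usL utL).
move=> n.
have e1 k : sqn (innerG ell (fun j x => u s j x - u t j x) (phi k)) <=
    2 * sqn (zcoef k s - zcoef k t) + 2 * (sqn (cexp (- la k) s - cexp (- la k) t) * F k).
  have -> : innerG ell (fun j x => u s j x - u t j x) (phi k) = ycoef k s - ycoef k t.
    by rewrite -usy -uty; exact: (ipB HG).
  have -> : ycoef k s - ycoef k t = cexp (- la k) s * (zcoef k s - zcoef k t) +
      (cexp (- la k) s - cexp (- la k) t) * zcoef k t by rewrite /ycoef; ring.
  by apply: (le_trans (sqnD_le _ _)); rewrite !sqnM sqn_cexp mul1r.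
pose m := maxn n K.
have nm : (n <= m)%N by rewrite leq_maxl.
have Km : (K <= m)%N by rewrite leq_maxr.
apply: (le_trans (@sum_ord_mono R (fun k => sqn (innerG ell (fun j x => u s j x - u t j x) (phi k))) n m _ nm)).
  by move=> k; exact: sqn_ge0.
apply: (@le_trans _ _ (\sum_(k < m) (2 * sqn (zcoef k s - zcoef k t) +
    2 * (sqn (cexp (- la k) s - cexp (- la k) t) * F k)))).
  by apply: ler_sum => k _; exact: e1.
rewrite big_split /= -!mulr_sumr -addrA; apply: lerD.
  rewrite -mulrA ler_wpM2l //; exact: zcoef_increment.
rewrite -(big_mkord xpredT (fun k => sqn (cexp (- la k) s - cexp (- la k) t) * F k)).
rewrite (big_cat_nat (leq0n K) Km) /= mulrDr big_mkord; apply: lerD.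
  rewrite mulr_sumr mulr_suml; apply: ler_sum => k _.
  have := ler_wpM2r (F0 k) (sqn_cexpB_le (- la k) s t).
  have -> : 2 * (- la k * (s - t)) ^+ 2 * F k = 2 * (la k ^+ 2 * F k * (s - t) ^+ 2) by ring.
  have -> : 4 * la k ^+ 2 * F k * (s - t) ^+ 2 = 4 * (la k ^+ 2 * F k * (s - t) ^+ 2) by ring.
  lra.
have tail : \sum_(K <= k < m) F k <= e.
  have := hK m Km; rewrite -(big_mkord xpredT F) -(big_mkord xpredT F) (big_cat_nat (leq0n K) Km) /=.
  lra.
have : \sum_(K <= k < m) sqn (cexp (- la k) s - cexp (- la k) t) * F k <= 4 * \sum_(K <= k < m) F k.
  rewrite mulr_sumr; apply: ler_sum => k _; apply: ler_wpM2r => //; exact: sqn_cexpB_le4.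
lra.
Qed.

Lemma state_continuous : continuous_L2G ell T u.
Proof.
split=> t tT.
  by apply: (hu _).1; move: tT; rewrite in_itv.
have tT' : 0 <= t <= T by move: tT; rewrite in_itv.
apply/cvgrPdist_le => e e0.
have e16 : 0 < e ^+ 2 / 16 by rewrite divr_gt0 // exprn_gt0.
have [D D0 hD] := state_modulus tT' e16.
pose c := 2 * N + D + 1; have c0 : 0 < c by rewrite /c; have := N_ge0; lra.
(* The bound 1 makes the quadratic term linear; the other bound leaves [e ^+ 2 / 2] for the linear
   terms, the tail taking the other half. *)
pose dl := Num.min 1 (e ^+ 2 / (2 * c)).
have dl0 : 0 < dl by rewrite lt_min ltr01 /= divr_gt0 ?mulr_gt0 ?exprn_gt0.
near=> s.
have sT : 0 <= s <= T.
  have : s \in `[0, T] by near: s; exact: withinT.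
  by rewrite in_itv.
have st : `|s - t| < dl.
  have : ball t dl s by near: s; apply: cvg_within; exact: nbhsx_ballx.
  by rewrite /ball /= distrC.
rewrite sub0r normrN ger0_norm ?normG_ge0 //.
have hs := hD s sT.
have st1 : `|s - t| <= 1 by apply: (le_trans (ltW st)); rewrite ge_min lexx.
have st2 : `|s - t| <= e ^+ 2 / (2 * c) by apply: (le_trans (ltW st)); rewrite ge_min lexx orbT.
have sq : (s - t) ^+ 2 <= `|s - t|.
  by rewrite -(real_normK (num_real (s - t))) expr2 ler_piMr.
have b1 : D * (s - t) ^+ 2 <= D * `|s - t| by rewrite ler_wpM2l.
have b2 : c * `|s - t| <= e ^+ 2 / 2.
  apply: (le_trans (ler_wpM2l (ltW c0) st2)); rewrite le_eqVlt; apply/orP; left.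
  by apply/eqP; field; rewrite gt_eqF.
have b3 : 2 * `|s - t| * N + D * `|s - t| <= c * `|s - t|.
  have -> : 2 * `|s - t| * N = 2 * N * `|s - t| by ring.
  by rewrite /c -mulrDl ler_wpM2r //; lra.
have h2 : normG ell (fun j x => u s j x - u t j x) ^+ 2 <= e ^+ 2 by lra.
rewrite leNgt; apply/negP => lt1.
by have := ltrXn2r 2 (ltW e0) lt1; rewrite ltNge h2.
Unshelve. all: by end_near.
Qed.
End Solution.

Section WeakEquation.
Context {R : realType}.
Local Notation leb := (@lebesgue_measure R).
Local Notation mR := (measurableTypeR R).
Local Notation oo a b := (`]a, b[%classic : set R).
Variables (lb lt : R).
Hypotheses (hb : 0 < lb) (ht : 0 < lt).
Local Notation ell := (@X_length R lb lt).
Local Notation phi := (xphi lb lt).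
Local Notation la := (xlam lb lt).
Variables (omega : 'I_4 -> set R) (T : R).
Hypotheses (ho : open_subset ell omega) (T0 : 0 < T).
Variables (h : 'I_4 -> R * R -> R[i]) (u0 : 'I_4 -> R -> R[i]).
Hypotheses (hL : L2_control omega T h) (u0L : L2G ell u0).
Variable u : R -> 'I_4 -> R -> R[i].
Hypothesis hu : forall t, 0 <= t <= T ->
  L2G ell (u t) /\ forall k, innerG ell (u t) (phi k) = ycoef lb lt omega h u0 k t.

Let N := Re (control_ip omega 0 T h h).
Let M := 2 * Re (innerG ell u0 u0) + 2 * (T * N).
Let HG := L2G_hilbert ell.
Let pL := xphi_L2G hb ht.
Let uc : continuous_L2G ell T u := state_continuous hb ht ho hL u0L hu.

Variable t : R.
Hypothesis tT : 0 <= t <= T.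

Let HK := control_hilbert ho 0 t.
Let t0 : 0 <= t. Proof. by case/andP: tT. Qed.
Let t_le : t <= T. Proof. by case/andP: tT. Qed.
Let htL := control_L2S ho hL (lexx 0) t_le.
Let sT s : oo 0 t s -> 0 <= s <= T.
Proof. by move=> /ooP/andP[h1 h2]; rewrite ltW //= (ltW (lt_le_trans h2 t_le)). Qed.
Let uL s : 0 <= s <= T -> L2G ell (u s). Proof. by move=> /hu []. Qed.
Let zT : 0 <= (0 : R) <= T. Proof. by rewrite lexx ltW. Qed.

Definition free_part (psi : 'I_4 -> R -> R[i]) : R[i] :=
  cintegral leb (oo 0 t) (fun s => innerG ell (u s) psi).
Definition forced_part (f : 'I_4 -> R -> R[i]) : R[i] :=
  control_ip omega 0 t h (tensor (fun=> 1) f).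
(** The amount by which the weak equation fails for the pair of a test function and its Laplacian.
    The two arguments are independent so that the defect is jointly antilinear and can be bounded in
    both. *)
Definition defect (f psi : 'I_4 -> R -> R[i]) : R[i] :=
  innerG ell (u t) f - innerG ell (u 0) f - ci * free_part psi + ci * forced_part f.

Lemma tensor1_L2 f : L2G ell f -> L2s (leb \x leb)%E (fun j => oo 0 t `*` omega j) (tensor (fun=> 1) f).
Proof. by move=> fL; apply: (tensor_L2 ho) => //; exact: cst1_bounded. Qed.

Lemma inner_cintegrable f : L2G ell f -> cintegrable leb (oo 0 t) (fun s => innerG ell (u s) f).
Proof.
move=> fL; have [i1 i2] := moment_cintegrable T0 uc fL.
by split; [apply: integrableS i1 | apply: integrableS i2]; try exact: mleb; exact: oo_sub.
Qed.

Lemma free_partD a f g : L2G ell f -> L2G ell g -> free_part (f + a *: g) = free_part f + conjc a * free_part g.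
Proof.
move=> fL gL; rewrite /free_part -(cintegralZ (mleb _)); last exact: inner_cintegrable.
rewrite -(cintegralD (mleb _)); try exact: inner_cintegrable; last first.
  by apply: (cintegrableZ (mleb _)); exact: inner_cintegrable.
apply: eq_cintegral => s /sT/uL us.
by rewrite (ipDr HG fL (domZ HG a gL) us) (ipZr HG a us gL).
Qed.

Lemma forced_partD a f g : L2G ell f -> L2G ell g ->
  forced_part (f + a *: g) = forced_part f + conjc a * forced_part g.
Proof.
move=> fL gL; rewrite /forced_part.
have -> : tensor (fun=> 1) (f + a *: g) = tensor (fun=> 1) f + a *: tensor (fun=> 1) g.
  apply/funext => j; apply/funext => z.
  rewrite -[LHS]/(1 * (f j z.2 + a * g j z.2)) -[RHS]/(1 * f j z.2 + a * (1 * g j z.2)).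
  by ring.
by rewrite (ipDr HK (tensor1_L2 fL) (domZ HK a (tensor1_L2 gL)) htL) (ipZr HK a htL (tensor1_L2 gL)).
Qed.

Lemma defectD a f g psi chi : L2G ell f -> L2G ell g -> L2G ell psi -> L2G ell chi ->
  defect (f + a *: g) (psi + a *: chi) = defect f psi + conjc a * defect g chi.
Proof.
move=> fL gL psL cL; rewrite /defect free_partD // forced_partD //.
rewrite (ipDr HG fL (domZ HG a gL) (uL tT)) (ipZr HG a (uL tT) gL).
rewrite (ipDr HG fL (domZ HG a gL) (uL zT)) (ipZr HG a (uL zT) gL).
ring.
Qed.

(** Each of the four terms is bounded by Cauchy-Schwarz, with norms of the state and of the control
    uniform on the time interval; the crude constant only serves to pass to the limit. *)
Lemma defect_bound f psi : L2G ell f -> L2G ell psi ->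
  sqn (defect f psi) <= 8 * (2 * M + N * T + 2 * M * T ^+ 2) *
    (Re (innerG ell f f) + Re (innerG ell psi psi)).
Proof.
move=> fL psL; set F := Re (innerG ell f f); set P := Re (innerG ell psi psi).
have F0 : 0 <= F := ip_ge0 HG fL; have P0 : 0 <= P := ip_ge0 HG psL.
have N0 : 0 <= N := N_ge0 ho hL; have M0 : 0 <= M := M_ge0 ho T0 hL u0L.
have uB s g : 0 <= s <= T -> L2G ell g -> sqn (innerG ell (u s) g) <= M * Re (innerG ell g g).
  move=> sT' gL; apply: (le_trans (cauchy_schwarz HG (uL sT') gL)).
  by rewrite ler_wpM2r ?(ip_ge0 HG gL) //; exact: (state_bound hb ht ho hL u0L hu sT').
have b1 := uB t f tT fL; have b2 := uB 0 f zT fL.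
have tT2 : t ^+ 2 <= T ^+ 2 by rewrite lerXn2r ?nnegrE // ltW.
have b3 : sqn (ci * free_part psi) <= 2 * M * T ^+ 2 * P.
  have MP : 0 <= M * P by exact: mulr_ge0.
  rewrite sqnM; have -> : sqn (ci : R[i]) = 1 by rewrite /sqn /= expr0n expr1n add0r.
  rewrite mul1r.
  have := cintegral_bound (mleb _) (B := Num.sqrt (M * P)) (leb_oo_lt 0 t) (inner_cintegrable psL) (sqrtr_ge0 _).
  rewrite fine_leb_oo // subr0 exprMn sqr_sqrtr // => hI.
  apply: (le_trans (hI _)).
    by move=> s /sT sT'; exact: uB.
  have := ler_wpM2l MP tT2.
  have -> : 2 * M * T ^+ 2 * P = 2 * (M * P * T ^+ 2) by ring.
  lra.
have b4 : sqn (ci * forced_part f) <= N * T * F.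
  rewrite sqnM; have -> : sqn (ci : R[i]) = 1 by rewrite /sqn /= expr0n expr1n add0r.
  rewrite mul1r; apply: (le_trans (cauchy_schwarz HK htL (tensor1_L2 fL))).
  rewrite -mulrA; apply: ler_pM.
  - exact: (ip_ge0 HK htL).
  - exact: (ip_ge0 HK (tensor1_L2 fL)).
  - exact: (control_norm_le ho hL (lexx 0) t_le).
  rewrite (tensor_ip ho (cst1_bounded 0 t) (cst1_bounded 0 t)) //.
  have -> : cintegral leb (oo 0 t) (fun=> 1 * conjc 1) = t%:C :> R[i].
    apply: complex_eqP; rewrite ?Re_cintegral ?Im_cintegral Rintegral_cst ?mleb // fine_leb_oo //=.
      by rewrite subr0; ring.
    by ring.
  rewrite mulrC Re_mulr mulrC; apply: ler_pM => //.
    exact: (ip_ge0 (omega_hilbert ho) (L2G_omega ho fL)).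
  exact: le_omega_innerG.
apply: (le_trans (sqnD_le _ _)).
have c1 := sqnD_le (innerG ell (u t) f - innerG ell (u 0) f) (- (ci * free_part psi)).
have c2 := sqnD_le (innerG ell (u t) f) (- innerG ell (u 0) f).
rewrite sqnN in c1; rewrite sqnN in c2.
have MF : 0 <= M * F by exact: mulr_ge0.
have MP : 0 <= M * P by exact: mulr_ge0.
have NT : 0 <= N * T by apply: mulr_ge0 => //; exact: ltW.
have MT : 0 <= 2 * M * T ^+ 2 by apply: mulr_ge0 (sqr_ge0 T); lra.
have NTF := mulr_ge0 NT F0; have NTP := mulr_ge0 NT P0.
have MTF := mulr_ge0 MT F0; have MTP := mulr_ge0 MT P0.
have -> : 8 * (2 * M + N * T + 2 * M * T ^+ 2) * (F + P) = 16 * (M * F) + 16 * (M * P) +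
  8 * (N * T * F) + 8 * (N * T * P) + 8 * (2 * M * T ^+ 2 * F) + 8 * (2 * M * T ^+ 2 * P) by ring.
lra.
Qed.

Lemma defect_eigen k : defect (phi k) ((- la k)%:C *: phi k) = 0.
Proof.
have src := source_cintegrable hb ht ho hL k t_le.
have [yi] := duhamel_inv (la k) (innerG ell u0 (phi k)) t0 src.
have yE s : 0 <= s <= T -> innerG ell (u s) (phi k) = ycoef lb lt omega h u0 k s.
  by move=> sT'; exact: (hu sT').2.
have e0 : innerG ell (u 0) (phi k) = innerG ell u0 (phi k).
  by rewrite yE // /ycoef cexp0 mul1r /zcoef bcoef0 mulr0 subr0.
have Ii := inner_cintegrable (pL k).
move=> eqt; rewrite /defect yE // e0.
have forcedE : forced_part (phi k) = cintegral leb (oo 0 t) (source lb lt omega h k).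
  rewrite /forced_part.
  have [_ e] := control_pairing ho htL (pL k) (cst1_bounded 0 t).
  have -> : tensor (fun=> 1) (phi k) = tensor (fun=> conjc 1) (phi k) by rewrite conjc1.
  by rewrite -e; apply: eq_cintegral => s _; rewrite mul1r.
have freeE : free_part ((- la k)%:C *: phi k) = - (la k)%:C * cintegral leb (oo 0 t) (fun s => innerG ell (u s) (phi k)).
  rewrite /free_part -(cintegralZ (mleb _)) //; apply: eq_cintegral => s /sT/uL us.
  by rewrite (ipZr HG _ us (pL k)) conjc_real rmorphN.
rewrite freeE forcedE.
have -> : ycoef lb lt omega h u0 k t = innerG ell u0 (phi k) +
   cintegral leb (oo 0 t) (fun s => ci * (- (la k)%:C * innerG ell (u s) (phi k)) - ci * source lb lt omega h k s).
  rewrite [LHS]eqt; congr (_ + _); apply: eq_cintegral => s /sT sT'.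
  by rewrite yE.
rewrite (cintegralB (mleb _)); last 2 first.
- by apply: (cintegrableZ (mleb _)); exact: (cintegrableZ (mleb _)).
- exact: (cintegrableZ (mleb _)).
rewrite !(cintegralZ (mleb _)) //; last exact: (cintegrableZ (mleb _)).
move: (innerG _ _ _) (cintegral _ _ _) (cintegral _ _ _) ((la k)%:C) => a X Y l.
ring.
Qed.

Lemma defect_lincomb n (c : nat -> R[i]) :
  defect (lincomb phi n c) (lincomb phi n (fun k => (- la k)%:C * c k)) = 0.
Proof.
have z0 := dom0 HG.
elim: n => [|n IH].
  rewrite /lincomb !big_ord0; have := defectD (-1) z0 z0 z0 z0.
  rewrite scaler0 addr0 => ->; rewrite conjcN conjc1; ring.
rewrite /lincomb !big_ord_recr /= -/(lincomb phi n c) -/(lincomb phi n (fun k => (- la k)%:C * c k)).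
rewrite mulrC -scalerA defectD ?IH ?defect_eigen ?mulr0 ?addr0 //; try exact: (dom_lincomb HG).
exact: (domZ HG).
Qed.

Lemma laplacian_L2 f psi : laplacian ell f psi -> L2G ell f /\ L2G ell psi.
Proof. by move=> [f1 [hH _ _ _]]; split=> j; have [[]] := hH j. Qed.

(** By Green's formula the coefficients of [psi] are [- la k] times those of [f], so the same
    truncation approximates [f] and [psi] simultaneously. The defect vanishes on the truncations,
    and its bound carries this to the limit. *)
Lemma defect_laplacian f psi : laplacian ell f psi -> defect f psi = 0.
Proof.
move=> lap; have [fL psL] := laplacian_L2 lap.
set C := 8 * (2 * M + N * T + 2 * M * T ^+ 2).
have C0 : 0 <= C.
  have N0 : 0 <= N := N_ge0 ho hL; have M0 : 0 <= M := M_ge0 ho T0 hL u0L.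
  have := mulr_ge0 N0 (ltW T0); have := mulr_ge0 M0 (sqr_ge0 T); rewrite /C -[2 * M * _]mulrA; lra.
apply: sqn_eq0; apply/eqP; rewrite eq_le sqn_ge0 andbT; apply/ler_addgt0Pr => e e0; rewrite add0r.
pose d := e / (2 * (C + 1)); have d0 : 0 < d by rewrite divr_gt0 // mulr_gt0 //; lra.
have orth := xphi_orthonormal hb ht.
have [n1 h1] := expansion HG pL orth (xphi_total hb ht) fL d0.
have [n2 h2] := expansion HG pL orth (xphi_total hb ht) psL d0.
pose n := maxn n1 n2.
have g1 := h1 n (leq_maxl _ _); have g2 := h2 n (leq_maxr _ _).
pose c k := innerG ell f (phi k).
have cE : (fun k => innerG ell psi (phi k)) = (fun k => (- la k)%:C * c k).
  by apply/funext => k; exact: (xmode_green hb ht _ _ lap).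
rewrite cE -/c in g2; rewrite -/c in g1.
have PL a : L2G ell (lincomb phi n a) by exact: (dom_lincomb HG).
have := defectD (-1) fL (PL c) psL (PL (fun k => (- la k)%:C * c k)).
rewrite defect_lincomb mulr0 addr0 !scaleN1r => <-.
apply: (le_trans (defect_bound (domB HG fL (PL _)) (domB HG psL (PL _)))).
apply: (@le_trans _ _ (C * (d + d))); first by rewrite ler_wpM2l // lerD.
have -> : C * (d + d) = e * (C / (C + 1)) by rewrite /d; field; rewrite gt_eqF //; lra.
rewrite ler_piMr ?(ltW e0) // ler_pdivrMr ?mul1r; lra.
Qed.

Lemma state_weak_equation f psi : laplacian ell f psi ->
  innerG ell (u t) f = innerG ell (u 0) f +
    cintegral leb (oo 0 t) (fun s => ci * innerG ell (u s) psi - ci * innerG ell (cut_off omega h s) f).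
Proof.
move=> lap; have [fL psL] := laplacian_L2 lap.
have [i e] := control_pairing ho htL fL (cst1_bounded 0 t).
have i' : cintegrable leb (oo 0 t) (fun s => innerG ell (cut_off omega h s) f).
  by apply: (eq_cintegrable (mleb _)) i => s _; rewrite mul1r.
have forcedE : forced_part f = cintegral leb (oo 0 t) (fun s => innerG ell (cut_off omega h s) f).
  rewrite /forced_part; have -> : tensor (fun=> 1) f = tensor (fun=> conjc 1) f by rewrite conjc1.
  by rewrite -e; apply: eq_cintegral => s _; rewrite mul1r.
have := defect_laplacian lap; rewrite /defect forcedE /free_part.
rewrite (cintegralB (mleb _)); try by apply: (cintegrableZ (mleb _)) => //; exact: inner_cintegrable.
rewrite !(cintegralZ (mleb _)) //; last exact: inner_cintegrable.
set A := innerG _ _ _; set B := innerG _ _ _; set X := cintegral _ _ _; set Y := cintegral _ _ _ => e0.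
transitivity (B + (ci * X - ci * Y) + (A - B - ci * X + ci * Y)); first by ring.
by rewrite e0 addr0.
Qed.
End WeakEquation.

(** * Sufficiency and conclusion *)

Section Sufficiency.
Context {R : realType}.
Local Notation leb := (@lebesgue_measure R).
Local Notation mR := (measurableTypeR R).
Local Notation oo a b := (`]a, b[%classic : set R).

Lemma ae_eq0_of_normG n (ell : 'I_n -> R) (f : 'I_n -> R -> R[i]) : L2G ell f ->
  Re (innerG ell f f) = 0 -> eqG ell f (fun _ _ => 0).
Proof.
move=> fL; rewrite /innerG Re_sum => s0.
have ge0 j : 0 <= Re (cintegral leb (oo 0 (ell j)) (fun x => f j x * conjc (f j x))).
  by rewrite Re_cintegral; apply: Rintegral_ge0 => x _; rewrite Re_mulc_conj sqn_ge0.
move=> j; have mD := @mleb R (`]0, ell j[).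
have [m1 m2 fi] := fL j.
have /eqP := s0; rewrite psumr_eq0; last by move=> i _; exact: ge0.
move=> /allP /(_ j (mem_index_enum j)) /eqP; rewrite Re_cintegral => e0.
have fi' : integrableR leb (oo 0 (ell j)) (fun x => sqn (f j x)).
  by apply: (eq_integrable mD) fi => x _ /=; rewrite normc_sqn.
have e1 : \int[leb]_(x in oo 0 (ell j)) sqn (f j x) = 0.
  by apply: etrans e0; apply: eq_Rintegral => x _; rewrite Re_mulc_conj.
pose D : set mR := oo 0 (ell j).
have e2 : (\int[leb]_(x in D) `|(sqn (f j x))%:E| = 0)%E.
  apply: etrans (congr1 EFin e1); apply: etrans (EFin_Rintegral mD fi'); apply: eq_integral => x _.
  by rewrite /= ger0_norm // sqn_ge0.
have := (ae_eq_integral_abs leb mD (measurable_int leb fi')).1 e2.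
apply: filterS => x hx xD; apply: sqn_eq0.
by have [] := hx xD.
Qed.

Variables (lb lt : R).
Hypotheses (hb : 0 < lb) (ht : 0 < lt).
Local Notation ell := (@X_length R lb lt).
Local Notation al := (lt / lb).
Local Notation phi := (xphi lb lt).
Local Notation la := (xlam lb lt).

Lemma eqG_of_moments f g : L2G ell f -> L2G ell g ->
  (forall k, innerG ell f (phi k) = innerG ell g (phi k)) -> eqG ell f g.
Proof.
move=> fL gL e; have HG := L2G_hilbert ell; have dL := domB HG fL gL.
have := ae_eq0_of_normG dL (xphi_total hb ht dL _).
have z k : innerG ell (f - g) (phi k) = 0.
  by rewrite (ipB HG fL gL (xphi_L2G hb ht k)) e subrr.
move=> /(_ z) h j; apply: filterS (h j) => x hx xD.
by apply/eqP; rewrite -subr_eq0; apply/eqP; exact: hx.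
Qed.

Variables (omega : 'I_4 -> set R).
Hypotheses (ho : open_subset ell omega).
Hypotheses (ho0 : omega (inord 0) !=set0) (ho2 : omega (inord 2) !=set0).

(** Solve the moment problem dictated by Duhamel's formula at time [T], build the state driven by
    this control, and identify its initial and final values by their coefficients. *)
Lemma sufficiency : badly_approximable al -> exists2 T : R, 0 < T & exactly_controllable ell omega T.
Proof.
move=> ba; have [T T0 hT] := control_moments hb ht ho ho0 ho2 ba.
exists T => // u0 u1 u0L u1L; have HG := L2G_hilbert ell; have pL := xphi_L2G hb ht.
(* The value of [bcoef k T] for which the coefficient of the state at time [T] is that of [u1]. *)
pose d k := ci * (cexp (la k) T * innerG ell u1 (phi k) - innerG ell u0 (phi k)).
have orth := xphi_orthonormal hb ht.
have dB n : \sum_(k < n) sqn (d k) <= 2 * Re (innerG ell u1 u1) + 2 * Re (innerG ell u0 u0).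
  apply: (@le_trans _ _ (\sum_(k < n) (2 * sqn (innerG ell u1 (phi k)) + 2 * sqn (innerG ell u0 (phi k))))).
    apply: ler_sum => k _; rewrite /d sqnM.
    have -> : sqn (ci : R[i]) = 1 by rewrite /sqn /= expr0n expr1n add0r.
    rewrite mul1r; apply: (le_trans (sqnD_le _ _)).
    by rewrite sqnN sqnM sqn_cexp mul1r.
  by rewrite big_split /= -!mulr_sumr; apply: lerD; rewrite ler_wpM2l //; exact: (bessel HG pL orth).
have [h0 h0L hmom] := hT d _ dB.
(* Moving the real cutoff onto the control turns moments against damped waves into moments against
   the true eigenwaves. *)
pose h j (z : R * R) := cutoff T z.1 * h0 j z.
have hL : L2_control omega T h.
  move=> j; apply: (L2_bddM (cylinder_meas ho 0 T j) (a := fun z => cutoff T z.1) (f := h0 j)) => //.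
  exact: (@cbounded_fst _ _ mR mR R (oo 0 T) (omega j) (mleb _) _ (cutoff_bounded T 0 T)).
have [u hu] := state_exists hb ht ho hL u0L.
have zT : 0 <= (0 : R) <= T by rewrite lexx ltW.
have tT : 0 <= T <= T by rewrite lexx ltW.
exists h; split=> //; exists u; split.
- split; first exact: (state_continuous hb ht ho hL u0L hu).
  move=> f psi lap t; rewrite in_itv /= => tin.
  exact: (state_weak_equation hb ht ho T0 hL u0L hu tin lap).
- apply: eqG_of_moments => //; first exact: (hu 0 zT).1.
  by move=> k; rewrite (hu 0 zT).2 /ycoef cexp0 mul1r /zcoef bcoef0 mulr0 subr0.
- apply: eqG_of_moments => //; first exact: (hu T tT).1.
  move=> k; rewrite (hu T tT).2 /ycoef /zcoef.
  have -> : bcoef lb lt omega h k T = d k.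
    rewrite -[LHS]subr0 -(bcoef0 lb lt omega h k) (bcoef_increment hb ht ho hL k (lexx 0) (ltW T0) (lexx T)).
    rewrite -hmom; apply: eq_bigr => j _; apply: eq_cintegral => z _.
    have cr : conjc (cutoff T z.1) = cutoff T z.1 by exact: conjc_real.
    by rewrite /h /eigenwave /damped_wave /tensor !conjcM cr; ring.
  rewrite /d [ci * (ci * _)]mulrA ci_sqr.
  set b := innerG _ _ _; set a := innerG _ _ _.
  have -> : b - -1 * (cexp (la k) T * a - b) = cexp (la k) T * a by ring.
  by rewrite mulrA cexp_mulN mul1r.
Qed.
End Sufficiency.

Theorem theorem1p11 (R : realType) (ell_b ell_t : R) (hell_b : 0 < ell_b) (hell_t : 0 < ell_t)
    (omega : 'I_4 -> set R)
    (homega : open_subset (X_length ell_b ell_t) omega)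
    (homega1 : omega (inord 0) !=set0) (homega3 : omega (inord 2) !=set0)
    (homega2 : omega (inord 1) = set0) (homega4 : omega (inord 3) = set0) :
  (exists2 T : R, 0 < T & exactly_controllable (X_length ell_b ell_t) omega T) <->
  badly_approximable (ell_t / ell_b).
Proof.
split=> [[T T0 hT]|ba].
  exact: (necessity hell_b hell_t homega homega2 homega4 T0 hT).
exact: (sufficiency hell_b hell_t homega homega1 homega3 ba).
Qed.
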